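(* For each $\sigma>0$ let $\mu_\sigma$ be a stochastic Mather measure with diffusion rate $\sigma$ for the Lagrangian $L$. Then, as $\sigma\to0$, through some subsequence $\mu_\sigma\rightharpoonup\mu$ weakly, and the limit $\mu$ is a Mather measure: $\mu$ is a probability measure on $\Omega$ with $\int_\Omega v\cdot D_x\phi\,d\mu=0$ for all smooth periodic $\phi(x)$, and $\mu$ minimizes $\int_\Omega L\,d\mu$ among all such measures.
   Context: Let $\mathbb{T}^n=\mathbb{R}^n/\mathbb{Z}^n$ and $\Omega=\mathbb{T}^n\times\mathbb{R}^n$, with points $(x,v)$. The Lagrangian $L(x,v)$ is smooth in both variables, $\mathbb{Z}^n$-periodic in $x$, coercive and strictly convex in $v$, and $L\ge 0$. Fix a function $\gamma=\gamma(|v|):\Omega\to[1,+\infty)$ with $L(x,v)/\gamma(v)\to+\infty$ and $|v|/\gamma(v)\to 0$ as $|v|\to+\infty$. $C^0_\gamma(\Omega)$ is the space of continuous functions $\phi$ on $\Omega$ with $\|\phi\|_\gamma=\sup_\Omega|\phi/\gamma|<\infty$ and $\phi(x,v)/\gamma(v)\to 0$ as $|v|\to\infty$. $\mathcal{M}$ is the set of signed Radon measures $\mu$ on $\Omega$ with $\int_\Omega\gamma\,d|\mu|<\infty$; it is regarded (via integration) as the dual of $C^0_\gamma(\Omega)$. For $\sigma>0$ consider the controlled diffusion $dx=v\,dt+\sigma\,dw$, where $w$ is an $n$-dimensional Brownian motion, $v$ is a progressively measurable control and the process starts at some initial point. For each bounded control strategy $v$ and $T>0$ define $\mu_T$ by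 $\int\phi\,d\mu_T=\frac1T E\int_0^T\phi(x(t),v(t))\,dt$ for $\phi\in C^0_\gamma(\Omega)$, with $x(t)$ taken modulo $\mathbb{Z}^n$. A measure $\mu(v)$ is any weak-$*$ limit of $\mu_T$ along a sequence $T\to+\infty$. $\mathcal{M}_0$ (depending on $\sigma$) is the weak-$*$ closure of the set of all measures $\mu(v)$, $v$ a bounded control strategy. $\mathcal{M}_1=\{\mu\in\mathcal{M}:\mu\ge 0,\ \int_\Omega d\mu=1\}$. A stochastic Mather measure with diffusion rate $\sigma$ is a measure in $\mathcal{M}_0\cap\mathcal{M}_1$ that minimizes $\int_\Omega L\,d\mu$ over $\mathcal{M}_0\cap\mathcal{M}_1$. *)

(* Defs.v *)
From HB Require Import structures.
From mathcomp Require Import all_boot all_order all_algebra.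
From mathcomp Require Import all_classical all_reals all_analysis.
Import Order.TTheory GRing.Theory Num.Theory.
Import numFieldNormedType.Exports.

Set Implicit Arguments.
Unset Strict Implicit.
Unset Printing Implicit Defensive.

Local Open Scope classical_set_scope.
Local Open Scope ring_scope.

Definition lattice_eq (R : realType) (n : nat) : rel 'rV[R]_n :=
  fun x y => [forall i, x ord0 i - y ord0 i \is a Num.int].

Lemma lattice_eq_refl (R : realType) (n : nat) : reflexive (@lattice_eq R n).
Proof. by move=> x; apply/forallP => i; rewrite subrr. Qed.

Lemma lattice_eq_sym (R : realType) (n : nat) : symmetric (@lattice_eq R n).
Proof.
by move=> x y; apply: eq_forallb => i; rewrite -[LHS]rpredN opprB.
Qed.

Lemma lattice_eq_trans (R : realType) (n : nat) : transitive (@lattice_eq R n).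
Proof.
move=> y x z /forallP xy /forallP yz; apply/forallP => i.
by have := rpredD (xy i) (yz i); rewrite addrA subrK.
Qed.

Canonical lattice_equiv (R : realType) (n : nat) :=
  EquivRel (@lattice_eq R n) (@lattice_eq_refl R n) (@lattice_eq_sym R n)
           (@lattice_eq_trans R n).

Definition torus (R : realType) (n : nat) :=
  quotient_topology {eq_quot (@lattice_equiv R n)}%qT.

HB.instance Definition _ (R : realType) (n : nat) :=
  PointedTopological.on (torus R n).

HB.instance Definition _ (R : realType) (n : nat) :=
  Quotient.on (torus R n).

Definition to_torus (R : realType) (n : nat) (x : 'rV[R]_n) : torus R n :=
  (\pi_(torus R n) x)%qT.

Definition phase (R : realType) (n : nat) : Type := (torus R n * 'rV[R]_n)%type.

HB.instance Definition _ (R : realType) (n : nat) :=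
  Topological.copy (phase R n) (torus R n * 'rV[R]_n)%type.

HB.instance Definition _ (R : realType) (n : nat) :=
  isPointed.Build (phase R n) (point, point).

Definition bphase (R : realType) (n : nat) :=
  g_sigma_algebraType (@open (phase R n)).

HB.instance Definition _ (R : realType) (n : nat) :=
  Measurable.on (bphase R n).

(* The norm of the library on ['rV_n] is the sup norm. *)
Definition enorm (R : realType) (n : nat) (v : 'rV[R]_n) : R :=
  Num.sqrt (\sum_(i < n) v ord0 i ^+ 2).

(* Neighbourhoods of |v| = +oo, uniformly in x. *)
Definition vinfty (R : realType) (n : nat) : set_system (phase R n) :=
  filter_from setT (fun K : R => [set p : phase R n | K < enorm p.2]).

(* C^oo: the iterated directional derivatives of every order exist and are
   continuous. *)
Definition iter_derive (R : realType) (V : normedModType R) (f : V -> R)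
    (s : seq V) : V -> R :=
  foldr (fun v g => fun x => 'D_v g x) f s.

Definition smooth (R : realType) (V : normedModType R) (f : V -> R) : Prop :=
  forall s : seq V, continuous (iter_derive f s) /\
    forall x v, derivable (iter_derive f s) x v.

Definition lagrangian (R : realType) (n : nat) (L : phase R n -> R) : Prop :=
  [/\ smooth (fun p : 'rV[R]_n * 'rV[R]_n => L (to_torus p.1, p.2)),
      (L p / enorm p.2) @[p --> @vinfty R n] --> +oo,
      (forall (x : torus R n) (v v' : 'rV[R]_n) (t : R),
        v != v' -> 0 < t < 1 ->
        L (x, t *: v + (1 - t) *: v') < t * L (x, v) + (1 - t) * L (x, v'))
    & forall p, 0 <= L p].

(* The weight on the phase space is [weight g], for g : [0, +oo[ -> R.
   Measurability gives a meaning to the integral of the weight; boundedness on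
   bounded sets is what makes every compactly supported measure have a finite
   weighted mass, and holds when g is continuous. *)
Definition weight (R : realType) (n : nat) (g : R -> R) (p : phase R n) : R :=
  g (enorm p.2).

Definition weight_for (R : realType) (n : nat) (L : phase R n -> R)
    (g : R -> R) : Prop :=
  [/\ forall p : phase R n, 1 <= weight g p,
      measurable_fun setT (weight g : bphase R n -> R) /\
      (forall K : R, exists C : R, forall p : phase R n,
        enorm p.2 <= K -> weight g p <= C),
      (L p / weight g p) @[p --> @vinfty R n] --> +oo
    & (enorm p.2 / weight g p) @[p --> @vinfty R n] --> 0].

Definition C0w (R : realType) (n : nat) (g : R -> R) : set (phase R n -> R) :=
  [set phi : phase R n -> R | [/\ continuous phi,
      (exists C : R, forall p, `|phi p / weight g p| <= C)
    & (phi p / weight g p) @[p --> @vinfty R n] --> 0]].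

Notation smeasure R n := (charge (bphase R n) R).

Lemma hahn_pair (R : realType) (n : nat) (mu : smeasure R n) :
  {PN : set (bphase R n) * set (bphase R n) |
    hahn_decomposition mu PN.1 PN.2}.
Proof.
by apply: cid; have [P [N PN]] := Hahn_decomposition mu; exists (P, N).
Qed.

(* The Jordan decomposition does not depend on the Hahn decomposition chosen
   (cf. [Hahn_decomposition_uniq]). *)
Definition tot_var (R : realType) (n : nat) (mu : smeasure R n) :
    {measure set (bphase R n) -> \bar R} :=
  charge_variation (projT2 (hahn_pair mu)).

Definition charge_integral (R : realType) (n : nat) (mu : smeasure R n)
    (f : phase R n -> R) : \bar R :=
  (\int[jordan_pos (projT2 (hahn_pair mu))]_p (f p)%:E -
   \int[jordan_neg (projT2 (hahn_pair mu))]_p (f p)%:E)%E.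

(* Finite signed Borel measures on the phase space are automatically Radon. *)
Definition wmeasure_sub (R : realType) (n : nat) (g : R -> R) : Type :=
  {mu : smeasure R n | (\int[tot_var mu]_p (weight g p)%:E < +oo)%E}.

HB.instance Definition _ (R : realType) (n : nat) (g : R -> R) :=
  gen_eqMixin (@wmeasure_sub R n g).
HB.instance Definition _ (R : realType) (n : nat) (g : R -> R) :=
  gen_choiceMixin (@wmeasure_sub R n g).

Definition pairing (R : realType) (n : nat) (g : R -> R)
    (mu : @wmeasure_sub R n g) : {ptws (@C0w R n g) -> R} :=
  fun phi => fine (charge_integral (sval mu) (set_val phi)).

(* The coarsest topology for which mu |-> \int phi dmu is continuous for every
   phi in C0w. *)
Definition wmeasure (R : realType) (n : nat) (g : R -> R) : Type :=
  initial_topology (@pairing R n g).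

Definition smeasure_of (R : realType) (n : nat) (g : R -> R)
  (mu : @wmeasure R n g) : smeasure R n := sval mu.

Definition is_prob (R : realType) (n : nat) (mu : smeasure R n) : Prop :=
  (forall A, measurable A -> (0 <= mu A)%E) /\ mu setT = 1%E.

Section stochastic_data.
Context (R : realType) (n : nat) (d : measure_display) (W : measurableType d)
  (P : probability W R).
Implicit Types (F : R -> set (set W)) (w v : R -> W -> 'rV[R]_n).

(* All processes are indexed by R, but only times t >= 0 are relevant. *)
Definition filtration F : Prop :=
  [/\ forall t, 0 <= t -> sigma_algebra setT (F t),
      forall t, 0 <= t -> F t `<=` measurable
    & forall s t, 0 <= s <= t -> F s `<=` F t].

(* The increment over [s, t] is independent of F s, with independent
   coordinates of law N(0, t - s). *)
Definition brownian F w : Prop :=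
  [/\ {ae P, forall om, w 0 om = 0},
      forall om, {within `[0, +oo[, continuous (fun t => w t om)},
      forall (t : R) (i : 'I_n) (B : set R), 0 <= t -> measurable B ->
        F t [set om | B (w t om ord0 i)]
    & forall (s t : R) (A : set W) (B : 'I_n -> set R),
        0 <= s < t -> F s A -> (forall i, measurable (B i)) ->
        P (A `&` [set om | forall i, B i (w t om ord0 i - w s om ord0 i)]) =
        (P A * \prod_(i < n) normal_prob 0%R (Num.sqrt (t - s)%R) (B i))%E].

Definition progressive F v : Prop :=
  forall (t : R) (i : 'I_n), 0 <= t ->
    measurable_fun (`[0, t] `*` setT)
      (fun p : measurableTypeR R * g_sigma_algebraType (F t) =>
         v p.1 p.2 ord0 i).

Definition bounded_control F v : Prop :=
  progressive F v /\
  exists C : R, forall t om, 0 <= t -> enorm (v t om) <= C.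

(* Solution of dx = v dt + sigma dw, x(0) = x0. *)
Definition diffusion w (sigma : R) (x0 : 'rV[R]_n) v (t : R) (om : W) :
    'rV[R]_n :=
  \row_i (x0 ord0 i + \int[lebesgue_measure]_(s in `[0, t]) v s om ord0 i
          + sigma * w t om ord0 i).

Definition occupation (g : R -> R) w (sigma : R) (x0 : 'rV[R]_n) v (T : R)
    (mu : @wmeasure R n g) : Prop :=
  forall phi : phase R n -> R, C0w g phi ->
    charge_integral (smeasure_of mu) phi =
    (T^-1%:E * 'E_P[fun om => (\int[lebesgue_measure]_(t in `[0, T])
        phi (to_torus (diffusion w sigma x0 v t om), v t om))%R])%E.

(* The measures mu(v), for all bounded controls, initial points and sequences
   of times. *)
Definition limit_measures (g : R -> R) F w (sigma : R) :
    set (@wmeasure R n g) :=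
  [set mu | exists (x0 : 'rV[R]_n) v (T : nat -> R) (m : nat -> wmeasure n g),
    [/\ bounded_control F v, (forall k, 0 < T k) /\ T k @[k --> \oo] --> +oo,
        forall k, occupation w sigma x0 v (T k) (m k)
      & m k @[k --> \oo] --> mu]].

Definition M0 (g : R -> R) F w (sigma : R) : set (@wmeasure R n g) :=
  closure (limit_measures F w sigma).

Definition stochastic_mather (L : phase R n -> R) (g : R -> R) F w (sigma : R)
    (mu : @wmeasure R n g) : Prop :=
  [/\ M0 F w sigma mu, is_prob (smeasure_of mu)
    & forall nu : wmeasure n g, M0 F w sigma nu -> is_prob (smeasure_of nu) ->
      (charge_integral (smeasure_of mu) L <= charge_integral (smeasure_of nu) L)%E].

End stochastic_data.

(* The integral of v . D_x phi vanishes for all smooth periodic phi. If it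
   does, then |v| is integrable, since a difference of two infinite integrals
   is infinite here. *)
Definition holonomic (R : realType) (n : nat) (mu : smeasure R n) : Prop :=
  forall phi : torus R n -> R, smooth (phi \o @to_torus R n) ->
    charge_integral mu (fun p => \sum_(i < n) p.2 ord0 i *
      'D_(delta_mx ord0 i) (phi \o @to_torus R n) (repr p.1)) = 0%E.

Definition mather (R : realType) (n : nat) (L : phase R n -> R)
    (mu : smeasure R n) : Prop :=
  [/\ is_prob mu, holonomic mu
    & forall nu : smeasure R n, is_prob nu -> holonomic nu ->
      (charge_integral mu L <= charge_integral nu L)%E].

(* Main.v *)
From HB Require Import structures.
Require Import Defs.
From mathcomp Require Import all_boot all_order all_algebra.
From mathcomp Require Import all_classical all_reals all_analysis.
From mathcomp Require Import measurable_realfun.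
From mathcomp Require Import lra ring zify.
Import Order.TTheory GRing.Theory Num.Theory.
Import numFieldNormedType.Exports.

(** Fix eps > 0.  Value iteration for a discounted control problem on a lattice of the
    torus, with time step h and a small discount rate, produces a function u and a constant lam such
    that u(x + hv) - u(x) + h L(x, v) is at least h (lam - eps) for every admissible velocity v, and at
    most h (lam + 2 eps) for the optimal one v = V(x).

    Lower bound.  Smoothing u by a Fejer-type kernel gives a trigonometric polynomial phi with
    L + v . D phi >= lam - O(eps) everywhere, hence int L dnu >= lam - O(eps) for every holonomic
    probability nu.

    Upper bound.  The feedback control equal to V (lattice cell of x(kh)) on [kh, (k+1)h[ has average
    cost at most lam + O(eps) + C sigma, where only E |w_t - w_s| <= C for |t - s| <= 1 is used.  Its
    occupation measures accumulate at an element of M_0, so int L dmu_sigma <= lam + O(eps) for small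
    sigma.

    Since L / gamma tends to infinity, the measures mu_sigma are tight for the weight gamma and a
    subsequence converges; its limit is minimal by monotone convergence applied to min(L, N).  The
    limit is holonomic: on [kh, (k+1)h] the path whose noise is frozen at time kh is Lipschitz in time,
    so the ordinary chain rule shows that the time average of v . D phi is O(sigma), up to a
    contribution of large velocities which the superlinearity of L makes uniformly small. *)

Set Implicit Arguments.
Unset Strict Implicit.
Unset Printing Implicit Defensive.

Local Open Scope classical_set_scope.
Local Open Scope ring_scope.

(** * The torus and the phase space *)

(** Brownian motion enters only through the expected size of its increments: there is no stochastic
    integral, martingale argument or viscous Hamilton-Jacobi equation. What must be avoided is a
    constant depending on the bound of the control, since [M0] is a closure over controls with
    arbitrary bounds. Hence velocities are split at a level [K], the excess over [K] being paid by
    [L], and almost-holonomy is stated as an inequality between integrals of functions of [C0w],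
    which survives weak-* closure. With time step [1/p], velocities in multiples of [1/q] and mesh
    [1/(pq)], a step joins lattice points exactly and no interpolation error accumulates. The
    discounted value has oscillation at most [A], uniformly in the rate [al], so that [al * u] is
    nearly constant; this constant is [lam]. The kernel is fixed before the lattice is refined,
    hence its derivative bounds do not depend on [q]. The exact minimal cost is never identified:
    [lam] depends on [eps] and only squeezes, from below for holonomic measures and from above for
    [mu_sigma]. *)

Lemma coord_le_norm (R : realType) n (x : 'rV[R]_n) (i : 'I_n) :
  `|x ord0 i| <= `|x|.
Proof.
rewrite [leRHS]mx_normrE.
exact: (le_bigmax _ (fun ij => `|x ij.1 ij.2|) (ord0, i)).
Qed.

Lemma norm_rV_le (R : realType) n (x : 'rV[R]_n) (c : R) :
  0 <= c -> (forall i, `|x ord0 i| <= c) -> `|x| <= c.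
Proof.
move=> c0 xc; rewrite [leLHS]mx_normrE; apply: bigmax_le => // -[a b] _ /=.
by rewrite (ord1 a).
Qed.

Lemma norm_rV_lt (R : realType) n (x : 'rV[R]_n) (c : R) :
  0 < c -> (forall i, `|x ord0 i| < c) -> `|x| < c.
Proof.
move=> c0 xc; rewrite [ltLHS]mx_normrE; apply: bigmax_lt => // -[a b] _ /=.
by rewrite (ord1 a).
Qed.

Lemma enorm_ge0 (R : realType) n (v : 'rV[R]_n) : 0 <= enorm v.
Proof. exact: sqrtr_ge0. Qed.

Lemma norm_le_enorm (R : realType) n (v : 'rV[R]_n) : `|v| <= enorm v.
Proof.
apply: norm_rV_le; first exact: enorm_ge0.
move=> i; rewrite -sqrtr_sqr /enorm ler_wsqrtr// (bigD1 i)//= lerDl.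
by apply: sumr_ge0 => j _; exact: sqr_ge0.
Qed.

Lemma enorm_le_sum (R : realType) n (v : 'rV[R]_n) :
  enorm v <= \sum_(i < n) `|v ord0 i|.
Proof.
have [s0 ss] : 0 <= \sum_(i < n) `|v ord0 i| /\
    \sum_(i < n) v ord0 i ^+ 2 <= (\sum_(i < n) `|v ord0 i|) ^+ 2.
  elim/big_rec2: _ => [|i y z _ [z0 yz]]; first by rewrite expr0n.
  split; first by rewrite addr_ge0.
  rewrite sqrrD real_normK ?num_real//.
  have : 0 <= `|v ord0 i| * z by rewrite mulr_ge0.
  rewrite -mulr_natl; lra.
by rewrite -[leRHS](ger0_norm s0) -sqrtr_sqr /enorm ler_wsqrtr.
Qed.

Lemma enorm_le_norm (R : realType) n (v : 'rV[R]_n) :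
  enorm v <= n%:R * `|v|.
Proof.
apply: (le_trans (enorm_le_sum v)).
apply: le_trans (ler_sum _ (fun i _ => coord_le_norm v i)) _.
by rewrite sumr_const card_ord mulr_natl.
Qed.

Lemma rV_coord_continuous (R : realType) n (i : 'I_n) :
  continuous (fun v : 'rV[R]_n => v ord0 i).
Proof. exact: coord_continuous. Qed.

Lemma sum_continuous (R : realType) (T : topologicalType) (I : Type) (r : seq I)
    (F : I -> T -> R) :
  (forall i, continuous (F i)) -> continuous (fun x => \sum_(i <- r) F i x).
Proof.
move=> cF x; elim: r => [|i r IH].
  by under eq_fun do rewrite big_nil; exact: cvg_cst.
under eq_fun do rewrite big_cons.
exact: (cvgD (cF i x) IH).
Qed.

Lemma enorm_continuous (R : realType) n : continuous (@enorm R n).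
Proof.
move=> v; apply: (@continuous_comp _ _ _ (fun v : 'rV[R]_n => \sum_(i < n) v ord0 i ^+ 2) (@Num.sqrt R)); last exact: sqrt_continuous.
apply: sum_continuous => i {}v.
by apply: (@continuous_comp _ _ _ (fun v : 'rV[R]_n => v ord0 i) (fun x : R => x ^+ 2)); [exact: rV_coord_continuous|exact: exprn_continuous].
Qed.

Definition intv (R : realType) n (z : 'rV[int]_n) : 'rV[R]_n := \row_i (z ord0 i)%:~R.

Lemma lattice_eqP (R : realType) n (x y : 'rV[R]_n) :
  lattice_eq x y <-> exists z, x = y + intv R z.
Proof.
split=> [/forallP h|[z ->{x}]].
  exists (\row_i Num.floor (x ord0 i - y ord0 i)); apply/rowP => i.
  rewrite !mxE; have := h i; rewrite intrEfloor => /eqP ->; ring.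
by apply/forallP => i; rewrite !mxE addrAC subrr add0r intr_int.
Qed.

Lemma to_torusP (R : realType) n (x y : 'rV[R]_n) :
  to_torus x = to_torus y <-> lattice_eq x y.
Proof. by split=> [/eqmodP//|h]; apply/eqmodP. Qed.

Lemma to_torusD (R : realType) n (x : 'rV[R]_n) z : to_torus (x + intv R z) = to_torus x.
Proof. by apply/to_torusP/lattice_eqP; exists z. Qed.

Lemma to_torusK (R : realType) n (p : torus R n) : to_torus (repr p) = p.
Proof. exact: reprK. Qed.

Lemma to_torus_continuous (R : realType) n : continuous (@to_torus R n).
Proof. exact: pi_continuous. Qed.

(** The saturation of [U] is the union of its integer translates. *)
Lemma to_torus_open (R : realType) n (U : set 'rV[R]_n) :
  open U -> open (@to_torus R n @` U).
Proof.
move=> oU; rewrite /open/= /quotient_open.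
rewrite (_ : _ @^-1` _ = \bigcup_(z : 'rV[int]_n) ((fun x => x + intv R z) @^-1` U)).
  apply: bigcup_open => z _; apply: open_comp => // x _.
  exact: (cvgD (@cvg_id _ (nbhs x)) (@cvg_cst _ (intv R z) _ (nbhs x) _)).
apply/seteqP; split=> x /=.
  move=> [y Uy yx]; have /to_torusP/lattice_eqP[z yz] := yx.
  by exists z => //=; rewrite -yz.
move=> [z _ /= Uxz]; exists (x + intv R z) => //; exact: to_torusD.
Qed.

Definition lift (R : realType) n (p : 'rV[R]_n * 'rV[R]_n) : phase R n :=
  (to_torus p.1, p.2).

Lemma lift_continuous (R : realType) n : continuous (@lift R n).
Proof.
move=> p.
have h : {for p, continuous (fun p : 'rV[R]_n * 'rV[R]_n => to_torus p.1)}.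
  apply: (@continuous_comp _ _ _ fst (@to_torus R n)); first exact: cvg_fst.
  exact: to_torus_continuous.
exact: (cvg_pair h cvg_snd).
Qed.

(** The product of a quotient map with the identity need not be a quotient map; here it is one
    because [to_torus] is open. *)
Lemma phase_continuousP (R : realType) n (T : topologicalType) (f : phase R n -> T) :
  continuous f <-> continuous (f \o @lift R n).
Proof.
split=> [cf p|cf p].
  by apply: continuous_comp; [exact: lift_continuous|exact: cf].
move=> A /= nA.
have := cf (repr p.1, p.2); rewrite /continuous_at /= /lift /= to_torusK.
case: p nA => x v /= nA /(_ A nA) -[[/= U V] [nU nV] UV].
move: nU; rewrite nbhsE => -[U' [oU' U'x] U'U].
exists (@to_torus R n @` U', V) => /=.
  split=> //; apply: open_nbhs_nbhs; split; first exact: to_torus_open.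
  by exists (repr x) => //; exact: to_torusK.
move=> [y w] /= [[y' Uy' <-] Vw]; apply: (UV (y', w)); split => //=; exact: U'U.
Qed.

(** Only the first point is confined to [K]. This lets a representative in the unit cube be compared
    with a neighbour that falls outside the cube. *)
Lemma compact_ball_uniform (R : realType) (T : pseudoMetricType R) (F : T -> R) (K : set T) (eta : R) :
  compact K -> continuous F -> 0 < eta ->
  exists2 del : R, 0 < del & forall a b, K a -> ball a del b -> `|F a - F b| < eta.
Proof.
move=> cK cF eta0; have /compact_near_coveringP nc := cK.
have nK : \forall del \near 0^'+, K `<=` [set a | forall b, ball a del b -> `|F a - F b| < eta].
  apply: nc => x Kx.
  have e20 : 0 < eta / 2 by rewrite divr_gt0.
  have /nbhs_ballP[e /= e0 be] := cF x _ (nbhsx_ballx (F x) (eta / 2) e20).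
  have he0 : 0 < e / 2 by rewrite divr_gt0.
  exists (ball x (e / 2), [set del | del < e / 2]) => /=.
    by split; [exact: nbhsx_ballx|exact: nbhs_right_lt].
  move=> [x' del] /= [bx' de] b bb.
  have /be : ball x e x' by apply: le_ball bx'; move: e0; clear; lra.
  have /be : ball x e b.
    by rewrite (splitr e); apply: ball_triangle bx' _; apply: le_ball bb; exact: ltW.
  rewrite /ball/= /ball/= => h1 h2; rewrite (splitr eta).
  rewrite (_ : F x' - F b = (F x - F b) - (F x - F x')); last by ring.
  by rewrite (le_lt_trans (ler_normB _ _))// ltrD.
near (0 : R)^'+ => del.
exists del; first by near: del; exact: nbhs_right_gt.
move=> a b Ka; have : K `<=` [set a | forall b, ball a del b -> `|F a - F b| < eta] by near: del.
by move=> /(_ a Ka); apply.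
Unshelve. all: by end_near. Qed.

(** Cells of mesh [1/(N+1)]; the successor excludes a zero mesh. They serve to exhaust open sets
    and, later, as the cells observed by the feedback control. *)
Definition gridfl (R : realType) n (N : nat) (x : 'rV[R]_n) : 'rV[int]_n :=
  \row_i Num.floor (N.+1%:R * x ord0 i).

Lemma gridfl_dist (R : realType) n N (x y : 'rV[R]_n) :
  gridfl N x = gridfl N y -> `|x - y| <= N.+1%:R^-1.
Proof.
move=> xy; apply: norm_rV_le => // i; rewrite !mxE.
have : gridfl N x ord0 i = gridfl N y ord0 i by rewrite xy.
rewrite !mxE => e.
have := floor_le (N.+1%:R * x ord0 i); have := floorD1_gt (N.+1%:R * x ord0 i).
have := floor_le (N.+1%:R * y ord0 i); have := floorD1_gt (N.+1%:R * y ord0 i).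
rewrite e !intrD; set f := (_ %:~R) => h1 h2 h3 h4.
rewrite -[leRHS]mulr1 ler_pdivlMl// -[X in X * _](@ger0_norm _ N.+1%:R)// -normrM ler_norml; lra.
Qed.

Section meas.
Context (R : realType) (n : nat) d (T : measurableType d) (D : set T).
Hypothesis mD : measurable D.

Lemma measurable_gridfl (X : T -> 'rV[R]_n) N z :
  (forall i, measurable_fun D (fun t => X t ord0 i)) ->
  measurable (D `&` [set t | gridfl N (X t) = z]).
Proof.
move=> mX.
rewrite (_ : _ `&` _ = D `&` \bigcap_(i in [set: 'I_n]) (D `&` [set t | Num.floor (N.+1%:R * X t ord0 i) = z ord0 i])).
  apply: measurableI => //; apply: fin_bigcap_measurable => // i _.
  rewrite (_ : [set t | _] = (fun t => X t ord0 i) @^-1` `[(z ord0 i)%:~R / N.+1%:R, (z ord0 i + 1)%:~R / N.+1%:R[ ).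
    by apply: mX => //; exact: measurable_itv.
  apply/seteqP; split=> t /=; rewrite in_itv/= ler_pdivrMr// ltr_pdivlMr// [X t _ _ * _]mulrC.
    by move=> <-; rewrite floor_le floorD1_gt.
  by move=> /floor_def.
apply/seteqP; split=> t /= [Dt].
  by move=> <-; split => // i _; split => //; rewrite mxE.
by move=> h; split => //; apply/rowP => i; rewrite mxE; have [] := h i Logic.I.
Qed.

(** An open set is the union of the products of grid cells that it contains. There are countably
    many such products, and each is cut out by floors of coordinates, so coordinatewise
    measurability is enough. *)
Lemma measurable_pair_open (X V : T -> 'rV[R]_n) (O : set ('rV[R]_n * 'rV[R]_n)) :
  (forall i, measurable_fun D (fun t => X t ord0 i)) ->
  (forall i, measurable_fun D (fun t => V t ord0 i)) ->
  open O -> measurable (D `&` [set t | O (X t, V t)]).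
Proof.
move=> mX mV oO.
pose C N z z' := [set p : 'rV[R]_n * 'rV[R]_n | gridfl N p.1 = z /\ gridfl N p.2 = z'].
rewrite (_ : _ `&` _ = \bigcup_(a : nat * ('rV[int]_n * 'rV[int]_n))
   (if pselect (C a.1 a.2.1 a.2.2 `<=` O) then
   (D `&` [set t | gridfl a.1 (X t) = a.2.1]) `&` (D `&` [set t | gridfl a.1 (V t) = a.2.2])
   else set0)).
  apply: countable_bigcupT_measurable; first exact: countableP.
  move=> [N [z z']] /=; case: (pselect (C N z z' `<=` O)) => [_|_] //=.
  by apply: measurableI; exact: measurable_gridfl.
apply/seteqP; split=> t /=.
  move=> [Dt Ot]; have := open_nbhs_nbhs (conj oO Ot).
  move=> /nbhs_ballP[e /= e0 be].
  pose N := Num.truncn e^-1.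
  have Ne : N.+1%:R^-1 < e by rewrite invf_plt ?posrE//; exact: truncnS_gt.
  exists (N, (gridfl N (X t), gridfl N (V t))) => //=.
  case: (pselect (C _ _ _ `<=` O)) => //; apply.
  move=> [x v] [/= hx hv]; apply: be; split=> /=; rewrite mx_norm_ball /ball_ /=.
    by apply: le_lt_trans Ne; exact: gridfl_dist.
  by apply: le_lt_trans Ne; exact: gridfl_dist.
move=> [[N [z z']]] /= _; case: (pselect (C N z z' `<=` O)) => //= CO [[Dt h1] [_ h2]].
by split => //; exact: CO.
Qed.

Lemma measurable_fun_lift (X V : T -> 'rV[R]_n) :
  (forall i, measurable_fun D (fun t => X t ord0 i)) ->
  (forall i, measurable_fun D (fun t => V t ord0 i)) ->
  measurable_fun D (fun t => lift (X t, V t) : bphase R n).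
Proof.
move=> mX mV; apply: (@measurability _ _ _ (bphase R n) D _ (@open (phase R n))) => // _ [B oB <-].
rewrite (_ : _ @^-1` _ = [set t | (@lift R n @^-1` B) (X t, V t)])//.
apply: measurable_pair_open => //; apply: open_comp => // p _; exact: lift_continuous.
Qed.

Lemma measurable_fun_open (f : T -> R) :
  (forall O, open O -> measurable (D `&` f @^-1` O)) -> measurable_fun D f.
Proof.
move=> h; apply: (measurability (@RGenOpens.G R)).
  exact: RGenOpens.measurableE.
move=> _ [_ [a [b ->]] <-]; apply: h; exact: interval_open.
Qed.

Lemma measurable_fun_pair_continuous (X V : T -> 'rV[R]_n) (f : 'rV[R]_n * 'rV[R]_n -> R) :
  (forall i, measurable_fun D (fun t => X t ord0 i)) ->
  (forall i, measurable_fun D (fun t => V t ord0 i)) ->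
  continuous f -> measurable_fun D (fun t => f (X t, V t)).
Proof.
move=> mX mV cf; apply: measurable_fun_open => O oO.
apply: (measurable_pair_open (O := f @^-1` O)) => //; apply: open_comp => // p _; exact: cf.
Qed.

End meas.

Lemma phase_open_measurable (R : realType) n (O : set (phase R n)) :
  open O -> measurable (O : set (bphase R n)).
Proof. by move=> oO; apply: sub_sigma_algebra. Qed.

Lemma phase_continuous_measurable (R : realType) n (f : phase R n -> R) :
  continuous f -> measurable_fun setT (f : bphase R n -> R).
Proof.
move=> cf; apply: measurable_fun_open => O oO; rewrite setTI.
apply: phase_open_measurable; apply: open_comp => // p _; exact: cf.
Qed.

(** * Probability measures as charges *)

Section mkprob.
Context d (T : measurableType d) (R : realType) (m : {measure set T -> \bar R}).
Hypothesis m1 : m setT = 1%E.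
Definition mkprob of m setT = 1%E := (m : set T -> \bar R).
HB.instance Definition _ := Measure.on (mkprob m1).
HB.instance Definition _ := Measure_isProbability.Build _ _ _ (mkprob m1) m1.
Definition prob_of_measure : probability T R := mkprob m1.
End mkprob.

Section prob_charge.
Context (R : realType) (n : nat).
Implicit Types mu : smeasure R n.

Lemma jordan_neg_prob mu : is_prob mu -> forall A, measurable A ->
  jordan_neg (projT2 (hahn_pair mu)) A = 0%E.
Proof.
move=> [mu0 _] A mA; rewrite /jordan_neg /measure_of_charge /charge.cjordan_neg/=.
have [[mP _] [mN N0] _ _] := projT2 (hahn_pair mu).
rewrite /cscale /= /crestr0 mem_set// /crestr.
have mAN : measurable (A `&` (projT1 (hahn_pair mu)).2) by exact: measurableI.
have : mu (A `&` (projT1 (hahn_pair mu)).2) = 0%E.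
  by apply/eqP; rewrite eq_le mu0// andbT; apply: N0 => //; exact: subIsetr.
by move=> ->; rewrite mule0.
Qed.

Lemma jordan_pos_prob mu : is_prob mu -> forall A, measurable A ->
  jordan_pos (projT2 (hahn_pair mu)) A = mu A.
Proof.
move=> pmu A mA.
rewrite (jordan_decomp (projT2 (hahn_pair mu)) mA) /cadd/= /cscale/=.
by rewrite jordan_neg_prob// mule0 adde0.
Qed.

Lemma tot_var_prob mu : is_prob mu -> forall A, measurable A ->
  tot_var mu A = mu A.
Proof.
move=> pmu A mA.
change (jordan_pos (projT2 (hahn_pair mu)) A + jordan_neg (projT2 (hahn_pair mu)) A = mu A)%E.
by rewrite jordan_pos_prob// jordan_neg_prob// adde0.
Qed.

Lemma charge_integral_jordan mu (f : phase R n -> R) : is_prob mu ->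
  charge_integral mu f = (\int[jordan_pos (projT2 (hahn_pair mu))]_p (f p)%:E)%E.
Proof.
move=> pmu; rewrite /charge_integral [X in (_ - X)%E](_ : _ = 0%E) ?sube0//.
rewrite -(integral_measure_zero setT (fun p : bphase R n => (f p)%:E)).
by apply: eq_measure_integral => A mA _; exact: jordan_neg_prob.
Qed.

Lemma prob_charge mu : is_prob mu -> exists Q : probability (bphase R n) R,
  (forall A, measurable A -> Q A = mu A) /\
  forall f : phase R n -> R, charge_integral mu f = (\int[Q]_p (f p)%:E)%E.
Proof.
move=> pmu.
have h1 : jordan_pos (projT2 (hahn_pair mu)) setT = 1%E.
  by rewrite jordan_pos_prob//; case: pmu.
exists (prob_of_measure h1); split => [A mA|f].
  exact: jordan_pos_prob.
by rewrite charge_integral_jordan.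
Qed.

(** The way back from probabilities to weighted charges: the negative part of a nonnegative charge
    vanishes, so the integral against the charge is the ordinary one. *)
Lemma wmeasure_of_prob (g : R -> R) (Q : probability (bphase R n) R) :
  (\int[Q]_p (weight g p)%:E < +oo)%E ->
  exists mu : wmeasure n g, [/\ is_prob (smeasure_of mu),
    (forall A, measurable A -> smeasure_of mu A = Q A) &
    forall f : phase R n -> R, charge_integral (smeasure_of mu) f = (\int[Q]_p (f p)%:E)%E].
Proof.
move=> Qg.
pose c : smeasure R n := charge_of_finite_measure Q.
have pc : is_prob c by split => [A mA|]; [exact: measure_ge0|exact: probability_setT].
have cf (f : phase R n -> R) : charge_integral c f = (\int[Q]_p (f p)%:E)%E.
  rewrite charge_integral_jordan//; apply: eq_measure_integral => A mA _.
  exact: (jordan_pos_prob pc).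
have cg : (\int[tot_var c]_p (weight g p)%:E < +oo)%E.
  rewrite (eq_measure_integral Q)// => A mA _.
  exact: (tot_var_prob pc).
by exists (exist _ c cg : @wmeasure_sub R n g).
Qed.

Lemma pairing_continuous (g : R -> R) (phi : phase R n -> R) : C0w g phi ->
  continuous (fun mu : wmeasure n g => fine (charge_integral (smeasure_of mu) phi)).
Proof.
move=> Cphi mu.
pose phi' : C0w g := exist _ phi (mem_set Cphi).
have := @initial_continuous (@wmeasure_sub R n g) {ptws (@C0w R n g) -> R} (@pairing R n g) mu.
move=> h.
apply: (@continuous_comp _ _ _ (@pairing R n g : wmeasure n g -> {ptws (@C0w R n g) -> R}) (fun f : {ptws (@C0w R n g) -> R} => f phi')).
  exact: h.
exact: (@proj_continuous _ (fun _ => R) phi').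
Qed.

Lemma wmeasure_cvg (g : R -> R) (m : nat -> wmeasure n g) (mu : wmeasure n g) :
  (forall phi, C0w g phi -> fine (charge_integral (smeasure_of (m k)) phi) @[k --> \oo] -->
     fine (charge_integral (smeasure_of mu) phi)) ->
  m k @[k --> \oo] --> mu.
Proof.
move=> h A /= [_ [[B oB <-] /= Bmu BA]].
have /(_ B) : (@pairing R n g (m k) : {ptws (@C0w R n g) -> R}) @[k --> \oo] --> @pairing R n g mu.
  apply/cvg_sup => phi.
  (* The product topology is the supremum of the topologies pulled back by evaluations. Convergence
     for one of these is convergence of the values, because evaluation is surjective: constant
     functions reach every value. *)
  apply/cvg_image; first by apply/seteqP; split => // r _; exists (cst r).
  move=> U nU; have [phi0 phiP] := phi.
  have /(_ U) := h (set_val phi) (set_valP phi).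
  move=> /(_ nU) kU.
  exists ((fun f : {ptws (@C0w R n g) -> R} => f phi) @^-1` U) => //.
  apply/seteqP; split => [r [f /= fU <-//]|r Ur]; exists (cst r) => //.
move=> hB; have hk : \forall k \near \oo, B (pairing (m k)) by exact: hB (open_nbhs_nbhs (conj oB Bmu)).
have : \forall k \near \oo, A (m k) by apply: filterS hk => k; exact: BA.
by [].
Qed.

End prob_charge.

(** * Integrals of bounded functions *)

Lemma seq_cvgP (R : realType) (u : nat -> R) (l : R) :
  u k @[k --> \oo] --> l <->
  forall e, 0 < e -> exists N, forall k, (N <= k)%N -> `|u k - l| <= e.
Proof.
split=> [/cvgrPdist_le h e e0|h].
  have [N _ hN] := h e e0; exists N => k Nk; rewrite distrC; exact: hN.
apply/cvgrPdist_le => e e0; have [N hN] := h e e0.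
by exists N => // k /= Nk; rewrite distrC; exact: hN.
Qed.

Lemma seq_lim_ge (R : realType) (u : nat -> R) (l a : R) :
  u k @[k --> \oo] --> l -> (forall k, a <= u k) -> a <= l.
Proof.
move=> ul au; rewrite -(cvg_lim _ ul)//; apply: limr_ge; first by apply/cvg_ex; exists l.
by near=> k; exact: au.
Unshelve. all: by end_near. Qed.

Lemma seq_lim_le (R : realType) (u : nat -> R) (l a : R) :
  u k @[k --> \oo] --> l -> (forall k, u k <= a) -> l <= a.
Proof.
move=> ul au; rewrite -(cvg_lim _ ul)//; apply: limr_le; first by apply/cvg_ex; exists l.
by near=> k; exact: au.
Unshelve. all: by end_near. Qed.

Lemma seq_lim_eq (R : realType) (u v : nat -> R) (l m : R) :
  u k @[k --> \oo] --> l -> v k @[k --> \oo] --> m -> (forall k, u k = v k) -> l = m.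
Proof.
move=> ul vm uv; rewrite -(cvg_lim _ ul)// -(cvg_lim _ vm)//.
by congr (lim _); under eq_fun do rewrite uv.
Qed.

Lemma sum_cvg (R : realType) (I : Type) (r : seq I) (u : I -> nat -> R) (l : I -> R) :
  (forall i, u i k @[k --> \oo] --> l i) ->
  \sum_(i <- r) u i k @[k --> \oo] --> \sum_(i <- r) l i.
Proof.
move=> h; elim: r => [|i r IH].
  by under eq_fun do rewrite big_nil; rewrite big_nil; exact: cvg_cst.
under eq_fun do rewrite big_cons; rewrite big_cons.
exact: (cvgD (h i) IH).
Qed.

Lemma expr_half_lt (R : realType) (e : R) : 0 < e -> exists l : nat, 2 ^- l < e.
Proof.
move=> e0; have [N _ /(_ N (leqnn N))] := near_infty_natSinv_expn_lt (PosNum e0).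
by rewrite /= div1r => h; exists N.
Qed.

Lemma natr_large (R : realType) (x : R) : exists N : nat, x < N.+1%:R.
Proof. by exists (Num.truncn x); exact: truncnS_gt. Qed.

Lemma invn_small (R : realType) (e : R) : 0 < e -> exists N : nat, N.+1%:R^-1 < e.
Proof.
by move=> e0; exists (Num.truncn e^-1); rewrite invf_plt ?posrE//; exact: truncnS_gt.
Qed.

Section bounded_measurable.
Context (R : realType) d (T : measurableType d).
Implicit Types (mu : {measure set T -> \bar R}) (D : set T) (f g : T -> R).

(** Integrability side conditions are discharged by this class: it is stable under the algebraic
    operations, and its members are integrable for every finite measure. *)
Definition bm D f := measurable_fun D f /\ exists C, forall x, D x -> `|f x| <= C.

Lemma bm_integrable mu D f : measurable D -> (mu D < +oo)%E -> bm D f ->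
  mu.-integrable D (EFin \o f).
Proof.
move=> mD muD [mf [C fC]]; apply: measurable_bounded_integrable => //.
exists C; split; first exact: num_real.
by move=> y Cy x Dx /=; rewrite (le_trans (fC x Dx))// ltW.
Qed.

Lemma bmD D f g : bm D f -> bm D g -> bm D (fun x => f x + g x).
Proof.
move=> [mf [C fC]] [mg [C' gC]]; split; first exact: measurable_funD.
by exists (C + C') => x Dx; rewrite (le_trans (ler_normD _ _))// lerD ?fC ?gC.
Qed.

Lemma bmM D f g : bm D f -> bm D g -> bm D (fun x => f x * g x).
Proof.
move=> [mf [C fC]] [mg [C' gC]]; split; first exact: measurable_funM.
by exists (C * C') => x Dx; rewrite normrM ler_pM ?fC ?gC.
Qed.

Lemma bm_cst D (c : R) : bm D (fun=> c).
Proof. by split; [exact: measurable_cst|exists `|c|]. Qed.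

Lemma bmZ D (c : R) f : bm D f -> bm D (fun x => c * f x).
Proof. by move=> h; apply: bmM => //; exact: bm_cst. Qed.

Lemma bmN D f : bm D f -> bm D (fun x => - f x).
Proof. by move=> h; have := bmZ (-1) h; under eq_fun do rewrite mulN1r. Qed.

Lemma bmB D f g : bm D f -> bm D g -> bm D (fun x => f x - g x).
Proof. by move=> hf hg; apply: bmD => //; exact: bmN. Qed.

Lemma bm_norm D f : bm D f -> bm D (fun x => `|f x|).
Proof.
move=> [mf [C fC]]; split; first exact: measurableT_comp.
by exists C => x Dx; rewrite normr_id fC.
Qed.

Lemma bm_sum D (I : Type) (r : seq I) (f : I -> T -> R) :
  (forall i, bm D (f i)) -> bm D (fun x => \sum_(i <- r) f i x).
Proof.
move=> h; elim: r => [|i r IH].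
  by under eq_fun do rewrite big_nil; exact: bm_cst.
by under eq_fun do rewrite big_cons; exact: bmD.
Qed.

Lemma Rint_sum mu D (I : Type) (r : seq I) (f : I -> T -> R) :
  measurable D -> (mu D < +oo)%E -> (forall i, bm D (f i)) ->
  \int[mu]_(x in D) (\sum_(i <- r) f i x) = \sum_(i <- r) \int[mu]_(x in D) f i x.
Proof.
move=> mD muD h; elim: r => [|i r IH].
  under eq_Rintegral do rewrite big_nil.
  by rewrite big_nil Rintegral_cst// mul0r.
under eq_Rintegral do rewrite big_cons.
rewrite big_cons RintegralD ?IH//; apply: bm_integrable => //.
exact: bm_sum.
Qed.

Lemma Rint_le mu D f g : measurable D -> (mu D < +oo)%E -> bm D f -> bm D g ->
  (forall x, D x -> f x <= g x) -> \int[mu]_(x in D) f x <= \int[mu]_(x in D) g x.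
Proof. by move=> *; apply: le_Rintegral => //; exact: bm_integrable. Qed.

Lemma Rint_indic mu D (A : set T) : measurable D -> measurable A ->
  \int[mu]_(x in D) (\1_A x : R) = fine (mu (A `&` D)).
Proof. by move=> mD mA; rewrite /Rintegral integral_indic. Qed.

Lemma bm_indic D (A : set T) : measurable A -> bm D (fun x => \1_A x : R).
Proof.
move=> mA; split; first exact: measurable_indic.
by exists 1 => x _; rewrite indicE; case: (_ \in _); rewrite ?normr1 ?normr0.
Qed.

Variable Q : probability T R.

Lemma prob_fin D : measurable D -> (Q D < +oo)%E.
Proof. by move=> mD; rewrite (le_lt_trans (probability_le1 Q mD))// ltry. Qed.
Lemma prob_finT : (Q setT < +oo)%E.
Proof. exact: prob_fin. Qed.
Hint Resolve prob_finT : core.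

Lemma bm_integrableT f : bm setT f -> Q.-integrable setT (EFin \o f).
Proof. by move=> h; apply: bm_integrable => //; exact: prob_fin. Qed.

Lemma Rint_prob_cst (c : R) : \int[Q]_x c = c.
Proof. by rewrite Rintegral_cst// [X in fine X](_ : _ = 1%E) ?mulr1//; exact: probability_setT. Qed.

Lemma Rint_dist f g (eta : R) : bm setT f -> bm setT g ->
  (forall x, `|f x - g x| <= eta) -> `|\int[Q]_x f x - \int[Q]_x g x| <= eta.
Proof.
move=> bf bg h; rewrite -RintegralB//; [|exact: bm_integrableT..].
have bfg := bmB bf bg.
apply: (le_trans (le_normr_Rintegral _ _)) => //; first exact: bm_integrableT.
rewrite -[leRHS](Rint_prob_cst eta); apply: Rint_le => //.
- exact: bm_norm.
- exact: bm_cst.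
Qed.

(** Reduces an integral, up to [eta], to finitely many masses, so that convergence of masses will
    give convergence of integrals. *)
Lemma Rint_simple (W : finType) (e : T -> W) (c : W -> R) f (eta : R) :
  (forall w, measurable [set x | e x = w]) -> bm setT f ->
  (forall x, `|f x - c (e x)| <= eta) ->
  `|\int[Q]_x f x - \sum_w c w * fine (Q [set x | e x = w])| <= eta.
Proof.
move=> me bf h.
have ->: \sum_w c w * fine (Q [set x | e x = w]) =
   \int[Q]_x (\sum_w c w * \1_[set x | e x = w] x).
  rewrite Rint_sum//; last by move=> w; apply: bmZ; exact: bm_indic.
  apply: eq_bigr => w _; rewrite RintegralZl//; last by apply: bm_integrableT; exact: bm_indic.
  by rewrite Rint_indic// setIT.
apply: Rint_dist => //; first by apply: bm_sum => w; apply: bmZ; exact: bm_indic.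
move=> x; rewrite (bigD1 (e x))//= big1 ?addr0; last first.
  by move=> w wx; rewrite indicE memNset ?mulr0// => /= xw; rewrite xw eqxx in wx.
by rewrite indicE mem_set// mulr1.
Qed.

End bounded_measurable.

Section diagonal.
Context (R : realType).

Lemma increasing_ge (f : nat -> nat) : {homo f : k l / (k < l)%N} -> forall k, (k <= f k)%N.
Proof. by move=> hf; elim=> // k IH; apply: leq_ltn_trans IH (hf _ _ (ltnSn k)). Qed.

Lemma bounded_subseq (u : nat -> R) (C : R) : (forall k, `|u k| <= C) ->
  exists f : nat -> nat, {homo f : k l / (k < l)%N} /\ exists l : R, (u \o f) k @[k --> \oo] --> l.
Proof.
move=> uC; have bu : bounded_fun u.
  exists C; split; first exact: num_real.
  by move=> y Cy k _ /=; rewrite (le_trans (uC k))// ltW.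
have [f fi /cvg_ex[l ul]] := bolzano_weierstrass bu.
exists f; split; last by exists l.
by move=> k l' kl; have := fi l' k; rewrite !leEnat leqNgt [RHS]leqNgt kl /= => /negbFE.
Qed.

(** Cantor's diagonal: [s i] is the extraction after [i] rounds, and from rank [i.+1] on the
    sequence [s k k] runs through [s i.+1] at indices at least [k]. *)
Lemma diagonal_subseq (u : nat -> nat -> R) (C : R) : (forall i k, `|u i k| <= C) ->
  exists j : nat -> nat, {homo j : k l / (k < l)%N} /\
    forall i, exists l : R, u i (j k) @[k --> \oo] --> l.
Proof.
move=> uC.
(* The bound is placed inside the existence statement, so that the choice is defined for every [v]
   and [s] can be a plain recursion. *)
have H (v : nat -> R) : {f : nat -> nat | (forall k, `|v k| <= C) -> {homo f : k l / (k < l)%N} /\ exists l : R, (v \o f) k @[k --> \oo] --> l}.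
  apply: cid; case: (pselect (forall k, `|v k| <= C)) => [h|h].
    by have [f hf] := bounded_subseq h; exists f.
  by exists id.
pose nxt i (s : nat -> nat) := s \o sval (H (u i \o s)).
pose s := fix s i := if i is i'.+1 then nxt i' (s i') else id.
have step i : {homo sval (H (u i \o s i)) : k l / (k < l)%N} /\ exists l : R, u i (s i.+1 k) @[k --> \oo] --> l.
  by have := svalP (H (u i \o s i)); apply => k; exact: uC.
have tail i m : exists h : nat -> nat, {homo h : k l / (k < l)%N} /\ s (i + m)%N = s i \o h.
  elim: m => [|m [h [hh sh]]]; first by exists id; split=> //; rewrite addn0.
  exists (h \o sval (H (u (i + m)%N \o s (i + m)%N))); split.
    by move=> k l kl; apply: hh; apply: (step _).1.
  by rewrite addnS /= /nxt {1}sh.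
have incs i : {homo s i : k l / (k < l)%N}.
  by elim: i => [|i IH] k l kl //=; apply: IH; apply: (step i).1.
exists (fun k => s k k); split.
  apply: homo_ltn => [y x z|k]; first exact: ltn_trans.
  have := (step k).1 => hk; apply: (incs k).
  by apply: leq_trans (increasing_ge hk k.+1).
move=> i; have [_ [l /seq_cvgP ul]] := step i; exists l; apply/seq_cvgP => e /ul[N hN].
exists (maxn N i.+1) => k; rewrite geq_max => /andP[Nk ik].
have [h [hh sh]] := tail i.+1 (k - i.+1)%N.
rewrite subnKC// in sh; rewrite sh /=; apply: hN.
exact: leq_trans Nk (increasing_ge hh k).
Qed.

End diagonal.

(** * Random variables with prescribed dyadic masses *)

Section tree.
Context (R : realType) (p : seq bool -> R).
Hypothesis p_ge0 : forall w, 0 <= p w.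
Hypothesis p_nil : p [::] = 1.
Hypothesis p_split : forall w, p w = p (rcons w false) + p (rcons w true).

(** The unit interval is cut repeatedly in the proportions prescribed by [p]. The pair consists of
    the word of the depth [i] interval containing [s] and of the left end of that interval. *)
Fixpoint tree_node (s : R) (i : nat) : seq bool * R :=
  if i is i'.+1 then
    let wa := tree_node s i' in
    let b := wa.2 + p (rcons wa.1 false) <= s in
    (rcons wa.1 b, if b then wa.2 + p (rcons wa.1 false) else wa.2)
  else ([::], 0).

Definition tree_bit (s : R) (i : nat) : bool := last false (tree_node s i.+1).1.

Lemma tree_node_mkseq s l : (tree_node s l).1 = mkseq (tree_bit s) l.
Proof.
elim: l => //= l IH; rewrite mkseqS -IH; congr rcons.
by rewrite /tree_bit /= last_rcons.
Qed.

(** By induction on the last letter: the interval of [w] splits at [a + p (rcons w false)]. Since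
    lengths are the numbers [p w], the bits of a uniform [s] have joint law [p]. *)
Lemma tree_cell w : exists a, [/\ 0 <= a, a + p w <= 1 &
  forall s, 0 <= s < 1 ->
    ((tree_node s (size w)).1 = w -> (tree_node s (size w)).2 = a) /\
    ((tree_node s (size w)).1 = w <-> a <= s < a + p w)].
Proof.
elim/last_ind: w => [|w b [a [a0 a1 H]]].
  by exists 0; split => //; rewrite ?p_nil ?add0r// => s s01; rewrite ?p_nil.
exists (if b then a + p (rcons w false) else a).
have h1 := p_ge0 (rcons w false); have h2 := p_ge0 (rcons w true).
have h3 := p_split w.
split.
- by case: b; lra.
- by case: b; lra.
- move=> s s01; rewrite size_rcons /=; have [H1 H2] := H s s01; split.
    move=> /eqP; rewrite eqseq_rcons => /andP[/eqP e1 /eqP e2].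
    by rewrite e2 (H1 e1) e1.
  split.
    move=> /eqP; rewrite eqseq_rcons => /andP[/eqP e1 /eqP <-].
    have /andP[g1 g2] := H2.1 e1; rewrite (H1 e1) e1; case: (leP (a + p (rcons w false)) s); lra.
  move=> hb; have e1 : (tree_node s (size w)).1 = w by apply/H2; move: hb; case: b; lra.
  rewrite e1 (H1 e1); congr rcons; move: hb; case: b => /andP[g1 g2]; case: (leP (a + p (rcons w false)) s) => //; lra.
Qed.

End tree.

Section unit_prob.
Context (R : realType).

Definition U01_meas := mrestr (@lebesgue_measure R) (measurable_itv `[0, 1[).
HB.instance Definition _ := Measure.on U01_meas.
Let U01T : U01_meas setT = 1%E.
Proof. by rewrite /U01_meas /mrestr setTI lebesgue_measure_itv/= lte01 oppr0 adde0. Qed.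
HB.instance Definition _ := Measure_isProbability.Build _ _ _ U01_meas U01T.
Definition U01 : probability (measurableTypeR R) R := U01_meas.

Lemma U01_itv (a b : R) : 0 <= a -> a <= b -> b <= 1 ->
  U01 `[a, b[%classic = (b - a)%:E.
Proof.
move=> a0 ab b1.
change (lebesgue_measure (`[a, b[%classic `&` `[0, 1[%classic) = (b - a)%:E :> \bar R).
rewrite setIidl; last first.
  by move=> x /=; rewrite !in_itv/= => /andP[h1 h2]; apply/andP; split; lra.
rewrite lebesgue_measure_itv/= lte_fin; case: ltP => h; first by rewrite EFinB.
by congr EFin; lra.
Qed.

Lemma U01_setIU (A : set R) : U01 A = U01 (A `&` `[0, 1[%classic).
Proof.
change (lebesgue_measure (A `&` `[0, 1[%classic) =
  lebesgue_measure (A `&` `[0, 1[%classic `&` `[0, 1[%classic) :> \bar R).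
by rewrite -setIA setIid.
Qed.

End unit_prob.

Section code_limit.
Context (R : realType) d (T : measurableType d) (Q : nat -> probability T R).
Context (B : nat -> set T).
Hypothesis mB : forall i, measurable (B i).

Let code (x : T) (i : nat) : bool := x \in B i.

Lemma measurable_code l w : measurable [set x | mkseq (code x) l = w].
Proof.
elim: l w => [|l IH] w.
  case: (pselect ([::] = w)) => h.
    by rewrite (_ : [set x | _] = setT)//; apply/seteqP; split.
  by rewrite (_ : [set x | _] = set0)//; apply/seteqP; split.
elim/last_ind: w => [|w b _].
  by rewrite (_ : [set x | _] = set0)//; apply/seteqP; split=> x //=; rewrite mkseqS; case: mkseq.
rewrite (_ : [set x | _] = [set x | mkseq (code x) l = w] `&` (if b then B l else ~` B l)).
  by apply: measurableI => //; case: b => //; exact: measurableC.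
apply/seteqP; split => x /=; rewrite mkseqS.
  move=> /eqP; rewrite eqseq_rcons => /andP[/eqP -> /eqP <-]; split=> //.
  by rewrite /code; case: (boolP (x \in B l)) => [/set_mem//|/negP h] /= Bx; apply: h; exact/mem_set.
move=> [-> h]; congr rcons; case: b h => h; first exact/mem_set.
by apply/negbTE; apply/negP => /set_mem.
Qed.

(** Along a diagonal subsequence the masses of all finite words converge, and the limits inherit the
    consistency relation between a word and its two extensions. Realising them by intervals makes
    the limit an image of Lebesgue measure, so its countable additivity needs no proof. *)
Lemma code_limit : exists (j : nat -> nat) (E : R -> nat -> bool),
  [/\ {homo j : k l / (k < l)%N},
   forall l w, measurable [set s : measurableTypeR R | mkseq (E s) l = w] &
   forall w, fine (Q (j k) [set x | mkseq (code x) (size w) = w]) @[k --> \oo] -->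
     fine (U01 R [set s | mkseq (E s) (size w) = w])].
Proof.
pose u i k := if unpickle i is Some w then fine (Q k [set x | mkseq (code x) (size w) = w]) else 0.
have uC i k : `|u i k| <= 1.
  rewrite /u; case: (unpickle i) => [w|]; last by rewrite normr0.
  have mA := measurable_code (size w) w.
  rewrite ger0_norm ?fine_ge0//.
  have := probability_le1 (Q k) mA.
  by rewrite -(@fineK _ (Q k _)) ?fin_num_measure// lee_fin.
have [j [hj ul]] := diagonal_subseq uC.
have pw w : {l : R | fine (Q (j k) [set x | mkseq (code x) (size w) = w]) @[k --> \oo] --> l}.
  by apply: cid; have [l] := ul (pickle w); rewrite /u pickleK => h; exists l.
pose p w := sval (pw w).
have pwP w : fine (Q (j k) [set x | mkseq (code x) (size w) = w]) @[k --> \oo] --> p w := svalP (pw w).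
have p0 w : 0 <= p w.
  by apply: seq_lim_ge (pwP w) _ => k; rewrite fine_ge0.
have p1 : p [::] = 1.
  apply: (@seq_lim_eq R _ (fun=> 1) _ _ (pwP [::])) => [|k]; first exact: cvg_cst.
  by rewrite (_ : [set x | _] = setT) ?probability_setT//; apply/seteqP; split.
have ps w : p w = p (rcons w false) + p (rcons w true).
  apply: (@seq_lim_eq R _ (fun k => fine (Q (j k) [set x | mkseq (code x) (size (rcons w false)) = rcons w false]) + fine (Q (j k) [set x | mkseq (code x) (size (rcons w true)) = rcons w true])) _ _ (pwP w)) => [|k].
    exact: (cvgD (pwP (rcons w false)) (pwP (rcons w true))).
  rewrite -fineD ?fin_num_measure//; [|exact: measurable_code..].
  rewrite -measureU//; [|exact: measurable_code..|].
    congr (fine (_ _)); apply/seteqP; split => x /=; rewrite !size_rcons !mkseqS.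
      by move=> ->; case: (code x (size w)); [right|left].
    by case=> /eqP; rewrite eqseq_rcons => /andP[/eqP-> _].
  apply/seteqP; split => x //= -[]; rewrite !size_rcons !mkseqS => -> /eqP.
  by rewrite eqseq_rcons andbF.
(* The value outside the unit interval is arbitrary, as [U01] does not charge it; a constant keeps
   the map measurable. *)
exists j, (fun s => if 0 <= s < 1 then tree_bit p s else fun=> false).
have key w : [set s | mkseq (if 0 <= s < 1 then tree_bit p s else fun=> false) (size w) = w] `&` `[0,1[%classic
  = `[projT1 (cid (tree_cell p0 p1 ps w)), projT1 (cid (tree_cell p0 p1 ps w)) + p w[%classic.
  move: (cid _) => [a [a0 a1 H]] /=.
  apply/seteqP; split=> s /=; rewrite !in_itv/=.
    move=> [h s01]; move: h; rewrite s01 -tree_node_mkseq.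
    by have [_ ->] := H s s01.
  move=> h; have s01 : 0 <= s < 1 by apply/andP; move: h => /andP[]; lra.
  split=> //; rewrite s01 -tree_node_mkseq; by have [_ ->] := H s s01.
split=> //.
  move=> l w; case: (eqVneq l (size w)) => [->|lw]; last first.
    rewrite (_ : [set s | _] = set0)//; apply/seteqP; split=> s //= e.
    by move: lw; rewrite -e size_mkseq eqxx.
  pose S := [set s : measurableTypeR R | mkseq (if 0 <= s < 1 then tree_bit p s else fun=> false) (size w) = w].
  rewrite -/S (_ : S = (S `&` `[0,1[%classic) `|` (if mkseq (fun=> false) (size w) == w then ~` `[0,1[%classic else set0)); last first.
    apply/seteqP; split=> s /=.
      move=> Ss; case: (boolP (0 <= s < 1)) => s01; first by left; rewrite in_itv.
      right; rewrite /S /= (negbTE s01) in Ss; rewrite Ss eqxx /= in_itv/=; exact/negP.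
    move=> [[]//|]; case: eqP => //= h; rewrite in_itv/= => /negP/negbTE s01.
    by rewrite /S/= s01.
  apply: measurableU; first by rewrite key; exact: measurable_itv.
  by case: eqP => //= _; apply: measurableC; exact: measurable_itv.
move=> w; rewrite U01_setIU key; move: (cid _) => [a [a0 a1 H]] /=.
rewrite U01_itv//; last by rewrite lerDl.
by rewrite addrAC subrr add0r /=; exact: pwP.
Qed.

End code_limit.

(** * Binary expansions in the closed unit interval *)

Section digits.
Context (R : realType).

(** Greedy binary digits: the remainder is [2 ^+ l] times the error of the first [l] digits. It
    stays in the closed interval, the point [1] being expanded with all digits equal to one. *)
Fixpoint drem (y : R) (l : nat) : R :=
  if l is l'.+1 then 2 * drem y l' - (if (2^-1 <= drem y l')%R then 1 else 0) else y.

Definition dig (y : R) (l : nat) : bool := 2^-1 <= drem y l.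

Definition dsum (b : nat -> bool) (l : nat) : R := \sum_(i < l) (b i)%:R / 2 ^+ i.+1.

Lemma drem_itv y l : 0 <= y <= 1 -> 0 <= drem y l <= 1.
Proof.
move=> y01; elim: l => //= l IH.
by case: (leP 2^-1 (drem y l)) => h; lra.
Qed.

Lemma digE y l : y = dsum (dig y) l + drem y l / 2 ^+ l.
Proof.
elim: l => [|l IH]; first by rewrite /dsum big_ord0 add0r expr0 divr1.
rewrite {1}IH /dsum big_ord_recr /= -addrA; congr (_ + _).
have -> : (if 2^-1 <= drem y l then 1 else 0) = (dig y l)%:R :> R by rewrite /dig; case: ifP.
rewrite exprS; field.
by rewrite expf_neq0// pnatr_eq0.
Qed.

Lemma dig_dist y l : 0 <= y <= 1 -> `|y - dsum (dig y) l| <= 2 ^- l.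
Proof.
move=> y01; rewrite {1}(digE y l) addrAC subrr add0r.
have /andP[h1 h2] := drem_itv l y01.
rewrite ger0_norm ?divr_ge0 ?exprn_ge0// ler_pdivrMr ?exprn_gt0//.
by rewrite mulVf// expf_neq0// pnatr_eq0.
Qed.

Lemma dsumS b l : dsum b l.+1 = dsum b l + (b l)%:R / 2 ^+ l.+1.
Proof. by rewrite /dsum big_ord_recr. Qed.

Lemma dsum_ge0 b l : 0 <= dsum b l.
Proof. by apply: sumr_ge0 => i _; rewrite divr_ge0// exprn_ge0. Qed.

Lemma dsum_homo b : {homo dsum b : k l / (k <= l)%N >-> k <= l}.
Proof.
apply: homo_leq => [x|x y z|l]; [exact: lexx|exact: le_trans|].
by rewrite dsumS lerDl divr_ge0// exprn_ge0.
Qed.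

Lemma dsum_le b k l : (k <= l)%N -> dsum b l <= dsum b k + 2 ^- k - 2 ^- l.
Proof.
move=> /subnK <-; elim: (l - k)%N => [|m IH]; first by rewrite add0n; lra.
rewrite addSn dsumS.
have h : (b (m + k)%N)%:R / 2 ^+ (m + k).+1 <= (2 ^+ (m + k).+1)^-1 :> R.
  by rewrite ler_piMl// ?invr_ge0 ?exprn_ge0//; case: (b _).
have h2 : 2 ^- (m + k) = 2 * (2 ^+ (m + k).+1)^-1 :> R.
  by rewrite exprS invfM mulrA divff ?mul1r// pnatr_eq0.
lra.
Qed.

Definition dlim (b : nat -> bool) : R := limn (dsum b).

Lemma dsum_cvg b : cvgn (dsum b).
Proof.
apply: nondecreasing_is_cvgn; first exact: dsum_homo.
exists 1 => _ [l _ <-]; have := dsum_le b (leq0n l); rewrite {2}/dsum big_ord0 expr0 invr1 add0r.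
have : 0 <= 2 ^- l :> R by rewrite invr_ge0 exprn_ge0.
lra.
Qed.

Lemma dlim_dist b l : `|dlim b - dsum b l| <= 2 ^- l.
Proof.
have h1 : dsum b l <= dlim b.
  exact: (nondecreasing_cvgn_le (@dsum_homo b) (dsum_cvg (b := b))).
rewrite ger0_norm ?subr_ge0// lerBlDl.
apply: limr_le; first exact: dsum_cvg.
exists l => // k /= lk; have := dsum_le b lk.
have : 0 <= 2 ^- k :> R by rewrite invr_ge0 exprn_ge0.
lra.
Qed.

Lemma dlim_itv b : 0 <= dlim b <= 1.
Proof.
have := dlim_dist b 0; rewrite /dsum big_ord0 subr0 expr0 invr1 ler_norml => /andP[_ ->].
rewrite andbT; apply: limr_ge; first exact: dsum_cvg.
by near=> k; exact: dsum_ge0.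
Unshelve. all: by end_near. Qed.

Lemma dsum_itv b l : 0 <= dsum b l <= 1.
Proof.
rewrite dsum_ge0 /=; have /andP[_] := dlim_itv b; apply: le_trans.
exact: (nondecreasing_cvgn_le (@dsum_homo b) (dsum_cvg (b := b))).
Qed.

Lemma eq_dsum b b' l : (forall i, (i < l)%N -> b i = b' i) -> dsum b l = dsum b' l.
Proof. by move=> h; apply: eq_bigr => i _; rewrite h. Qed.

End digits.

(** * Weak limits of laws on a finite-dimensional cube *)

Section cube_limit.
Context (R : realType) d (T : measurableType d) (Q : nat -> probability T R).
Context (I : finType) (Y : I -> T -> R).
Hypothesis mY : forall c, measurable_fun setT (Y c).
Hypothesis Y01 : forall c x, 0 <= Y c x <= 1.

(** Enumerates the pairs of a coordinate and a digit position, so that a single bit sequence encodes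
    a point of the cube. *)
Let B (i : nat) : set T :=
  if @unpickle (I * nat)%type i is Some cl then [set x | dig (Y cl.1 x) cl.2] else set0.

Let mdrem c l : measurable_fun setT (fun x => drem (Y c x) l).
Proof.
elim: l => [|l IH] //=.
apply: measurable_funB; first by apply: measurable_funM => //; exact: measurable_cst.
apply: measurable_fun_ifT; [|exact: measurable_cst..].
by apply: measurable_fun_ler => //; exact: measurable_cst.
Qed.

Let mB i : measurable (B i).
Proof.
rewrite /B; case: unpickle => // -[c l] /=.
have := @measurable_fun_ler _ _ _ setT (cst 2^-1) (fun x => drem (Y c x) l) (@measurable_cst _ _ _ _ _ _) (mdrem c l).
move=> /(_ measurableT [set true] Logic.I); rewrite setTI.
by congr measurable; apply/seteqP; split=> x /=.
Qed.

(** Up to [eta], [Phi] depends only on finitely many digits, that is on a finite word, and the mass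
    of each word converges. The limit [X] lives in the closed cube: it may lie on a face that no [Y]
    reaches, so escape of mass has to be excluded separately. *)
Lemma cube_limit : exists (j : nat -> nat) (X : I -> R -> R),
  [/\ {homo j : k l / (k < l)%N},
   forall c, measurable_fun setT (X c : measurableTypeR R -> R),
   forall c s, 0 <= X c s <= 1 &
   forall Phi : (I -> R) -> R,
     (forall eta, 0 < eta -> exists l : nat, forall y y', (forall c, 0 <= y c <= 1) ->
        (forall c, 0 <= y' c <= 1) -> (forall c, `|y c - y' c| <= 2 ^- l) ->
        `|Phi y - Phi y'| <= eta) ->
     bm setT (fun x => Phi (Y^~ x)) ->
     bm setT ((fun s => Phi (X^~ s)) : measurableTypeR R -> R) ->
     \int[Q (j k)]_x Phi (Y^~ x) @[k --> \oo] --> \int[U01 R]_s Phi (X^~ s)].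
Proof.
have [j [E [hj mE cE]]] := code_limit Q mB.
pose X (c : I) s := dlim R (fun l => E s (pickle (c, l))).
have mword (f : seq bool -> R) l : measurable_fun setT ((fun s => f (mkseq (E s) l)) : measurableTypeR R -> R).
  move=> _ A mA; rewrite setTI.
  rewrite (_ : _ @^-1` _ = \bigcup_(w : seq bool) (if f w \in A then [set s | mkseq (E s) l = w] else set0)).
    apply: countable_bigcupT_measurable; first exact: countableP.
    by move=> w; case: ifP => // _; exact: mE.
  apply/seteqP; split=> s /=; first by move=> As; exists (mkseq (E s) l) => //; rewrite mem_set.
  by move=> [w _]; case: ifP => // /set_mem Aw /= ->.
exists j, X; split=> //.
- move=> c.
  apply: (@measurable_realfun.measurable_fun_cvg _ _ _ _ (fun l s => dsum R (fun l => E s (pickle (c, l))) l)).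
    move=> l.
    pose N := (\max_(i < l) (pickle (c, nat_of_ord i)).+1)%N.
    have := mword (fun w => dsum R (fun l => nth false w (pickle (c, l))) l) N.
    congr (measurable_fun _ _); apply/funext => s; apply: eq_dsum => i il.
    rewrite nth_mkseq//; exact: (leq_bigmax (F := fun i : 'I_l => (pickle (c, nat_of_ord i)).+1) (Ordinal il)).
  by move=> s _; exact: dsum_cvg.
- by move=> c s; exact: dlim_itv.
move=> Phi uPhi bY bX.
apply/seq_cvgP => e e0.
have e30 : 0 < e / 3 by rewrite divr_gt0.
have [l hl] := uPhi _ e30.
(* [N] exceeds the codes of the first [l] digits of all coordinates, so that these digits can be
   read off a word of length [N]. *)
pose N := (\max_(ci : I * 'I_l) (pickle (ci.1, nat_of_ord ci.2)).+1)%N.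
pose cw (w : seq bool) := Phi (fun c => dsum R (fun l => nth false w (pickle (c, l))) l).
have NP (c : I) i : (i < l)%N -> (pickle (c, i) < N)%N.
  by move=> il; rewrite /N (bigD1 (c, Ordinal il))//= leq_max leqnn.
pose eT (x : T) : N.-tuple bool := [tuple of mkseq (fun i => x \in B i) N].
pose eS (s : measurableTypeR R) : N.-tuple bool := [tuple of mkseq (E s) N].
have eTE w : [set x | eT x = w] = [set x | mkseq (fun i => x \in B i) (size w) = w :> seq bool].
  by apply/seteqP; split => x /=; rewrite size_tuple => h; [rewrite -h|apply: val_inj].
have eSE w : [set x | eS x = w] = [set x | mkseq (E x) (size w) = w :> seq bool].
  by apply/seteqP; split => x /=; rewrite size_tuple => h; [rewrite -h|apply: val_inj].
have hT k : `|\int[Q (j k)]_x Phi (Y^~ x) - \sum_(w : N.-tuple bool) cw w * fine (Q (j k) [set x | eT x = w])| <= e / 3.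
  apply: (@Rint_simple _ _ _ _ _ eT (fun w => cw w)) => //.
    by move=> w; rewrite eTE; exact: measurable_code.
  move=> x; apply: hl => // c; first exact: dsum_itv.
  rewrite (_ : dsum _ _ _ = dsum R (dig (Y c x)) l); first exact: dig_dist.
  apply: eq_dsum => i il; rewrite nth_mkseq ?NP// /B pickleK /=.
  by case: (boolP (dig _ _)) => h; [rewrite mem_set|rewrite memNset//=; exact/negP].
have hS : `|\int[U01 R]_x Phi (X^~ x) - \sum_(w : N.-tuple bool) cw w * fine (U01 R [set x | eS x = w])| <= e / 3.
  apply: (@Rint_simple _ _ _ _ _ eS (fun w => cw w)) => //.
    by move=> w; rewrite eSE; exact: mE.
  move=> s; apply: hl => c; [exact: dlim_itv|exact: dsum_itv|].
  rewrite (_ : dsum _ _ _ = dsum R (fun l => E s (pickle (c, l))) l); first exact: dlim_dist.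
  by apply: eq_dsum => i il; rewrite nth_mkseq ?NP.
have : \sum_(w : N.-tuple bool) cw w * fine (Q (j k) [set x | eT x = w]) @[k --> \oo] -->
       \sum_(w : N.-tuple bool) cw w * fine (U01 R [set x | eS x = w]).
  apply: sum_cvg => w.
  apply: cvgM; first exact: cvg_cst.
  by rewrite eSE; under eq_fun do rewrite eTE; exact: cE.
move=> /seq_cvgP/(_ _ e30)[K hK]; exists K => k /hK.
move: (hT k) hS; set a := \int[_]_x _; set b := \sum_w _; set c := \int[_]_x _; set f := \sum_w _.
rewrite !ler_norml => /andP[? ?] /andP[? ?] /andP[? ?]; apply/andP; split; lra.
Qed.

End cube_limit.

(** * Uniform continuity and weights on the phase space *)

Section phase_extra.
Context (R : realType) (n : nat).
Implicit Types (f : phase R n -> R) (p : phase R n).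

Lemma phase_open (A : set (phase R n)) : open (@lift R n @^-1` A) -> open A.
Proof.
rewrite !openE => oA [x v] Axv.
have /oA : (@lift R n @^-1` A) (repr x, v) by rewrite /= /lift/= to_torusK.
move=> [[/= U V] [nU nV] UV].
move: nU; rewrite nbhsE => -[U' [oU' U'x] U'U].
exists (@to_torus R n @` U', V) => /=.
  split=> //; apply: open_nbhs_nbhs; split; first exact: to_torus_open.
  by exists (repr x) => //; exact: to_torusK.
move=> [y w] /= [[y' Uy' <-] Vw]; apply: (UV (y', w)); split => //=; exact: U'U.
Qed.

(** Does not depend on the representative, by [fr_lift]. It is discontinuous, but the coding of
    points by bits asks only for measurability. *)
Definition fr (c : 'I_n) (p : phase R n) : R :=
  repr p.1 ord0 c - (Num.floor (repr p.1 ord0 c))%:~R.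

Lemma fr_itv c p : 0 <= fr c p < 1.
Proof.
have := floor_le (repr p.1 ord0 c); have := floorD1_gt (repr p.1 ord0 c).
by rewrite /fr intrD; lra.
Qed.

Lemma lift_fr p : lift (\row_c fr c p, p.2) = p.
Proof.
case: p => x v; rewrite /lift /=; congr pair.
rewrite -[RHS]to_torusK -[RHS](to_torusD _ (\row_c - Num.floor (repr x ord0 c))).
by congr to_torus; apply/rowP => c; rewrite !mxE mulrNz.
Qed.

Lemma fr_lift c (x v : 'rV[R]_n) : fr c (lift (x, v)) = x ord0 c - (Num.floor (x ord0 c))%:~R.
Proof.
have /to_torusP/lattice_eqP[z zE] : to_torus (repr (to_torus x)) = to_torus x by exact: to_torusK.
rewrite /fr /lift /= zE !mxE floorDrz ?intr_int// intrKfloor intrD; ring.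
Qed.

(** Although [fr] jumps at integers, these sets pull back to unions of open strips; their
    differences give all the superlevel sets needed for measurability. *)
Lemma fr_open c (q : R) : q <= 1 -> open [set p | 0 < fr c p < q].
Proof.
move=> q1; apply: phase_open.
rewrite (_ : _ @^-1` _ = \bigcup_(k : int) [set p : 'rV[R]_n * 'rV[R]_n | p.1 ord0 c \in `]k%:~R, k%:~R + q[ ]).
  apply: bigcup_open => k _.
  rewrite (_ : [set p | _] = (fun p : 'rV[R]_n * 'rV[R]_n => p.1 ord0 c) @^-1` `]k%:~R, k%:~R + q[%classic)//.
  apply: open_comp; last exact: interval_open.
  move=> p _; apply: (@continuous_comp _ _ _ fst (fun x : 'rV[R]_n => x ord0 c)); first exact: cvg_fst.
  exact: rV_coord_continuous.
apply/seteqP; split => -[x v] /=.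
  rewrite fr_lift => h; exists (Num.floor (x ord0 c)) => //=; rewrite in_itv/=.
  by move: h => /andP[]; lra.
move=> [k _]; rewrite /= in_itv/= => /andP[h1 h2].
rewrite fr_lift (@floor_def _ _ k); last by rewrite intrD; lra.
lra.
Qed.

Lemma measurable_fr c : measurable_fun setT (fr c : bphase R n -> R).
Proof.
apply: (measurability (@RGenCInfty.G R)); first exact: RGenCInfty.measurableE.
move=> _ [_ [q ->] <-]; rewrite setTI.
have mO q' : q' <= 1 -> measurable ([set p | 0 < fr c p < q'] : set (bphase R n)).
  by move=> q1; apply: phase_open_measurable; exact: fr_open.
have [q0|q0] := leP q 0.
  rewrite (_ : _ @^-1` _ = setT)//; apply/seteqP; split=> p //= _; rewrite in_itv/= andbT.
  by have /andP[h _] := fr_itv c p; lra.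
have [q1|q1] := ltP 1 q.
  rewrite (_ : _ @^-1` _ = set0)//; apply/seteqP; split=> p //=; rewrite in_itv/= andbT.
  by have /andP[_ h] := fr_itv c p; lra.
rewrite (_ : _ @^-1` _ = [set p | 0 < fr c p < 1] `\` [set p | 0 < fr c p < q]).
  by apply: measurableD; exact: mO.
apply/seteqP; split=> p /=; rewrite in_itv/= andbT; have /andP[h1 h2] := fr_itv c p.
  by move=> qp; split; [lra|move=> /andP[]; lra].
by move=> [/andP[h3 _] h4]; rewrite leNgt; apply/negP => h5; apply: h4; rewrite h3.
Qed.

Lemma phase_shift (x v : 'rV[R]_n) : exists z : 'rV[int]_n,
  (forall c, 0 <= (x + intv R z) ord0 c <= 1).
Proof.
exists (\row_c - Num.floor (x ord0 c)) => c; rewrite !mxE mulrNz.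
have := floor_le (x ord0 c); have := floorD1_gt (x ord0 c); rewrite intrD; lra.
Qed.

Lemma liftD (x v : 'rV[R]_n) z : lift (x + intv R z, v) = lift (x, v).
Proof. by rewrite /lift /= to_torusD. Qed.

Let box (a b : R) : set 'rV[R]_n := [set x | forall c, `[a, b]%classic (x ord0 c)].

Let box_compact a b : compact (box a b).
Proof. by apply: (@rV_compact R n (fun=> `[a, b]%classic)) => c; exact: segment_compact. Qed.

(** Both points are translated by the integer vector that brings [x] into the unit cube, where
    compactness applies; [y] and [w] may leave the compact set. *)
Lemma phase_uniform f (K eta : R) : continuous f -> 0 < eta ->
  exists2 del : R, 0 < del & forall x y v w : 'rV[R]_n, `|v| <= K ->
    `|x - y| < del -> `|v - w| < del -> `|f (lift (x, v)) - f (lift (y, w))| < eta.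
Proof.
move=> cf eta0; have cF : continuous (f \o @lift R n) by apply/phase_continuousP.
have cB : compact (box 0 1 `*` box (- K) K) by apply: compact_setX; exact: box_compact.
have [del del0 H] := compact_ball_uniform cB cF eta0.
exists del => // x y v w vK xy vw.
have [z zx] := phase_shift x v.
rewrite -(liftD x v z) -(liftD y w z).
apply: (H (_, _) (_, _)).
  split=> /= c; first by rewrite /= in_itv/=; exact: zx.
  by rewrite /= in_itv/= -ler_norml (le_trans (coord_le_norm _ _)).
split; rewrite mx_norm_ball /ball_ //=.
by rewrite opprD addrACA subrr addr0.
Qed.

Lemma phase_bounded f (K : R) : continuous f ->
  exists B : R, forall x v : 'rV[R]_n, `|v| <= K -> `|f (lift (x, v))| <= B.
Proof.
move=> cf; have cF : continuous (f \o @lift R n) by apply/phase_continuousP.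
have cB : compact (box 0 1 `*` box (- K) K) by apply: compact_setX; exact: box_compact.
have [K0|K0] := leP 0 K; last first.
  by exists 0 => x v vK; have := le_trans (normr_ge0 v) vK; rewrite leNgt K0.
have cnF : continuous (fun p : 'rV[R]_n * 'rV[R]_n => `|(f \o @lift R n) p|).
  by move=> p; apply: (@continuous_comp _ _ _ (f \o @lift R n) (@Num.norm R R)); [exact: cF|exact: norm_continuous].
have [||[x0 v0] _ H] := @compact_EVT_max _ _ (fun p : 'rV[R]_n * 'rV[R]_n => `|(f \o @lift R n) p|) _ _ cB.
- by exists (0, 0); split=> c /=; rewrite mxE in_itv/=; lra.
- exact: continuous_subspaceT.
exists `|f (lift (x0, v0))| => x v vK.
have [z zx] := phase_shift x v.
rewrite -(liftD x v z); apply: (H (_, _)); rewrite inE; split=> /= c.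
  by rewrite /= in_itv/=; exact: zx.
by rewrite /= in_itv/= -ler_norml (le_trans (coord_le_norm _ _)).
Qed.

Lemma vinfty_pinfty (h : phase R n -> R) : h p @[p --> @vinfty R n] --> +oo ->
  forall M, exists K, forall p, K < enorm p.2 -> M <= h p.
Proof.
move=> hoo M.
have hM : nbhs +oo [set x : R | M <= x] by apply: nbhs_pinfty_ge; exact: num_real.
by have [K _ HK] := hoo _ hM; exists K => p Kp; exact: HK.
Qed.

Lemma vinfty_zero (h : phase R n -> R) :
  (h p @[p --> @vinfty R n] --> (0 : R)) <->
  forall e, 0 < e -> exists K, forall p, K < enorm p.2 -> `|h p| <= e.
Proof.
split=> [h0 e e0|H A].
  have hM : nbhs (0 : R) [set x : R | `|x| <= e].
    exists e => //= y; rewrite /ball_/= sub0r normrN; exact: ltW.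
  by have [K _ HK] := h0 _ hM; exists K => p Kp; exact: HK.
move=> [e /= e0 eA]; have [|K HK] := H (e / 2); first by rewrite divr_gt0.
exists K => // p /= /HK hp; apply: eA; rewrite /ball_/= sub0r normrN.
by rewrite (le_lt_trans hp)//; lra.
Qed.

Section weights.
Context (L : phase R n -> R) (g : R -> R).
Hypothesis wL : weight_for L g.

Lemma weight_ge1 p : 1 <= weight g p.
Proof. by case: wL. Qed.

Lemma weight_gt0 p : 0 < weight g p.
Proof. exact: lt_le_trans ltr01 (weight_ge1 p). Qed.

(** Since [|v|] is negligible against the weight, functions of linear growth are admissible tests.
    This is what makes the integrand of the holonomy condition continuous for the weak-*
    topology. *)
Lemma C0w_linear f (B : R) : continuous f ->
  (forall p, `|f p| <= B * (1 + enorm p.2)) -> C0w g f.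
Proof.
move=> cf fB; have [_ _ _ /vinfty_zero w0] := wL.
have B0 : 0 <= B.
  have := le_trans (normr_ge0 _) (fB point); have := enorm_ge0 (@point (phase R n)).2.
  move=> h1 h2; rewrite leNgt; apply/negP => h3; have := le_lt_trans h2 _; nra.
have key (e : R) : 0 < e -> exists2 K, 0 <= K & forall p, K < enorm p.2 -> `|f p / weight g p| <= 2 * B * e.
  move=> e0; have [K HK] := w0 _ e0.
  exists (Num.max K 1); first by rewrite le_max ler01 orbT.
  move=> p; rewrite gt_max => /andP[Kp p1].
  have := HK p Kp; have := weight_gt0 p => wp.
  rewrite !normrM (ger0_norm (enorm_ge0 _)) !normfV !(gtr0_norm wp) !ler_pdivrMr//.
  move=> h; apply: (le_trans (fB p)); nra.
split=> //.
- have [K K0 HK] := key 1 ltr01.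
  exists (2 * B + B * (1 + K)) => p; have [pK|pK] := leP (enorm p.2) K.
    rewrite normrM normfV (gtr0_norm (weight_gt0 p)) ler_pdivrMr ?weight_gt0//.
    have := weight_ge1 p; have := fB p; have := enorm_ge0 p.2.
    set w := weight g p; set v := enorm p.2; set a := `|f p| => *.
    have : B * (1 + v) <= B * (1 + K) by rewrite ler_wpM2l// lerD2l.
    have : 0 <= B * (1 + K) by rewrite mulr_ge0// addr_ge0.
    nra.
  have := HK p pK; have : 0 <= B * (1 + K) by rewrite mulr_ge0// addr_ge0.
  lra.
- apply/vinfty_zero => e e0.
  have [|K _ HK] := key (e / (2 * (B + 1))); first by rewrite divr_gt0//; lra.
  exists K => p /HK/le_trans; apply.
  rewrite mulrA ler_pdivrMr; nra.
Qed.

(** For large velocities [L] exceeds the weight, elsewhere the weight is bounded. A bound on the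
    cost therefore bounds the weighted mass. *)
Lemma weight_le_L : (forall p, 0 <= L p) -> exists2 C, 0 <= C & forall p, weight g p <= L p + C.
Proof.
move=> L0; have [_ [_ wb] /vinfty_pinfty/(_ 1)[K HK] _] := wL.
have [C HC] := wb K; exists `|C| => // p.
have [pK|pK] := leP (enorm p.2) K.
  by have := HC p pK; have := L0 p; have := ler_norm C; lra.
have := HK p pK; rewrite ler_pdivlMr ?weight_gt0// mul1r.
by have := normr_ge0 C; lra.
Qed.

Lemma L_large : forall M, exists K, forall p, K < enorm p.2 -> M <= L p.
Proof.
move=> M; have [_ _ /vinfty_pinfty/(_ `|M|)[K HK] _] := wL.
exists K => p /HK; rewrite ler_pdivlMr ?weight_gt0//.
have := weight_ge1 p; have := ler_norm M; have := normr_ge0 M; nra.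
Qed.

End weights.

End phase_extra.

(** * Compactness of probability measures *)

Section integral_tools.
Context (R : realType) d (T : measurableType d).

(** Monotone convergence for truncations that become stationary at each point: a bound common to all
    truncations passes to the function, even when it is unbounded. *)
Lemma mono_int_le (Q : {measure set T -> \bar R}) (h : nat -> T -> R) (f : T -> R) (a : \bar R) :
  (forall N, measurable_fun setT (h N)) -> (forall N x, 0 <= h N x) ->
  (forall x, {homo h^~ x : N M / (N <= M)%N >-> N <= M}) ->
  (forall x, exists N0, forall N, (N0 <= N)%N -> h N x = f x) ->
  (forall N, (\int[Q]_x (h N x)%:E <= a)%E) -> (\int[Q]_x (f x)%:E <= a)%E.
Proof.
move=> mh h0 hh hf ha.
have cv x : setT x -> (fun N => (h N x)%:E) @ \oo --> (f x)%:E.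
  move=> _; have [N0 HN] := hf x.
  apply: (@cvg_near_cst _ _ (f x)%:E); exists N0 => // N /= /HN ->.
  exact/eqP.
have mE N : measurable_fun setT (fun x => (h N x)%:E) by exact/measurable_EFinP.
have hE N x : setT x -> (0 <= (h N x)%:E)%E by move=> _; rewrite lee_fin.
have hhE x : setT x -> {homo (fun N => (h N x)%:E) : N M / (N <= M)%N >-> (N <= M)%E}.
  by move=> _ N M NM; rewrite lee_fin; exact: hh.
have cvE := @cvg_monotone_convergence _ _ _ Q setT measurableT _ mE hE hhE.
rewrite (eq_integral (fun x => limn (fun N => (h N x)%:E))); last first.
  by move=> x _; apply/esym/cvg_lim => //; exact: cv.
rewrite -(cvg_lim _ cvE)//.
apply: lime_le; first by apply/cvg_ex; eexists; exact: cvE.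
by near=> N; exact: ha.
Unshelve. all: by end_near. Qed.

Lemma Rint_le_EFin (Q : {measure set T -> \bar R}) (f : T -> R) (C : R) : (forall x, 0 <= f x) ->
  (\int[Q]_x (f x)%:E <= C%:E)%E -> \int[Q]_x f x <= C.
Proof.
move=> f0 h; rewrite /Rintegral -lee_fin fineK//.
rewrite ge0_fin_numE ?(le_lt_trans h) ?ltry//.
by apply: integral_ge0 => x _; rewrite lee_fin.
Qed.

Lemma Rint_leP (Q : probability T R) (f h : T -> R) : bm setT f -> bm setT h ->
  (forall x, f x <= h x) -> \int[Q]_x f x <= \int[Q]_x h x.
Proof. by move=> bf bh fh; apply: Rint_le => //; exact: prob_finT. Qed.

Lemma EFin_Rint (Q : probability T R) (f : T -> R) : Q.-integrable setT (EFin \o f) ->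
  (\int[Q]_x (f x)%:E)%E = (\int[Q]_x f x)%:E.
Proof. by move=> fi; rewrite /Rintegral fineK//; exact: integrable_fin_num. Qed.

End integral_tools.

Lemma measurable_invr (R : realType) : measurable_fun setT (fun x : R => x^-1).
Proof.
rewrite -(setvU [set (0 : R)]); apply/measurable_funU => //.
  exact: measurableC.
split; last exact: measurable_fun_set1.
apply: open_continuous_measurable_fun; first by apply: closed_openC; apply: accessible_closed_set1; apply: hausdorff_accessible; exact: Rhausdorff.
by move=> x; rewrite inE => /= /eqP x0; exact: inv_continuous.
Qed.

Section push.
Context (R : realType) d d' (T : measurableType d) (T' : measurableType d').
Context (P : probability T R) (f : T -> T').
Hypothesis mf : measurable_fun setT f.

Definition push_measure : {measure set T' -> \bar R} :=
  @measure_function_pushforward__canonical__measure_function_Measure _ _ _ _ _ P f mf.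
Let push1 : push_measure setT = 1%E.
Proof. by rewrite /push_measure/= /pushforward preimage_setT probability_setT. Qed.
Definition push_prob : probability T' R := prob_of_measure push1.

Lemma Rint_push (h : T' -> R) : measurable_fun setT h -> P.-integrable setT (EFin \o (h \o f)) ->
  \int[push_prob]_y h y = \int[P]_x h (f x).
Proof.
move=> mh ih; rewrite /Rintegral; congr fine.
by rewrite (@integral_pushforward _ _ _ _ _ _ mf P setT (EFin \o h))//; exact/measurable_EFinP.
Qed.

Lemma ge0_integral_push (h : T' -> R) : measurable_fun setT h -> (forall y, 0 <= h y) ->
  (\int[push_prob]_y (h y)%:E = \int[P]_x (h (f x))%:E)%E.
Proof.
move=> mh h0.
rewrite (@ge0_integral_pushforward _ _ _ _ _ _ mf P setT (EFin \o h))//; first exact/measurable_EFinP.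
by move=> y _; rewrite lee_fin.
Qed.

End push.

(** * Compactification of the velocity axis *)

Section squash.
Context (R : realType).

(** A homeomorphism of the line onto the open unit interval, with inverse [usq]. At the end points
    [usq] divides by zero and returns a meaningless value, which [inner] later excludes. *)
Definition sq (r : R) : R := (1 + r / (1 + `|r|)) / 2.
Definition usq (y : R) : R := (2 * y - 1) / (1 - `|2 * y - 1|).

Lemma sq_itv r : 0 < sq r < 1.
Proof.
rewrite /sq; have r1 : 0 < 1 + `|r| by rewrite ltr_pwDl.
have : `|r / (1 + `|r|)| < 1.
  by rewrite normrM normfV (gtr0_norm r1) ltr_pdivrMr// mul1r ltrDr.
by rewrite ltr_norml; lra.
Qed.

Lemma sqK r : usq (sq r) = r.
Proof.
rewrite /usq /sq; have r1 : 0 < 1 + `|r| by rewrite ltr_pwDl.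
have -> : 2 * ((1 + r / (1 + `|r|)) / 2) - 1 = r / (1 + `|r|) by field; rewrite gt_eqF.
rewrite normrM normfV (gtr0_norm r1).
have -> : 1 - `|r| / (1 + `|r|) = (1 + `|r|)^-1 by field; rewrite gt_eqF.
by rewrite invrK divfK// gt_eqF.
Qed.

Lemma usq_unif (K eta : R) : 0 <= K -> 0 < eta -> exists2 del : R, 0 < del &
  forall y y', 0 < y < 1 -> `|usq y| <= K -> `|y - y'| <= del ->
    0 < y' < 1 /\ `|usq y - usq y'| <= eta.
Proof.
move=> K0 eta0; pose m : R := (1 + K)^-1.
have m0 : 0 < m by rewrite invr_gt0; lra.
have mK : m * (1 + K) = 1 by rewrite mulVf//; lra.
(* Where [|usq y| <= K], the distance [1 - |z|] is at least [m]. The first term keeps [1 - |z'|]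
   above [m / 2]; the second then controls the difference of the two quotients, whose denominators
   are bounded below by [m] and [m / 2]. *)
exists (Num.min (m / 4) (eta * (m * m) / 12)).
  rewrite lt_min; apply/andP; split; first by rewrite divr_gt0.
  by rewrite divr_gt0// mulr_gt0// mulr_gt0.
move=> y y' y01; rewrite /usq.
set z := 2 * y - 1; set z' := 2 * y' - 1.
have z1 : `|z| < 1 by rewrite ltr_norml /z; lra.
have oz : 0 < 1 - `|z| by lra.
rewrite normrM normfV (gtr0_norm oz) ler_pdivrMr// le_min => h1 /andP[h2 h3].
have zm : m <= 1 - `|z|.
  have : 1 <= (1 + K) * (1 - `|z|) by lra.
  by move: mK m0 oz K0; clear; nra.
have dz : `|z - z'| = 2 * `|y - y'|.
  have -> : z - z' = 2 * (y - y') by rewrite /z /z'; ring.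
  by rewrite normrM ger0_norm.
have dn := ler_dist_dist z z'.
have zm' : m / 2 <= 1 - `|z'|.
  by move: dn; rewrite dz ler_norml => /andP[]; lra.
split.
  have : `|z'| < 1 by lra.
  by rewrite ltr_norml /z' => /andP[]; lra.
have oz' : 0 < 1 - `|z'| by lra.
rewrite (_ : z / _ - _ = ((z - z') * (1 - `|z'|) + z' * (`|z| - `|z'|)) / ((1 - `|z|) * (1 - `|z'|))); last first.
  by field; rewrite !gt_eqF.
rewrite normrM normfV (gtr0_norm (mulr_gt0 oz oz')) ler_pdivrMr ?mulr_gt0//.
apply: (le_trans (ler_normD _ _)); rewrite !normrM (gtr0_norm oz').
have : m * (m / 2) <= (1 - `|z|) * (1 - `|z'|) by rewrite ler_pM//; lra.
have := normr_ge0 z'; move: h3 dn dz zm' eta0 m0.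
set A := `|z - z'|; set Bq := `| `|z| - `|z'| |; set P := (1 - `|z|) * _; set a := `|z'|; set dy := `|y - y'|.
move=> h3 dn dz zm' eta0 m0 a0 hP.
have : eta * (m * (m / 2)) <= eta * P by rewrite ler_pM2l.
have : 0 <= A by exact: normr_ge0.
have : a * Bq <= A.
  have : 0 <= Bq by exact: normr_ge0.
  by move=> Bq0; rewrite -[leRHS]mul1r ler_pM//; lra.
have : A * (1 - a) <= A by rewrite -[leRHS]mulr1 ler_wpM2l ?normr_ge0//; lra.
lra.
Qed.

Lemma measurable_usq : measurable_fun setT usq.
Proof.
have mz : measurable_fun setT (fun y : R => 2 * y - 1).
  by apply: measurable_funB => //; exact: measurable_funM.
apply: measurable_funM => //.
apply: (measurableT_comp (@measurable_invr R)).
apply: measurable_funB => //; exact: measurableT_comp.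
Qed.

End squash.

Section cutoff.
Context (R : realType) (n : nat).

Lemma cst_continuous_phase (c : R) : continuous (fun _ : phase R n => c).
Proof. by move=> p; exact: cvg_cst. Qed.

Lemma snd_phase_continuous (h : 'rV[R]_n -> R) : continuous h ->
  continuous (fun p : phase R n => h p.2).
Proof.
move=> ch p; apply: (@continuous_comp _ _ _ (snd : phase R n -> 'rV[R]_n) h); last exact: ch.
exact: cvg_snd.
Qed.

Lemma enorm_phase_continuous : continuous (fun p : phase R n => enorm p.2).
Proof. exact/snd_phase_continuous/enorm_continuous. Qed.

Section ops.
Variables (T : topologicalType) (f h : T -> R).
Hypotheses (cf : continuous f) (ch : continuous h).
Lemma continuousD_fun : continuous (fun p => f p + h p).
Proof. by move=> p; apply: cvgD; [exact: cf|exact: ch]. Qed.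
Lemma continuousB_fun : continuous (fun p => f p - h p).
Proof. by move=> p; apply: cvgB; [exact: cf|exact: ch]. Qed.
Lemma continuousM_fun : continuous (fun p => f p * h p).
Proof. by move=> p; apply: cvgM; [exact: cf|exact: ch]. Qed.
Lemma continuous_min_fun : continuous (fun p => Num.min (f p) (h p)).
Proof. by move=> p; apply: continuous_min; [exact: cf|exact: ch]. Qed.
Lemma continuous_max_fun : continuous (fun p => Num.max (f p) (h p)).
Proof. by move=> p; apply: continuous_max; [exact: cf|exact: ch]. Qed.
End ops.

Lemma sq_continuous : continuous (@sq R).
Proof.
apply: (@continuousM_fun R (fun r => 1 + r / (1 + `|r|)) (fun=> 2^-1)); last by move=> x; exact: cvg_cst.
apply: (@continuousD_fun R (fun=> 1) (fun r => r / (1 + `|r|))); first by move=> x; exact: cvg_cst.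
apply: (@continuousM_fun R id (fun r => (1 + `|r|)^-1)); first by move=> x; exact: cvg_id.
have h : continuous (fun r : R => 1 + `|r|).
  apply: (@continuousD_fun R (fun=> 1) (fun r => `|r|)); first by move=> z; exact: cvg_cst.
  exact: norm_continuous.
move=> x; have x0 : 1 + `|x| != 0 by rewrite gt_eqF// ltr_pwDl.
by apply: cvgV => //; exact: h.
Qed.

Definition chi (K : R) (p : phase R n) : R := Num.min 1 (Num.max 0 (K + 1 - enorm p.2)).

Lemma chi_continuous K : continuous (chi K).
Proof.
apply: continuous_min_fun; first exact: cst_continuous_phase.
apply: continuous_max_fun; first exact: cst_continuous_phase.
apply: continuousB_fun; first exact: cst_continuous_phase.
exact: enorm_phase_continuous.
Qed.

Lemma chi_itv K p : 0 <= chi K p <= 1.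
Proof.
by rewrite /chi le_min ler01 le_max lexx ge_min lexx.
Qed.

Lemma chi1 K p : enorm p.2 <= K -> chi K p = 1.
Proof. by move=> h; rewrite /chi; apply/min_idPl; rewrite le_max; apply/orP; right; lra. Qed.

Lemma chi0 K p : K + 1 <= enorm p.2 -> chi K p = 0.
Proof.
move=> h; rewrite /chi; have -> : Num.max 0 (K + 1 - enorm p.2) = 0 by apply/max_idPl; lra.
by apply/min_idPr.
Qed.

Lemma chi_homo p : {homo chi^~ p : K M / K <= M >-> K <= M}.
Proof.
move=> K M KM; rewrite /chi le_min ge_min lexx/= ge_min; apply/orP; right.
by rewrite ge_max le_max lexx/= le_max; apply/orP; right; lra.
Qed.

End cutoff.

Section compactness.
Context (R : realType) (n : nat).
Implicit Types (f : phase R n -> R) (p : phase R n).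

Definition coord (c : 'I_n + 'I_n) (p : phase R n) : R :=
  match c with inl i => fr i p | inr i => sq (p.2 ord0 i) end.

Definition decode (y : 'I_n + 'I_n -> R) : phase R n :=
  lift (\row_i y (inl i), \row_i usq (y (inr i))).

Definition inner (y : 'I_n + 'I_n -> R) : bool := [forall i, 0 < y (inr i) < 1].

(** Extension by zero to the faces of infinite velocity, continuous when [f] has compact support in
    [v]. The faces of the torus coordinates need no such care, because [decode] identifies 0 with
    1. *)
Definition cutf f (y : 'I_n + 'I_n -> R) : R := if inner y then f (decode y) else 0.

Lemma decode_coord p : decode (coord^~ p) = p.
Proof.
rewrite -[RHS]lift_fr /decode; congr (lift (_, _)); apply/rowP => i.
by rewrite mxE /= sqK.
Qed.

Lemma inner_coord p : inner (coord^~ p).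
Proof. by apply/forallP => i /=; exact: sq_itv. Qed.

Lemma cutf_coord f p : cutf f (coord^~ p) = f p.
Proof. by rewrite /cutf inner_coord decode_coord. Qed.

Lemma coord_itv c p : 0 <= coord c p <= 1.
Proof.
case: c => i /=; first by have /andP[-> /ltW ->] := fr_itv i p.
by have /andP[/ltW -> /ltW ->] := sq_itv (p.2 ord0 i).
Qed.

Lemma measurable_coord c : measurable_fun setT (coord c : bphase R n -> R).
Proof.
case: c => i /=; first exact: measurable_fr.
apply: phase_continuous_measurable; apply: (snd_phase_continuous (h := fun v => sq (v ord0 i))).
move=> v; apply: (@continuous_comp _ _ _ (fun v : 'rV[R]_n => v ord0 i) (@sq R)); first exact: rV_coord_continuous.
exact: sq_continuous.
Qed.

Definition csupp f := continuous f /\ exists K, forall p, K <= enorm p.2 -> f p = 0.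

Lemma csupp_bounded f : csupp f -> exists B, forall p, `|f p| <= B.
Proof.
move=> [cf [K fK]]; have [B HB] := phase_bounded K cf.
exists (Num.max 0 B) => p; have [pK|pK] := leP K (enorm p.2).
  by rewrite fK// normr0 le_max lexx.
rewrite le_max; apply/orP; right; case: p pK => x v /= pK.
rewrite -(to_torusK x); apply: (HB (repr x) v).
exact: le_trans (norm_le_enorm _) (ltW pK).
Qed.

Lemma cutf_unif f : csupp f -> forall eta, 0 < eta -> exists l : nat, forall y y',
  (forall c, 0 <= y c <= 1) -> (forall c, 0 <= y' c <= 1) ->
  (forall c, `|y c - y' c| <= 2 ^- l) -> `|cutf f y - cutf f y'| <= eta.
Proof.
move=> [cf [K0 fK0]] eta eta0.
pose K := Num.max K0 0.
have K_ge0 : 0 <= K by rewrite le_max lexx orbT.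
have fK p : K <= enorm p.2 -> f p = 0 by rewrite ge_max => /andP[h _]; exact: fK0.
have [del del0 Hdel] := phase_uniform K cf eta0.
have del20 : 0 < del / 2 by rewrite divr_gt0.
have [del' del'0 Hdel'] := usq_unif K_ge0 del20.
have m0 : 0 < Num.min (del / 2) del' by rewrite lt_min del20.
have [l hl] := expr_half_lt m0.
exists l.
(* By symmetry one of the two points may be taken inside the support region; if neither is, both
   values vanish. *)
suff H y y' : (forall c, `|y c - y' c| <= 2 ^- l) -> inner y -> enorm (decode y).2 < K ->
    `|cutf f y - cutf f y'| <= eta.
  move=> y y' _ _ yy'.
  have [/andP[h1 h2]|h1] := boolP (inner y && (enorm (decode y).2 < K)); first exact: H.
  have [/andP[h3 h4]|h3] := boolP (inner y' && (enorm (decode y').2 < K)).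
    by rewrite distrC; apply: H => // c; rewrite distrC.
  have z0 z : ~~ (inner z && (enorm (decode z).2 < K)) -> cutf f z = 0.
    by rewrite /cutf; case: (inner z) => //=; rewrite -leNgt => h; exact: fK.
  by rewrite !z0// subrr normr0 ltW.
move=> yy' iy yK.
have vK i : `|usq (y (inr i))| <= K.
  have := coord_le_norm (\row_i usq (y (inr i))) i; rewrite mxE => /le_trans; apply.
  by apply: le_trans (norm_le_enorm _) _; exact: ltW.
have key i := Hdel' (y (inr i)) (y' (inr i)) (forallP iy i) (vK i).
have yl c : `|y c - y' c| <= Num.min (del / 2) del' by apply: le_trans (yy' c) (ltW hl).
have yl1 c : `|y c - y' c| <= del / 2 by have := yl c; rewrite le_min => /andP[].
have yl2 c : `|y c - y' c| <= del' by have := yl c; rewrite le_min => /andP[].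
have iy' : inner y' by apply/forallP => i; have [] := key i (yl2 _).
rewrite /cutf iy iy' /decode ltW//; apply: Hdel.
- by apply: norm_rV_le => // i; rewrite mxE.
- apply: norm_rV_lt => // i; rewrite !mxE; apply: le_lt_trans (yl1 _) _; lra.
- apply: norm_rV_lt => // i; rewrite !mxE; have [_ h] := key i (yl2 _).
  by apply: le_lt_trans h _; lra.
Qed.

Context (L : phase R n -> R) (g : R -> R).
Hypotheses (wL : weight_for L g) (L0 : forall p, 0 <= L p) (cL : continuous L).

Lemma weight_integral (Q : probability (bphase R n) R) (C : R) :
  (\int[Q]_p (L p)%:E <= C%:E)%E -> (\int[Q]_p (weight g p)%:E < +oo)%E.
Proof.
move=> QC; have [C1 C10 wC1] := weight_le_L wL L0.
have mL := phase_continuous_measurable cL.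
have mw : measurable_fun setT (weight g : bphase R n -> R) by case: wL => _ [].
apply: (@le_lt_trans _ _ (\int[Q]_p ((L p)%:E + C1%:E))%E).
  apply: ge0_le_integral => //.
  - by move=> p _; rewrite lee_fin ltW// (weight_gt0 wL).
  - exact/measurable_EFinP.
  - by apply: emeasurable_funD => //; exact/measurable_EFinP.
  - by move=> p _; rewrite -EFinD lee_fin.
rewrite ge0_integralD//; [|by move=> p _; rewrite lee_fin|exact/measurable_EFinP].
have -> : (\int[Q]__ C1%:E = C1%:E)%E by rewrite integral_cst// [X in (_ * X)%E](_ : _ = 1%E) ?mule1//; exact: probability_setT.
by rewrite (@le_lt_trans _ _ (C%:E + C1%:E))%E// ?leeD2r// -EFinD ltry.
Qed.

Lemma L_integrable (Q : probability (bphase R n) R) (C : R) :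
  (\int[Q]_p (L p)%:E <= C%:E)%E -> Q.-integrable setT (EFin \o L).
Proof.
move=> QC; apply/integrableP; split; first by apply/measurable_EFinP; exact: phase_continuous_measurable.
apply: le_lt_trans (ltry C); apply: le_trans QC.
by rewrite le_eqVlt; apply/orP; left; apply/eqP/eq_integral => p _; rewrite /= ger0_norm.
Qed.

Lemma C0w_integrable (Q : probability (bphase R n) R) (C : R) f : C0w g f ->
  (\int[Q]_p (L p)%:E <= C%:E)%E -> Q.-integrable setT (EFin \o f).
Proof.
move=> [cf [B fB] _] QC; have [C1 C10 wC1] := weight_le_L wL L0.
have B0 : 0 <= B by exact: le_trans (normr_ge0 _) (fB point).
have LI := L_integrable QC.
have : Q.-integrable setT (EFin \o (fun p => B * (L p + C1))).
  have : Q.-integrable setT (EFin \o (fun p => L p + C1)).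
    by apply: (@integrableD _ _ _ Q setT measurableT (EFin \o L) (EFin \o cst C1)) => //; exact: finite_measure_integrable_cst.
  by move=> h; exact: (@integrableZl _ _ _ Q setT measurableT B (EFin \o (fun p => L p + C1)) h).
apply: le_integrable => //; first by apply/measurable_EFinP; exact: phase_continuous_measurable.
move=> p _ /=; rewrite lee_fin.
have := fB p; have w0 := weight_gt0 wL p.
rewrite normrM normfV (gtr0_norm w0) ler_pdivrMr// => /le_trans; apply.
by rewrite ger0_norm ?mulr_ge0 ?addr_ge0// ler_wpM2l.
Qed.

(** Uniform integrability in the form used later: the estimate depends on the measure only through
    the bound [C] on its cost. *)
Lemma Rint_dominated (Q : probability (bphase R n) R) (C : R) f (a b : R) :
  (\int[Q]_p (L p)%:E <= C%:E)%E -> measurable_fun setT (f : bphase R n -> R) ->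
  0 <= a -> 0 <= b -> (forall p, `|f p| <= a * (L p + b)) ->
  Q.-integrable setT (EFin \o f) /\ `|\int[Q]_p f p| <= a * (C + b).
Proof.
move=> QC mf a0 b0 fab.
have LI := L_integrable QC.
have Lb : Q.-integrable setT (EFin \o (fun p => L p + b)).
  by apply: (@integrableD _ _ _ Q setT measurableT (EFin \o L) (EFin \o cst b)) => //; exact: finite_measure_integrable_cst.
have Lab : Q.-integrable setT (EFin \o (fun p => a * (L p + b))).
  exact: (@integrableZl _ _ _ Q setT measurableT a (EFin \o (fun p => L p + b)) Lb).
have fI : Q.-integrable setT (EFin \o f).
  apply: le_integrable Lab => //; first exact/measurable_EFinP.
  by move=> p _ /=; rewrite lee_fin (ger0_norm (mulr_ge0 _ _))// addr_ge0.
split=> //; apply: (le_trans (le_normr_Rintegral measurableT fI)).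
apply: (@le_trans _ _ (\int[Q]_p (a * (L p + b)))).
  apply: le_Rintegral => //; exact: integrable_norm fI.
rewrite RintegralZl// RintegralD//; last exact: finite_measure_integrable_cst.
rewrite Rint_prob_cst ler_wpM2l// lerD2r.
exact: Rint_le_EFin.
Qed.

Lemma csupp_chi f K : continuous f -> csupp (fun p => f p * chi K p).
Proof.
move=> cf; split; first by apply: continuousM_fun => //; exact: chi_continuous.
by exists (K + 1) => p /chi0 ->; rewrite mulr0.
Qed.

(* Skorokhod's construction: the limits of the masses of the dyadic cells of a compactification of the
   phase space define nested intervals of [0, 1[, and the limit is an image of Lebesgue measure. *)
Theorem prob_compactness (Q : nat -> probability (bphase R n) R) (C : R) :
  (forall k, (\int[Q k]_p (L p)%:E <= C%:E)%E) ->
  exists (j : nat -> nat) (Q' : probability (bphase R n) R),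
  [/\ {homo j : k l / (k < l)%N}, (\int[Q']_p (L p)%:E <= C%:E)%E &
    forall f, C0w g f -> \int[Q (j k)]_p f p @[k --> \oo] --> \int[Q']_p f p].
Proof.
move=> QC.
have [j [X [hj mX X01 HX]]] := cube_limit Q measurable_coord coord_itv.
have mZ : measurable_fun setT ((fun s => decode (X^~ s)) : measurableTypeR R -> bphase R n).
  apply: measurable_fun_lift => // i.
    by under eq_fun do rewrite mxE; exact: mX.
  under eq_fun do rewrite mxE.
  exact: (measurableT_comp (@measurable_usq R) (mX (inr i))).
pose Q' := push_prob (U01 R) mZ.
pose G : set (measurableTypeR R) := [set s | inner (X^~ s)].
have mG : measurable G.
  rewrite (_ : G = \bigcap_(i in [set: 'I_n]) (X (inr i) @^-1` `]0, 1[%classic)).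
    apply: fin_bigcap_measurable => // i _.
    by rewrite -[X in measurable X]setTI; apply: mX.
  apply/seteqP; split=> s /=.
    by move=> /forallP h i _ /=; rewrite in_itv/=; exact: h.
  by move=> h; apply/forallP => i; have := h i Logic.I; rewrite /= in_itv.
have cutE f s : cutf f (X^~ s) = \1_G s * f (decode (X^~ s)).
  rewrite /cutf indicE; case: ifPn => h; first by rewrite mem_set// mul1r.
  by rewrite memNset ?mul0r//; exact/negP.
have bmf f : csupp f -> bm setT (f : bphase R n -> R).
  by move=> cf; split; [apply: phase_continuous_measurable; case: cf|have [B HB] := csupp_bounded cf; exists B].
have bmZ' f : bm setT (f : bphase R n -> R) -> bm setT ((fun s => f (decode (X^~ s))) : measurableTypeR R -> R).
  move=> [mf [B fB]]; split; last by exists B => s _; exact: fB.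
  exact: (measurableT_comp mf mZ).
have limU f : csupp f -> \int[Q (j k)]_p f p @[k --> \oo] --> \int[U01 R]_s (\1_G s * f (decode (X^~ s))).
  move=> cf; have b1 : bm setT ((fun x => cutf f (coord^~ x)) : bphase R n -> R).
    by under eq_fun do rewrite cutf_coord; exact: bmf.
  have b2 : bm setT ((fun s => cutf f (X^~ s)) : measurableTypeR R -> R).
    by under eq_fun do rewrite cutE; apply: bmM; [exact: bm_indic|apply: bmZ'; exact: bmf].
  have := HX (cutf f) (cutf_unif cf) b1 b2.
  under eq_Rintegral do rewrite cutE.
  by under eq_fun do under eq_Rintegral do rewrite cutf_coord.
(* Tightness: no mass reaches the faces of infinite velocity. Beyond [K] one has [L >= M], so the
   part cut off by [chi K] has mass at most [C / M], and [M] is chosen to make this at most [e]. *)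
have UG : \int[U01 R]_s (\1_G s : R) = 1.
  apply/eqP; rewrite eq_le; apply/andP; split.
    rewrite -[leRHS](Rint_prob_cst (U01 R)); apply: Rint_leP; [exact: bm_indic|exact: bm_cst|].
    by move=> s; rewrite indicE; case: (_ \in _).
  apply/ler_addgt0Pr => e e0; rewrite -lerBlDr.
  pose M := (`|C| + 1) / e; have M0 : 0 < M by rewrite divr_gt0// ltr_pwDr.
  have [K HK] := L_large wL M.
  have cc : csupp (fun p => 1 * chi K p) by apply: csupp_chi; exact: cst_continuous_phase.
  have bc := bmf _ cc.
  apply: (@le_trans _ _ (\int[U01 R]_s (\1_G s * (1 * chi K (decode (X^~ s)))))); last first.
    apply: Rint_leP; [by apply: bmM; [exact: bm_indic|exact: bmZ' bc]|exact: bm_indic|].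
    move=> s; have /andP[h1 h2] := chi_itv K (decode (X^~ s)).
    by rewrite indicE; case: (_ \in _); rewrite ?mul0r ?mul1r.
  apply: seq_lim_ge (limU _ cc) _ => k.
  rewrite lerBlDr -lerBlDl.
  rewrite -[X in X - _](Rint_prob_cst (Q (j k))) -RintegralB//; [|exact: bm_integrableT (bm_cst _ _)|exact: bm_integrableT bc].
  have [||||_ h] := @Rint_dominated (Q (j k)) C (fun p => 1 - 1 * chi K p) M^-1 0 (QC _).
  - by have [] := bmB (bm_cst setT 1) bc.
  - by rewrite invr_ge0 ltW.
  - by [].
  - move=> p; have /andP[h1 h2] := chi_itv K p; rewrite mul1r addr0 ger0_norm ?subr_ge0//.
    have [pK|pK] := leP (enorm p.2) K.
      by rewrite chi1// subrr mulr_ge0// invr_ge0 ltW.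
    rewrite ler_pdivlMl//; have := HK p pK; have := L0 p; nra.
  apply: (le_trans (ler_norm _)); apply: (le_trans h); rewrite addr0 /M invf_div.
  rewrite mulrAC ler_pdivrMr ?ltr_pwDr// ler_pM2l//.
  by have := ler_norm C; lra.
have limf f : csupp f -> \int[Q (j k)]_p f p @[k --> \oo] --> \int[Q']_p f p.
  move=> cf; have bf := bmf _ cf; have bZ := bmZ' _ bf.
  rewrite (_ : \int[Q']_p f p = \int[U01 R]_s (\1_G s * f (decode (X^~ s)))); first exact: limU.
  rewrite Rint_push; [|by case: bf|exact: bm_integrableT].
  have [B HB] := csupp_bounded cf.
  have b1G : bm setT (fun s => 1 - \1_G s : R) by apply: bmB; [exact: bm_cst|exact: bm_indic].
  apply/eqP; rewrite -subr_eq0 -RintegralB//; [|exact: bm_integrableT..|].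
    rewrite -normr_le0; apply: le_trans (le_normr_Rintegral _ _) _ => //.
      apply: bm_integrableT; apply: bmB => //; apply: bmM => //; exact: bm_indic.
    apply: (@le_trans _ _ (\int[U01 R]_s (B * (1 - \1_G s)))).
      apply: Rint_leP; [|exact: bmZ|].
        by apply: bm_norm; apply: bmB => //; apply: bmM => //; exact: bm_indic.
      move=> s; rewrite -[X in X - _]mul1r -mulrBl normrM mulrC.
      rewrite ler_pM// ger0_norm// subr_ge0 indicE; by case: (_ \in _).
    rewrite RintegralZl//; last exact: bm_integrableT.
    have i1 : (U01 R).-integrable setT (EFin \o (fun=> 1 : R)) by exact/bm_integrableT/bm_cst.
    have i2 : (U01 R).-integrable setT (EFin \o (fun s => \1_G s : R)) by exact/bm_integrableT/bm_indic.
    rewrite (RintegralB measurableT i1 i2).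
    by rewrite UG Rint_prob_cst subrr mulr0.
  by apply: bm_integrableT; apply: bmM => //; exact: bm_indic.
have QL : (\int[Q']_p (L p)%:E <= C%:E)%E.
  (* Convergence is so far known only for compactly supported functions, hence a cutoff in addition
     to the truncation of the values. *)
  pose h (N : nat) (p : phase R n) := Num.min (L p) N%:R * chi N%:R p.
  have ch N : csupp (h N).
    by apply: csupp_chi; apply: continuous_min_fun => //; exact: cst_continuous_phase.
  have h0 N p : 0 <= h N p.
    by have /andP[h1 _] := chi_itv N%:R p; rewrite mulr_ge0// le_min L0 ler0n.
  have hL N p : h N p <= L p.
    have /andP[h1 h2] := chi_itv N%:R p; rewrite -[leRHS]mulr1 ler_pM//.
      by rewrite le_min L0 ler0n.
    by rewrite ge_min lexx.
  apply: (@mono_int_le _ _ _ Q' h).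
  - by move=> N; have [] := bmf _ (ch N).
  - exact: h0.
  - move=> p N M NM; have /andP[h1 h2] := chi_itv N%:R p.
    rewrite /h; apply: ler_pM => //; first by rewrite le_min L0 ler0n.
      by rewrite le_min !ge_min lexx ler_nat NM orbT.
    by apply: chi_homo; rewrite ler_nat.
  - move=> p; have [N0 HN0] := natr_large (Num.max (L p) (enorm p.2)).
    exists N0.+1 => N NN.
    have : Num.max (L p) (enorm p.2) <= N%:R by rewrite (le_trans (ltW HN0))// ler_nat.
    by rewrite ge_max => /andP[/min_idPl h1 h2]; rewrite /h h1 chi1// mulr1.
  - move=> N; rewrite EFin_Rint; last exact: bm_integrableT (bmf _ (ch N)).
    rewrite lee_fin; apply: seq_lim_le (limf _ (ch N)) _ => k.
    apply: Rint_le_EFin => //; apply: le_trans (QC (j k)).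
    apply: ge0_le_integral => //.
    - by move=> p _; rewrite lee_fin.
    - by apply/measurable_EFinP; have [] := bmf _ (ch N).
    - by apply/measurable_EFinP; exact: phase_continuous_measurable.
    - by move=> p _; rewrite lee_fin.
exists j, Q'; split=> // f Cf.
have [C1 C10 wC1] := weight_le_L wL L0.
apply/seq_cvgP => e e0.
have A0 : 0 < C + C1 + 1.
  have : 0 <= C; last by lra.
  by rewrite -lee_fin; apply: le_trans (QC 0%N); apply: integral_ge0 => p _; rewrite lee_fin.
(* Beyond [K], [|f|] is at most [e'] times the weight, hence at most [e' * (L + C1)]. Cutting off
   thus costs at most [e' * (C + C1)], below [e / 3], for all the measures at once. *)
pose e' := e / (3 * (C + C1 + 1)).
have e'0 : 0 < e' by rewrite divr_gt0// mulr_gt0.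
have [cf _ /vinfty_zero/(_ _ e'0)[K HK]] := Cf.
have cfc := csupp_chi K cf.
have near_ (P : probability (bphase R n) R) : (\int[P]_p (L p)%:E <= C%:E)%E ->
    `|\int[P]_p f p - \int[P]_p (f p * chi K p)| <= e / 3.
  move=> PC; rewrite -RintegralB//; [|exact: C0w_integrable Cf PC|exact: bm_integrableT (bmf _ cfc)].
  have [||||_ h] := @Rint_dominated P C (fun p => f p - f p * chi K p) e' C1 PC.
  - apply: measurable_funB; first exact: phase_continuous_measurable.
    by have [] := bmf _ cfc.
  - exact: ltW.
  - by [].
  - move=> p; have /andP[h1 h2] := chi_itv K p; rewrite -{1}[f p]mulr1 -mulrBr normrM.
    rewrite (@ger0_norm _ (1 - chi K p)) ?subr_ge0//.
    have LC : 0 <= e' * (L p + C1) by rewrite mulr_ge0 ?addr_ge0// ltW.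
    have [pK|pK] := leP (enorm p.2) K; first by rewrite chi1// subrr mulr0.
    have w0 := weight_gt0 wL p.
    have := HK p pK; rewrite normrM normfV (gtr0_norm w0) ler_pdivrMr// => h.
    apply: (@le_trans _ _ `|f p|); first by rewrite -[leRHS]mulr1 ler_wpM2l//; lra.
    by apply: (le_trans h); rewrite ler_pM2l.
  apply: le_trans h _; rewrite /e' invfM mulrA mulrAC ler_pdivrMr ?ler_pM2l ?divr_gt0//; lra.
have [N HN] := (seq_cvgP _ _).1 (limf _ cfc) _ (divr_gt0 e0 (ltr0Sn R 2)).
exists N => k /HN; have := near_ _ (QC (j k)); have := near_ _ QL.
set a := \int[_]_p _; set b := \int[_]_p _; set c := \int[_]_p _; set d := \int[_]_p _.
rewrite !ler_norml => /andP[? ?] /andP[? ?] /andP[? ?]; apply/andP; split; lra.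
Qed.

End compactness.

(** * Increments of Brownian motion *)

Lemma indic1 (R : realType) T (A : set T) x : A x -> \1_A x = 1 :> R.
Proof. by move=> h; rewrite indicE mem_set. Qed.

Lemma indic0 (R : realType) T (A : set T) x : ~ A x -> \1_A x = 0 :> R.
Proof. by move=> h; rewrite indicE memNset. Qed.

Lemma measurable_rV (R : realType) n d (T : measurableType d) (D : set T) (X : T -> 'rV[R]_n) (f : 'rV[R]_n -> R) :
  measurable D -> (forall i, measurable_fun D (fun t => X t ord0 i)) -> continuous f ->
  measurable_fun D (fun t => f (X t)).
Proof.
move=> mD mX cf; apply: (@measurable_fun_pair_continuous _ _ _ _ _ mD X X (fun p => f p.1)) => //.
move=> p; apply: (@continuous_comp _ _ _ fst f); [exact: cvg_fst|exact: cf].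
Qed.

Section normal_moment.
Context (R : realType).

(** Half of the Gaussian exponent absorbs [|x|] and the other half is a Gaussian of deviation
    [sqrt 2 * s]. The inequality left, [|x| <= s * exp (x^2 / (4 s^2))], follows from
    [1 + y <= exp y] and the square [(2 s - |x|)^2]. *)
Lemma normal_pdf_abs (s x : R) : 0 < s ->
  `|x| * normal_pdf 0 s x <= Num.sqrt 2 * s * normal_pdf 0 (Num.sqrt 2 * s) x.
Proof.
move=> s0; have r20 : 0 < Num.sqrt 2 :> R by rewrite sqrtr_gt0.
rewrite !normal_pdfE ?gt_eqF ?mulr_gt0// /normal_peak /normal_fun !subr0.
rewrite exprMn sqr_sqrtr//.
have -> : Num.sqrt (2 * s ^+ 2 * pi *+ 2) = Num.sqrt 2 * Num.sqrt (s ^+ 2 * pi *+ 2).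
  have h (a b c : R) : a * b * c *+ 2 = a * (b * c *+ 2) by rewrite mulrnAr mulrA.
  by rewrite -sqrtrM// h.
set p := Num.sqrt (_ *+ 2); rewrite invfM.
have -> : Num.sqrt 2 * s * ((Num.sqrt 2)^-1 * p^-1 * expR (- x ^+ 2 / (2 * s ^+ 2 *+ 2))) =
   s * p^-1 * expR (- x ^+ 2 / (2 * s ^+ 2 *+ 2)).
  by field; rewrite /p !gt_eqF// sqrtr_gt0 mulrn_wgt0// mulr_gt0 ?exprn_gt0// pi_gt0.
rewrite mulrCA -[X in _ <= X]mulrA [X in _ <= X]mulrCA ler_wpM2l ?invr_ge0 ?sqrtr_ge0//.
set E := expR (- x ^+ 2 / (2 * s ^+ 2 *+ 2)).
have -> : expR (- x ^+ 2 / (s ^+ 2 *+ 2)) = E * E.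
  by rewrite /E -expRD; congr expR; field; rewrite gt_eqF.
rewrite mulrA ler_wpM2r ?expR_ge0//.
rewrite /E mulNr expRN ler_pdivrMr ?expR_gt0//.
have : 1 + x ^+ 2 / (2 * s ^+ 2 *+ 2) <= expR (x ^+ 2 / (2 * s ^+ 2 *+ 2)) by exact: expR_ge1Dx.
rewrite -(ler_pM2l s0); apply: le_trans.
have -> : s * (1 + x ^+ 2 / (2 * s ^+ 2 *+ 2)) = s + `|x| ^+ 2 / (4 * s).
  by rewrite real_normK ?num_real//; field; rewrite gt_eqF.
rewrite -subr_ge0.
have -> : s + `|x| ^+ 2 / (4 * s) - `|x| = (2 * s - `|x|) ^+ 2 / (4 * s) by field; rewrite gt_eqF.
by rewrite divr_ge0 ?sqr_ge0// mulr_ge0// ltW.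
Qed.

Lemma normal_abs_moment (s : R) : 0 < s -> s <= 1 ->
  (\int[lebesgue_measure]_x (`|x| * normal_pdf 0 s x)%:E <= 2%:E)%E.
Proof.
move=> s0 s1; have r20 : 0 < Num.sqrt 2 :> R by rewrite sqrtr_gt0.
have c0 : 0 <= Num.sqrt 2 * s by rewrite mulr_ge0// ltW.
apply: (@le_trans _ _ (\int[lebesgue_measure]_x ((Num.sqrt 2 * s)%:E * (normal_pdf 0 (Num.sqrt 2 * s) x)%:E)%E)%E).
  apply: ge0_le_integral => //.
  - by move=> x _; rewrite lee_fin mulr_ge0// normal_pdf_ge0.
  - apply/measurable_EFinP; apply: measurable_funM; first exact: normr_measurable.
    exact: measurable_normal_pdf.
  - by apply: measurable_funeM; apply/measurable_EFinP; exact: measurable_normal_pdf.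
  - by move=> x _; rewrite -EFinM lee_fin; exact: normal_pdf_abs.
rewrite ge0_integralZl//; last 2 first.
- by apply/measurable_EFinP; exact: measurable_normal_pdf.
- by move=> x _; rewrite lee_fin normal_pdf_ge0.
rewrite integral_normal_pdf mule1 lee_fin.
have : Num.sqrt 2 <= 2 :> R.
  by rewrite -[leRHS]ger0_norm// -sqrtr_sqr ler_wsqrtr// expr2; lra.
nra.
Qed.

(** Counting the integer levels below [|x|] recovers [|x|] up to one. The expectation of a count is
    a sum of tail probabilities, which is what the law of an increment gives directly. *)
Lemma abs_le_count (x : R) (N : nat) : Num.min `|x| N%:R <= 1 + \sum_(i < N) (\1_[set y : R | i.+1%:R <= `|y|] x : R).
Proof.
elim: N => [|N IH]; first by rewrite big_ord0 ge_min; apply/orP; right; rewrite addr0.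
rewrite big_ord_recr /=.
have [h|h] := leP N.+1%:R `|x|.
  rewrite [\1_[set y | N.+1%:R <= _] x]indic1//.
  move: IH; rewrite !min_r //; last by rewrite (le_trans _ h)// ler_nat.
  by rewrite -natr1; lra.
rewrite [\1_[set y | N.+1%:R <= _] x]indic0 /=; last by apply/negP; rewrite -ltNge.
have [h2|h2] := leP N%:R `|x|.
  rewrite addr0.
  have : N%:R <= \sum_(i < N) (\1_[set y : R | i.+1%:R <= `|y|] x : R).
    rewrite -[in leLHS](card_ord N) -sum1_card natr_sum; apply: ler_sum => i _.
    rewrite indicE mem_set//=; apply: le_trans h2; rewrite ler_nat; exact: ltn_ord.
  by move: h; rewrite -[N.+1%:R]natr1; lra.
by move: IH; rewrite (min_l (ltW h2)) addr0.
Qed.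

Lemma count_le_abs (x : R) (N : nat) : \sum_(i < N) (\1_[set y : R | i.+1%:R <= `|y|] x : R) <= `|x|.
Proof.
elim: N => [|N IH]; first by rewrite big_ord0.
rewrite big_ord_recr /=.
have [h|h] := leP N.+1%:R `|x|.
  rewrite [\1_[set y | N.+1%:R <= _] x]indic1//.
  apply: le_trans h; rewrite -natr1 lerD2r.
  rewrite -[in leRHS](card_ord N) -sum1_card natr_sum; apply: ler_sum => i _.
  by rewrite indicE; case: (_ \in _).
by rewrite [\1_[set y | N.+1%:R <= _] x]indic0 /= ?addr0//; apply/negP; rewrite -ltNge.
Qed.

Lemma measurable_tail (i : nat) : measurable [set y : R | i.+1%:R <= `|y|].
Proof.
rewrite (_ : [set y | _] = (fun y => `|y|) @^-1` `[i.+1%:R, +oo[%classic).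
  by rewrite -[X in measurable X]setTI; apply: normr_measurable.
by apply/seteqP; split => y /=; rewrite in_itv/= andbT.
Qed.

(** The constant is [1 + 2]: one from replacing [|X|] by a count, two from the moment of the normal
    density. *)
Lemma law_abs_moment d (W : measurableType d) (P : probability W R) (X : W -> R) (s : R) :
  0 < s -> s <= 1 -> measurable_fun setT X ->
  (forall B, measurable B -> P (X @^-1` B) = normal_prob 0 s B) ->
  (\int[P]_om (`|X om|)%:E <= 3%:E)%E.
Proof.
move=> s0 s1 mX XB.
have mB i : measurable (X @^-1` [set y : R | i.+1%:R <= `|y|]).
  by rewrite -[X in measurable X]setTI; apply: mX => //; exact: measurable_tail.
have bI i : bm setT (fun om => \1_[set y : R | i.+1%:R <= `|y|] (X om) : R).
  exact: (@bm_indic R _ W setT _ (mB i)).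
apply: (@mono_int_le _ _ _ P (fun N om => Num.min `|X om| N%:R)).
- by move=> N; apply: measurable_minr => //; exact: measurableT_comp.
- by move=> N om; rewrite le_min normr_ge0 ler0n.
- by move=> om N M NM; rewrite le_min !ge_min lexx ler_nat NM orbT.
- move=> om; have [N0 HN0] := natr_large `|X om|.
  exists N0.+1 => N NN; apply/min_idPl; rewrite (le_trans (ltW HN0))// ler_nat//.
move=> N.
have b1 : bm setT (fun om => Num.min `|X om| N%:R).
  split; first by apply: measurable_minr => //; exact: measurableT_comp.
  by exists N%:R => om _; rewrite ger0_norm ?le_min ?normr_ge0 ?ler0n// ge_min lexx orbT.
have bS : bm setT (fun om => \sum_(i < N) (\1_[set y : R | i.+1%:R <= `|y|] (X om) : R)).
  by apply: bm_sum.
rewrite EFin_Rint; last exact: bm_integrableT.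
rewrite lee_fin; apply: (@le_trans _ _ (\int[P]_om (1 + \sum_(i < N) (\1_[set y : R | i.+1%:R <= `|y|] (X om) : R)))).
  apply: Rint_leP => //; first by apply: bmD => //; exact: bm_cst.
  by move=> om; exact: abs_le_count.
rewrite RintegralD//; [|exact/bm_integrableT/bm_cst|exact: bm_integrableT].
rewrite Rint_prob_cst.
have -> : \int[P]_om (\sum_(i < N) (\1_[set y : R | i.+1%:R <= `|y|] (X om) : R)) =
    \int[normal_prob 0 s]_x (\sum_(i < N) (\1_[set y : R | i.+1%:R <= `|y|] x : R)).
  rewrite Rint_sum//; last exact: prob_fin.
  rewrite Rint_sum//; [|by rewrite prob_finT|by move=> i; apply: bm_indic; exact: measurable_tail].
  apply: eq_bigr => i _; rewrite (@Rint_indic _ _ _ (normal_prob 0 s))//; last exact: measurable_tail.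
  rewrite setIT; have := XB _ (measurable_tail i); rewrite /= => <-.
  by rewrite -[in RHS](setIT (X @^-1` _)) -Rint_indic.
have -> : 3 = 1 + 2 :> R by rewrite (natrD _ 1 2).
rewrite lerD2l Rint_sum//; [|by rewrite prob_finT|by move=> i; apply: bm_indic; exact: measurable_tail].
rewrite -lee_fin; apply: le_trans (normal_abs_moment s0 s1).
have -> : (\sum_(i < N) \int[normal_prob 0 s]_x (\1_[set y : R | i.+1%:R <= `|y|] x : R))%:E =
   (\int[lebesgue_measure]_x \sum_(i < N) ((\1_[set y : R | i.+1%:R <= `|y|] x)%:E * (normal_pdf 0 s x)%:E))%E.
  rewrite ge0_integral_sum//; last 2 first.
  - move=> i; apply: emeasurable_funM; apply/measurable_EFinP; last exact: measurable_normal_pdf.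
    by apply: measurable_indic; exact: measurable_tail.
  - by move=> i x _; rewrite mule_ge0// lee_fin ?normal_pdf_ge0// indicE.
  rewrite -sumEFin; apply: eq_bigr => i _.
  rewrite (@Rint_indic _ _ _ (normal_prob 0 s))//; last exact: measurable_tail.
  rewrite setIT fineK; last by rewrite fin_num_measure//; exact: measurable_tail.
  rewrite /normal_prob [LHS]integral_mkcond; congr (integral _ _ _); apply/funext => x.
  rewrite patchE indicE; case: (_ \in _); by rewrite ?mul1e ?mul0e.
apply: ge0_le_integral => //.
- by move=> x _; apply: sume_ge0 => i _; rewrite mule_ge0// lee_fin ?normal_pdf_ge0// indicE.
- apply: emeasurable_sum => i; apply: emeasurable_funM; apply/measurable_EFinP; last exact: measurable_normal_pdf.
  by apply: measurable_indic; exact: measurable_tail.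
- apply/measurable_EFinP; apply: measurable_funM; first exact: normr_measurable.
  exact: measurable_normal_pdf.
- move=> x _; under eq_bigr do rewrite -EFinM.
  rewrite sumEFin lee_fin -mulr_suml ler_wpM2r ?normal_pdf_ge0//; exact: count_le_abs.
Qed.

End normal_moment.

Section brownian_moment.
Context (R : realType) (n : nat) (d : measure_display) (W : measurableType d)
  (P : probability W R) (F : R -> set (set W)) (w : R -> W -> 'rV[R]_n).
Hypotheses (fF : filtration F) (bw : brownian P F w).

Lemma brownian_measurable t i : 0 <= t -> measurable_fun setT (fun om => w t om ord0 i).
Proof.
move=> t0 _ B mB; rewrite setTI; have [_ _ wF _] := bw; have [_ FM _] := fF.
exact: FM t0 _ (wF t i B t0 mB).
Qed.

Lemma brownian_increment (s t : R) : 0 <= s -> s <= t -> t - s <= 1 ->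
  (\int[P]_om (`|w t om - w s om|)%:E <= (n%:R * 3)%:E)%E.
Proof.
move=> s0; rewrite le_eqVlt => /predU1P[->|st] ts1.
  under eq_integral do rewrite subrr normr0.
  by rewrite integral0 lee_fin mulr_ge0.
have t0 : 0 <= t by rewrite (le_trans s0)// ltW.
have mwi i : measurable_fun setT (fun om => w t om ord0 i - w s om ord0 i).
  by apply: measurable_funB; exact: brownian_measurable.
have law i (B : set R) : measurable B -> P ((fun om => w t om ord0 i - w s om ord0 i) @^-1` B) = normal_prob 0 (Num.sqrt (t - s)) B.
  (* The one-dimensional marginal is extracted: the conditioning event is the whole space and the
     other coordinates are unconstrained. *)
  move=> mB; have [_ _ _ /(_ s t setT (fun j => if j == i then B else setT))] := bw.
  have [sF _ _] := fF.
  rewrite s0 st => /(_ isT) h.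
  have FT : F s setT by have [F0 FC _] := sF s s0; have := FC _ F0; rewrite setD0.
  have := h FT; rewrite setTI (_ : [set om | _] = (fun om => w t om ord0 i - w s om ord0 i) @^-1` B).
    move=> ->; last by move=> j; case: eqP => // _; exact: measurableT.
    rewrite probability_setT mul1e (bigD1 i)//= eqxx big1 ?mule1// => j /negbTE ->.
    exact: probability_setT.
  apply/seteqP; split => om /= => [/(_ i)|Bi j]; first by rewrite eqxx.
  by case: eqP => // ->.
have s1 : Num.sqrt (t - s) <= 1 by rewrite -sqrtr1 ler_wsqrtr.
have s1' : 0 < Num.sqrt (t - s) by rewrite sqrtr_gt0 subr_gt0.
apply: (@le_trans _ _ (\int[P]_om \sum_(i < n) (`|w t om ord0 i - w s om ord0 i|)%:E)%E).
  apply: ge0_le_integral => //.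
  - apply/measurable_EFinP.
    apply: (measurable_rV (X := fun om => w t om - w s om)) => // [i|]; last exact: norm_continuous.
    by under eq_fun do rewrite !mxE; exact: mwi.
  - by apply: emeasurable_sum => i; apply/measurable_EFinP; exact: measurableT_comp.
  - move=> om _; rewrite sumEFin lee_fin; apply: norm_rV_le; first by apply: sumr_ge0.
    by move=> i; rewrite !mxE (bigD1 i)//= lerDl; apply: sumr_ge0.
rewrite ge0_integral_sum//; last by move=> i; apply/measurable_EFinP; exact: measurableT_comp.
apply: (@le_trans _ _ (\sum_(i < n) 3%:E)%E).
  by apply: lee_sum => i _; exact: (law_abs_moment s1' s1 (mwi i) (law i)).
by rewrite sumEFin sumr_const card_ord mulr_natl.
Qed.

End brownian_moment.

(** * Joint measurability and occupation measures *)

Section joint.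
Context (R : realType) d (W : measurableType d) (P : probability W R).
Local Notation lam := (@lebesgue_measure R).
Implicit Types (f : R -> W -> R) (T a b : R).

(** Progressive measurability gives joint measurability on bounded time intervals only; [jm_patch]
    extends to the whole product, where the Tonelli theorem applies. *)
Definition jm T f := measurable_fun (`[0, T] `*` setT)
  (fun p : measurableTypeR R * W => f p.1 p.2).

Let mD T : measurable (`[0, T]%classic `*` setT : set (measurableTypeR R * W)).
Proof. by apply: measurableX => //; exact: measurable_itv. Qed.

Lemma jmD T f g : jm T f -> jm T g -> jm T (fun t om => f t om + g t om).
Proof. by move=> hf hg; exact: measurable_funD hf hg. Qed.

Lemma jmM T f g : jm T f -> jm T g -> jm T (fun t om => f t om * g t om).
Proof. by move=> hf hg; exact: measurable_funM hf hg. Qed.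

Lemma jm_cst T (c : R) : jm T (fun _ _ => c).
Proof. exact: measurable_cst. Qed.

Lemma jm_om T (h : W -> R) : measurable_fun setT h -> jm T (fun _ om => h om).
Proof. by move=> mh; apply: measurable_funTS; exact: (measurableT_comp mh measurable_snd). Qed.

Lemma jm_patch T f (c : R) a b : 0 <= a -> b <= T -> jm T f ->
  measurable_fun setT (fun p : measurableTypeR R * W => if a <= p.1 <= b then f p.1 p.2 else c).
Proof.
move=> a0 bT jf.
have mI : measurable (`[a, b]%classic `*` setT : set (measurableTypeR R * W)).
  by apply: measurableX => //; exact: measurable_itv.
have mb : measurable_fun setT (fun p : measurableTypeR R * W => a <= p.1 <= b).
  apply: (measurable_fun_bool true); rewrite setTI.
  rewrite (_ : _ @^-1` _ = `[a, b]%classic `*` setT)//.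
  apply/seteqP; split=> p /=; rewrite in_itv/=; first by move=> ->.
  by case.
apply: measurable_fun_if => //; rewrite setTI.
rewrite (_ : _ @^-1` _ = `[a, b]%classic `*` setT); last first.
  apply/seteqP; split=> p /=; rewrite in_itv/=; first by move=> ->.
  by case.
apply: measurable_funS jf; first exact: mD.
move=> [t om] /= []; rewrite !in_itv/= => /andP[h1 h2] _; split=> //.
by apply/andP; split; lra.
Qed.

Lemma jm_section T f om : jm T f -> measurable_fun `[0, T] (f^~ om).
Proof.
move=> jf; case: (leP 0 T) => T0; last first.
  rewrite set_itv_ge ?bnd_simp -?ltNge//; exact: measurable_fun_set0.
have h := @jm_patch T f 0 0 T (lexx _) (lexx _) jf.
have := measurable_fun_pair1 om h.
move=> /(@measurable_funTS _ _ _ _ `[0, T]) ; apply: eq_measurable_fun => t; rewrite inE/= in_itv/=.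
by move=> ->.
Qed.

Lemma jm_sectionS T f a b om : 0 <= a -> b <= T -> jm T f -> measurable_fun `[a, b] (f^~ om).
Proof.
move=> a0 bT jf; apply: measurable_funS (jm_section om jf) => //.
move=> t /=; rewrite !in_itv/= => /andP[? ?]; apply/andP; split; lra.
Qed.

Lemma jm_tonelli T f a b : 0 <= a -> b <= T -> jm T f ->
  (forall t om, 0 <= t <= T -> 0 <= f t om) ->
  measurable_fun setT (fun om => (\int[lam]_(t in `[a, b]) (f t om)%:E)%E) /\
  (\int[P]_om \int[lam]_(t in `[a, b]) (f t om)%:E =
   \int[lam]_(t in `[a, b]) \int[P]_om (f t om)%:E)%E.
Proof.
move=> a0 bT jf f0.
have mF := jm_patch 0 a0 bT jf.
pose F := fun p : measurableTypeR R * W => (if a <= p.1 <= b then f p.1 p.2 else 0)%:E.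
have mFE : measurable_fun setT F by exact/measurable_EFinP.
have F0 p : (0 <= F p)%E.
  rewrite /F; case: ifPn => // /andP[h1 h2]; rewrite lee_fin f0//; apply/andP; split; lra.
have FE om : (\int[lam]_(t in `[a, b]) (f t om)%:E = fubini_G lam F om)%E.
  rewrite integral_mkcond; apply: eq_integral => t _.
  by rewrite patchE mem_setE in_itv/= /F/=; case: ifP.
split.
  under eq_fun do rewrite FE; exact: measurable_fun_fubini_tonelli_G.
under eq_integral do rewrite FE.
rewrite -(fubini_tonelli F mFE F0) [RHS]integral_mkcond.
apply: eq_integral => t _; rewrite patchE mem_setE in_itv/= /F/=.
by case: ifP => // _; rewrite integral0.
Qed.

Lemma itv_fin a b : (lam `[a, b]%classic < +oo)%E.
Proof. by rewrite lebesgue_measure_itv/=; case: ifP => // _; rewrite -EFinB ltry. Qed.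

Lemma Rint_itv_cst a b (c : R) : a <= b -> \int[lam]_(t in `[a, b]) c = c * (b - a).
Proof.
move=> ab; rewrite Rintegral_cst; last exact: measurable_itv.
congr (_ * _); have h : lam `[a, b]%classic = (b - a)%:E.
  rewrite lebesgue_measure_itv/= lte_fin; case: ltP => h; first by rewrite EFinB.
  by have -> : b - a = 0 by lra.
by change (b - a) with (fine (b - a)%:E); rewrite -h.
Qed.

Definition jb T (B : R) f := forall t om, 0 <= t <= T -> `|f t om| <= B.

Lemma jbm T f B a b om : 0 <= a -> b <= T -> jm T f -> jb T B f -> bm `[a, b] (f^~ om).
Proof.
move=> a0 bT jf fB; split; first exact: jm_sectionS jf.
exists B => t /=; rewrite in_itv/= => /andP[h1 h2]; apply: fB; apply/andP; split; lra.
Qed.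

Lemma jb_integrable T f B a b om : 0 <= a -> b <= T -> jm T f -> jb T B f ->
  lam.-integrable `[a, b] (EFin \o f^~ om).
Proof.
move=> a0 bT jf fB; apply: bm_integrable; [exact: measurable_itv|exact: itv_fin|exact: jbm fB].
Qed.

Lemma jb_bound T f B a b om : 0 <= a -> a <= b -> b <= T -> jm T f -> jb T B f ->
  `|\int[lam]_(t in `[a, b]) f t om| <= B * (b - a).
Proof.
move=> a0 ab bT jf fB; rewrite -(Rint_itv_cst B ab).
apply: le_trans (le_normr_Rintegral _ _) _; [exact: measurable_itv|exact: jb_integrable fB|].
have h := jbm om a0 bT jf fB.
apply: Rint_le; [exact: measurable_itv|exact: itv_fin|exact: bm_norm h|exact: bm_cst|].
by move=> t /=; rewrite in_itv/= => /andP[h1 h2]; apply: fB; apply/andP; split; lra.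
Qed.

Lemma jb_Rint_measurable T f B a b : 0 <= a -> a <= b -> b <= T -> jm T f -> jb T B f ->
  measurable_fun setT (fun om => \int[lam]_(t in `[a, b]) f t om).
Proof.
move=> a0 ab bT jf fB.
(* Adding the bound [B] makes the integrand nonnegative, as the Tonelli theorem requires; the
   constant is subtracted afterwards. *)
have jfB : jm T (fun t om => f t om + B) by apply: jmD => //; exact: jm_cst.
have [|mI _] := jm_tonelli a0 bT jfB.
  by move=> t om tT; have := fB t om tT; rewrite ler_norml => /andP[]; lra.
rewrite (_ : (fun om => _) = (fun om => fine (\int[lam]_(t in `[a, b]) (f t om + B)%:E)%E - B * (b - a))).
  apply: measurable_funB => //.
  by apply: measurableT_comp => //; exact: fine_measurable.
apply/funext => om; change (\int[lam]_(t in `[a, b]) f t om = \int[lam]_(t in `[a, b]) (f t om + B) - B * (b - a)).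
rewrite RintegralD ?Rint_itv_cst ?addrK//.
- exact: jb_integrable fB.
- by apply: bm_integrable; [exact: measurable_itv|exact: itv_fin|exact: bm_cst].
Qed.

Lemma jb_Rint_bm T f B a b : 0 <= a -> a <= b -> b <= T -> jm T f -> jb T B f ->
  bm setT (fun om => \int[lam]_(t in `[a, b]) f t om).
Proof.
move=> a0 ab bT jf fB; split; first exact: jb_Rint_measurable fB.
by exists (B * (b - a)) => om _; exact: jb_bound fB.
Qed.

(* The limit of the left-point step processes. *)
Lemma jm_continuous T f : (forall t, 0 <= t -> measurable_fun setT (f t)) ->
  (forall om, {within `[0, +oo[, continuous (f^~ om)}) -> jm T f.
Proof.
move=> mf cf.
pose fs (m : nat) (p : measurableTypeR R * W) := f ((Num.truncn (m.+1%:R * p.1))%:R / m.+1%:R) p.2.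
apply: (@measurable_realfun.measurable_fun_cvg _ _ _ _ fs).
  move=> m _ B mB.
  have -> : `[0, T]%classic `*` setT `&` fs m @^-1` B = \bigcup_(k : nat)
      ((`[0, T]%classic `&` (if k == 0%N then `]-oo, m.+1%:R^-1[%classic else `[k%:R / m.+1%:R, k.+1%:R / m.+1%:R[%classic)) `*`
       (f (k%:R / m.+1%:R) @^-1` B)).
    apply/seteqP; split=> -[t om] /=.
      move=> [[tT _] ftB]; exists (Num.truncn (m.+1%:R * t)) => //=; split=> //; split=> //.
      have t0 : 0 <= m.+1%:R * t by move: tT; rewrite in_itv/= => /andP[h _]; rewrite mulr_ge0.
      have /andP[h1 h2] := truncn_itv t0.
      case: eqP => [e|_] /=; rewrite in_itv/=.
        by rewrite e in h2; rewrite -[ltRHS]mul1r ltr_pdivlMr// mulrC.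
      by rewrite ler_pdivrMr// ltr_pdivlMr// [t * _]mulrC h1 h2.
    move=> [k _] /= [[tT tk] fB]; split=> //; rewrite /fs /=.
    suff -> : Num.truncn (m.+1%:R * t) = k by [].
    apply: truncn_def; move: tT tk; rewrite in_itv/= => /andP[t0 _].
    case: eqP => [->|_] /=; rewrite in_itv/=.
      rewrite mulr_ge0//= => h; rewrite mulrC -ltr_pdivlMr// mul1r//.
    by rewrite ler_pdivrMr// ltr_pdivlMr// [t * _]mulrC.
  apply: bigcupT_measurable => k; apply: measurableX.
    by apply: measurableI; [exact: measurable_itv|case: eqP => _; exact: measurable_itv].
  by rewrite -[X in measurable X]setTI; apply: mf => //; rewrite divr_ge0.
move=> [t om] /= [tT _]; apply/seq_cvgP => e e0.
have t0 : 0 <= t by move: tT; rewrite in_itv/= => /andP[].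
have /subspace_continuousP/(_ t) := cf om.
rewrite /= in_itv/= andbT => /(_ t0)/cvgrPdist_le/(_ e e0).
rewrite /within/= => /nbhs_ballP[del /= del0 H].
have [N HN] := invn_small del0.
exists N => k Nk; rewrite distrC /fs /=.
have kt : 0 <= k.+1%:R * t by rewrite mulr_ge0.
have /andP[h1 h2] := truncn_itv kt.
apply: H; last by rewrite in_itv/= andbT divr_ge0.
rewrite /ball/=.
have -> : t - (Num.truncn (k.+1%:R * t))%:R / k.+1%:R = (k.+1%:R * t - (Num.truncn (k.+1%:R * t))%:R) / k.+1%:R.
  by rewrite mulrBl [_ * t]mulrC mulfK.
rewrite normrM normfV ger0_norm ?subr_ge0// ger0_norm//.
apply: (@le_lt_trans _ _ k.+1%:R^-1).
  rewrite -[leRHS]mul1r ler_wpM2r ?invr_ge0//; move: h2; rewrite -natr1; lra.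
by apply: le_lt_trans HN; rewrite lef_pV2 ?posrE// ler_nat.
Qed.

End joint.


Section occupation_prob.
Context (R : realType) (n : nat) (d : measure_display) (W : measurableType d)
  (P : probability W R) (T C : R) (X V : R -> W -> 'rV[R]_n).
Hypotheses (T0 : 0 < T) (jX : forall i, jm T (fun t om => X t om ord0 i))
  (jV : forall i, jm T (fun t om => V t om ord0 i))
  (VC : forall t om, 0 <= t <= T -> `|V t om| <= C).
Local Notation lam := (@lebesgue_measure R).

Lemma lift_jm (f : phase R n -> R) : continuous f -> jm T (fun t om => f (lift (X t om, V t om))).
Proof.
move=> /phase_continuousP cf; apply: (@measurable_fun_pair_continuous _ _ _ _ _ _ (fun p => X p.1 p.2) (fun p => V p.1 p.2) (f \o @lift R n)) => //.
by apply: measurableX => //; exact: measurable_itv.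
Qed.

Lemma lift_jb (f : phase R n -> R) : continuous f ->
  exists B, jb T B (fun t om => f (lift (X t om, V t om))).
Proof.
move=> cf; have [B HB] := phase_bounded C cf.
by exists B => t om tT; apply: HB; exact: VC.
Qed.

Let mI : measurable (`[0, T]%classic : set R). Proof. exact: measurable_itv. Qed.

Lemma Rint_lift_integrable (f : phase R n -> R) om : continuous f ->
  lam.-integrable `[0, T] (EFin \o (fun t => f (lift (X t om, V t om)))).
Proof.
move=> cf; have [B HB] := lift_jb cf.
exact: (jb_integrable om (lexx 0) (lexx T) (lift_jm cf) HB).
Qed.

Lemma Rint_lift_bm (f : phase R n -> R) : continuous f ->
  bm setT (fun om => \int[lam]_(t in `[0, T]) f (lift (X t om, V t om))).
Proof.
move=> cf; have [B HB] := lift_jb cf.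
exact: (jb_Rint_bm P (lexx 0) (ltW T0) (lexx T) (lift_jm cf) HB).
Qed.

(** The measure is the image of the product of the uniform law on [[0, T]] with [P]. Bounded
    velocities and a compact torus make every continuous [f] bounded along the process, so the
    formula applies to [L] itself, which is not in [C0w]. *)
Theorem occupation_prob : exists Q : probability (bphase R n) R,
  forall f : phase R n -> R, continuous f ->
    (\int[Q]_p (f p)%:E =
     (T^-1 * \int[P]_om \int[lam]_(t in `[0, T]) f (lift (X t om, V t om)))%:E)%E.
Proof.
pose X' (p : measurableTypeR R * W) := if 0 <= p.1 <= T then X p.1 p.2 else 0.
pose V' (p : measurableTypeR R * W) := if 0 <= p.1 <= T then V p.1 p.2 else 0.
have mX i : measurable_fun setT (fun p => X' p ord0 i).
  have := jm_patch 0 (lexx 0) (lexx T) (jX i).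
  by apply: eq_measurable_fun => p _; rewrite /X'; case: ifP => // _; rewrite mxE.
have mV i : measurable_fun setT (fun p => V' p ord0 i).
  have := jm_patch 0 (lexx 0) (lexx T) (jV i).
  by apply: eq_measurable_fun => p _; rewrite /V'; case: ifP => // _; rewrite mxE.
have mf := measurable_fun_lift measurableT mX mV.
exists (push_prob (uniform_prob T0 \x P)%E mf).
have nonneg (f : phase R n -> R) : continuous f -> (forall p, 0 <= f p) ->
    (\int[push_prob (uniform_prob T0 \x P) mf]_p (f p)%:E =
     (T^-1 * \int[P]_om \int[lam]_(t in `[0, T]) f (lift (X t om, V t om)))%:E)%E.
  move=> cf f0; have mcf := phase_continuous_measurable cf.
  rewrite ge0_integral_push//.
  pose G := fun p => (f (lift (X' p, V' p)))%:E.
  have mG : measurable_fun setT G.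
    by apply/measurable_EFinP; exact: (measurableT_comp mcf mf).
  have G0 p : (0 <= G p)%E by rewrite lee_fin.
  rewrite -[LHS]/(\int[uniform_prob T0 \x P]_p G p)%E (fubini_tonelli1 G mG G0).
  rewrite integral_uniform//; last 2 first.
  - exact: measurable_fun_fubini_tonelli_F.
  - by move=> t; apply: integral_ge0 => om _.
  rewrite subr0 EFinM; congr (_ * _)%E.
  transitivity (\int[lam]_(t in `[0%R, T]) \int[P]_om (f (lift (X t om, V t om)))%:E)%E.
    apply: eq_integral => t; rewrite inE/= in_itv/= => tT.
    by apply: eq_integral => om _; rewrite /G /X' /V' /= tT.
  have [_ <-] := jm_tonelli P (lexx 0) (lexx T) (lift_jm cf) (fun t om _ => f0 _).
  rewrite -EFin_Rint; last exact: bm_integrableT (Rint_lift_bm cf).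
  by apply: eq_integral => om _; rewrite /Rintegral fineK//; apply: integrable_fin_num => //; exact: Rint_lift_integrable.
move=> f cf.
(* The nonnegative case is applied to the positive and negative parts, whose integrals are
   finite. *)
pose fp p := Num.max (f p) 0; pose fm p := Num.max (- f p) 0.
have c0 := @cst_continuous_phase R n 0.
have cfm : continuous fm.
  by apply: continuous_max_fun => //; move=> p; apply: cvgN; exact: cf.
have cfp : continuous fp by apply: continuous_max_fun.
rewrite integralE.
have -> : ((fun p => (f p)%:E) ^\+)%E = EFin \o fp by apply/funext => p; rewrite funeposE /= /fp EFin_max.
have -> : ((fun p => (f p)%:E) ^\-)%E = EFin \o fm by apply/funext => p; rewrite funenegE /= /fm EFin_max EFinN.
rewrite !nonneg//; [|by move=> p; rewrite /fm le_max lexx orbT|by move=> p; rewrite /fp le_max lexx orbT].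
rewrite -EFinB -mulrBr -RintegralB//; [|exact: bm_integrableT (Rint_lift_bm _)|exact: bm_integrableT (Rint_lift_bm _)].
congr (_ * _)%:E; apply: eq_Rintegral => om _; rewrite -RintegralB//; [|exact: Rint_lift_integrable|exact: Rint_lift_integrable].
by apply: eq_Rintegral => t _; rewrite /fp /fm; case: (leP 0 (f (lift (X t om, V t om)))) => h; rewrite /Num.max; do ?case: ifP; lra.
Qed.

End occupation_prob.

Section bounded_control.
Context (R : realType) (n : nat) (d : measure_display) (W : measurableType d)
  (P : probability W R) (F : R -> set (set W)) (w : R -> W -> 'rV[R]_n).
Hypotheses (fF : filtration F) (bw : brownian P F w).
Local Notation lam := (@lebesgue_measure R).
Implicit Types T t s : R.

Lemma progressive_jm (v : R -> W -> 'rV[R]_n) T i : 0 <= T -> progressive F v -> jm T (fun t om => v t om ord0 i).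
Proof.
move=> T0 pv; have mv := pv T i T0.
pose h (p : measurableTypeR R * W) : measurableTypeR R * g_sigma_algebraType (F T) := (p.1, p.2).
have mh : measurable_fun setT h.
  apply/measurable_fun_pairP; split; first exact: measurable_fst.
  move=> _ B mB; rewrite setTI.
  rewrite (_ : _ @^-1` B = setT `*` (B : set W)); last by apply/seteqP; split=> p //= [].
  apply: measurableX => //.
  have [sF sub _] := fF.
  have sFT : <<s F T >> `<=` @measurable _ W.
    by apply: smallest_sub; [exact: sigma_algebra_measurable|exact: sub].
  by apply: sFT.
apply: (@measurable_comp _ _ _ _ _ _ (`[0, T]%classic `*` setT) _ (`[0, T]%classic `*` setT) h _ _ mv).
- by apply: measurableX => //; exact: measurable_itv.
- by move=> _ [p [? ?] <-].
- exact: measurable_funTS mh.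
Qed.

Lemma Rint_split (f : R -> R) a b c : a <= b -> b <= c ->
  lam.-integrable `[a, c] (EFin \o f) ->
  \int[lam]_(t in `[a, c]) f t = \int[lam]_(t in `[a, b]) f t + \int[lam]_(t in `[b, c]) f t.
Proof.
move=> ab bc fi.
have := @Rintegral_itvB _ f (BLeft a) (BRight c) b fi.
rewrite !bnd_simp => /(_ ab bc) h.
rewrite -(@Rintegral_itv_obnd_cbnd _ b (BRight c) f); first by rewrite -h; lra.
apply: integrableS fi => //.
by apply: subset_itv; rewrite ?bnd_simp.
Qed.

Section path.
Context (v : R -> W -> 'rV[R]_n) (sigma : R) (x0 : 'rV[R]_n) (C : R).
Hypotheses (pv : progressive F v) (vC : forall t om, 0 <= t -> `|v t om| <= C).
Local Notation X := (diffusion w sigma x0 v).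
Local Notation drift a b om i := (\int[lam]_(s in `[a, b]) v s om ord0 i).

Lemma control_jm T i : 0 <= T -> jm T (fun t om => v t om ord0 i).
Proof. by move=> T0; exact: progressive_jm. Qed.

Lemma control_jb T i : jb T C (fun t om => v t om ord0 i).
Proof. by move=> t om /andP[t0 _]; apply: le_trans (coord_le_norm _ _) (vC _ t0). Qed.

Lemma control_integrable a b om i : 0 <= a -> 0 <= b -> lam.-integrable `[a, b] (EFin \o (fun t => v t om ord0 i)).
Proof. by move=> a0 b0; exact: (jb_integrable om a0 (lexx b) (control_jm i b0) (@control_jb b i)). Qed.

Lemma drift_bound a b om i : 0 <= a -> a <= b -> `|drift a b om i| <= C * (b - a).
Proof. by move=> a0 ab; exact: (jb_bound om a0 ab (lexx b) (control_jm i (le_trans a0 ab)) (@control_jb b i)). Qed.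

Lemma diffusionB a b om i : 0 <= a -> a <= b ->
  X b om ord0 i - X a om ord0 i = drift a b om i + sigma * (w b om ord0 i - w a om ord0 i).
Proof.
move=> a0 ab; rewrite !mxE (@Rint_split _ 0 a b)//; first by ring.
by apply: control_integrable => //; exact: le_trans a0 ab.
Qed.

Lemma brownian_jm T i : jm T (fun t om => w t om ord0 i).
Proof.
apply: jm_continuous => [t t0|om]; first exact: brownian_measurable fF bw _ _ t0.
have [_ cw _ _] := bw; have /subspace_continuousP h := cw om.
apply/subspace_continuousP => t t0; have hw := h t t0.
exact: (@cvg_comp _ _ _ (w^~ om) (fun y : 'rV[R]_n => y ord0 i) _ _ _ hw (@rV_coord_continuous R n i (w t om))).
Qed.

Lemma drift_continuous om i : {within `[0, +oo[, continuous (fun t => drift 0 t om i)}.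
Proof.
have C0 : 0 <= C by apply: le_trans (normr_ge0 _) (vC om (lexx 0)).
apply/subspace_continuousP => t /=; rewrite in_itv/= andbT => t0.
apply/cvgrPdist_le => e e0; rewrite /within/=.
apply/nbhs_ballP; exists (e / (C + 1)) => /=; first by rewrite divr_gt0//; lra.
move=> s; rewrite /ball/= ltr_pdivlMr; last lra.
rewrite in_itv/= andbT => ts s0.
have key a b : 0 <= a -> a <= b -> `|drift 0 b om i - drift 0 a om i| <= C * (b - a).
  move=> a0 ab; rewrite (@Rint_split _ 0 a b)//; last by apply: control_integrable => //; exact: le_trans a0 ab.
  by rewrite addrAC subrr add0r drift_bound.
apply: (@le_trans _ _ (C * `|t - s|)); last by have := normr_ge0 (t - s); nra.
case: (leP s t) => st.
  by rewrite [X in C * X]ger0_norm ?subr_ge0//; exact: key.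
by rewrite distrC [X in C * X]distrC [X in C * X]gtr0_norm ?subr_gt0//; apply: key => //; exact: ltW.
Qed.

Lemma diffusion_jm T i : jm T (fun t om => X t om ord0 i).
Proof.
have jd : jm T (fun t om => drift 0 t om i).
  apply: jm_continuous => [t t0|om]; last exact: drift_continuous.
  exact: (jb_Rint_measurable P (lexx 0) t0 (lexx t) (control_jm i t0) (@control_jb t i)).
have := jmD (jmD (@jm_cst _ _ _ T (x0 ord0 i)) jd) (jmM (@jm_cst _ _ _ T sigma) (@brownian_jm T i)).
by apply: eq_measurable_fun => p _; rewrite mxE.
Qed.

End path.

Section noise.
Implicit Types (a b h : R) (k : nat).

Lemma increment_jm a T : 0 <= a -> jm T (fun t om => `|w t om - w a om|).
Proof.
move=> a0; apply: (@measurable_rV R n _ _ _ (fun p => w p.1 p.2 - w a p.2) (fun x => `|x|)).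
- by apply: measurableX => //; exact: measurable_itv.
- move=> i; have ma : jm T (fun _ om => - w a om ord0 i).
    by apply: jm_om; apply: measurableT_comp => //; exact: brownian_measurable fF bw _ _ a0.
  have := jmD (@brownian_jm T i) ma.
  by apply: eq_measurable_fun => p _; rewrite !mxE.
- exact: norm_continuous.
Qed.

Lemma increment_measurable a b : 0 <= a -> 0 <= b -> measurable_fun setT (fun om => `|w b om - w a om|).
Proof.
move=> a0 b0; apply: (@measurable_rV R n _ _ setT (fun om => w b om - w a om) (fun x => `|x|)) => //.
  move=> i; apply: (eq_measurable_fun (fun om => w b om ord0 i - w a om ord0 i)).
    by move=> om _; rewrite !mxE.
  by apply: measurable_funB; exact: brownian_measurable fF bw _ _ _.
exact: norm_continuous.
Qed.

(** A continuous path is bounded on a compact interval. The bound depends on [om], so expectations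
    of such quantities are estimated through nonnegative integrals. *)
Lemma increment_bm a b om : 0 <= a -> a <= b -> bm `[a, b] (fun t => `|w t om - w a om|).
Proof.
move=> a0 ab; split; first exact: (jm_sectionS om a0 (lexx b) (increment_jm (T:=b) a0)).
have cf : {within `[a, b], continuous (fun t => `|w t om - w a om|)}.
  have [_ cw _ _] := bw; have /subspace_continuousP h := cw om.
  apply/subspace_continuousP => t /= tab.
  have t0 : `[0, +oo[%classic t by move: tab; rewrite /= !in_itv/= andbT => /andP[? _]; exact: le_trans a0 _.
  have hw := h t t0.
  have hw' : w^~ om x @[x --> within `[a, b] (nbhs t)] --> w t om.
    apply: cvg_trans hw; apply: cvg_app; apply: within_subset.
    by move=> s /=; rewrite !in_itv/= andbT => /andP[? _]; exact: le_trans a0 _.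
  exact: (cvg_norm (cvgB hw' (cvg_cst (w a om)))).
have [c _ Hc] := EVT_max ab cf.
by exists (`|w c om - w a om|) => t tab; rewrite normr_id; exact: Hc.
Qed.

(** All that the noise contributes during one time step: its increment at the end of the step and
    its deviation accumulated within it. Both the cost estimate and the holonomy estimate use
    nothing else of it than its expectation. *)
Definition noise h k om : R := `|w (k.+1%:R * h) om - w (k%:R * h) om| +
  \int[lam]_(t in `[k%:R * h, k.+1%:R * h]) `|w t om - w (k%:R * h) om|.

Lemma noise_ge0 h k om : 0 <= noise h k om.
Proof. by rewrite addr_ge0//; apply: Rintegral_ge0. Qed.

Lemma fine_le (x : \bar R) : (0 <= x -> (fine x)%:E <= x)%E.
Proof. by case: x => // _; rewrite leey. Qed.

Lemma noise_measurable h k : 0 < h -> measurable_fun setT (noise h k).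
Proof.
move=> h0; have a0 : 0 <= k%:R * h by rewrite mulr_ge0// ltW.
have b0 : 0 <= k.+1%:R * h by rewrite mulr_ge0// ltW.
have jf := increment_jm (T:=k.+1%:R * h) a0.
apply: measurable_funD.
  exact: increment_measurable.
have [|mI _] := jm_tonelli P a0 (lexx _) jf; first by [].
by apply: measurableT_comp mI; exact: fine_measurable.
Qed.

Lemma noise_expect h k : 0 < h -> h <= 1 -> (\int[P]_om (noise h k om)%:E <= (n%:R * 6)%:E)%E.
Proof.
move=> h0 h1; have a0 : 0 <= k%:R * h by rewrite mulr_ge0// ltW.
have ab : k%:R * h <= k.+1%:R * h by rewrite ler_pM2r// ler_nat.
have hh : k.+1%:R * h - k%:R * h = h by rewrite -mulrBl -natr1 addrAC subrr add0r mul1r.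
have b0 : 0 <= k.+1%:R * h by rewrite mulr_ge0// ltW.
have jf := increment_jm (T:=k.+1%:R * h) a0.
have [|mI eI] := jm_tonelli P a0 (lexx _) jf; first by [].
have I0 om : (0 <= \int[lam]_(t in `[(k%:R * h)%R, (k.+1%:R * h)%R]) (`|w t om - w (k%:R * h) om|)%:E)%E.
  by apply: integral_ge0 => t _; rewrite lee_fin.
apply: (@le_trans _ _ (\int[P]_om ((`|w (k.+1%:R * h) om - w (k%:R * h) om|)%:E +
  \int[lam]_(t in `[(k%:R * h)%R, (k.+1%:R * h)%R]) (`|w t om - w (k%:R * h) om|)%:E))%E).
  apply: ge0_le_integral => //.
  - by move=> om _; rewrite lee_fin noise_ge0.
  - by apply/measurable_EFinP; exact: noise_measurable.
  - apply: emeasurable_funD => //; apply/measurable_EFinP.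
    exact: increment_measurable.
  - by move=> om _; rewrite /noise EFinD leeD2l// fine_le.
rewrite ge0_integralD//; last first.
- by apply/measurable_EFinP; exact: increment_measurable.
rewrite eI.
have -> : n%:R * 6 = n%:R * 3 + n%:R * 3 :> R by ring.
rewrite EFinD; apply: leeD.
  by apply: brownian_increment fF bw _ _ _ _ _ => //; rewrite hh.
apply: (@le_trans _ _ (\int[lam]_(t in `[(k%:R * h)%R, (k.+1%:R * h)%R]) (n%:R * 3)%:E)%E).
  apply: ge0_le_integral => //.
  - by move=> t _; apply: integral_ge0 => om _; rewrite lee_fin.
  - have mF := jm_patch 0 a0 (lexx _) jf.
    have mF' : measurable_fun setT (fun p : measurableTypeR R * W => (if k%:R * h <= p.1 <= k.+1%:R * h then `|w p.1 p.2 - w (k%:R * h) p.2| else 0)%:E).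
      exact/measurable_EFinP.
    have := @measurable_fun_fubini_tonelli_F _ _ _ _ _ P _ mF'.
    move=> /(_ (fun p => _)) mG.
    apply: eq_measurable_fun (measurable_funTS (mG _)).
      move=> t; rewrite inE/= in_itv/= => tab; apply: eq_integral => om _ /=; by rewrite tab.
    by move=> p; case: ifP.
  - move=> t /=; rewrite in_itv/= => /andP[h2 h3].
    apply: brownian_increment fF bw _ _ _ _ _ => //; move: hh; lra.
rewrite integral_cst//= lebesgue_measure_itv/= lte_fin.
case: ifP => _; last by rewrite mule0 lee_fin mulr_ge0.
by rewrite -EFinB hh -EFinM lee_fin ler_piMr// mulr_ge0.
Qed.

Lemma expect_le_noise (f : W -> R) (a b h : R) N : bm setT f -> 0 <= b -> 0 < h -> h <= 1 ->
  (forall om, f om <= a + b * \sum_(k < N) noise h k om) ->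
  \int[P]_om f om <= a + b * (N%:R * (n%:R * 6)).
Proof.
move=> bf b0 h0 h1 fle; rewrite -lerBlDl -[X in _ - X](Rint_prob_cst P) -RintegralB//; [|exact: bm_integrableT|exact/bm_integrableT/bm_cst].
(* The positive part turns the comparison into one between nonnegative functions, where the
   expectation of the noise may be taken as an extended real. *)
have bu : bm setT (fun om => Num.max 0 (f om - a)).
  have [mf [C fC]] := bf; split.
    by apply: measurable_maxr => //; apply: measurable_funB.
  exists (C + `|a|) => om _; have h3 := fC om I; have h4 := ler_normB (f om) a; have h5 := normr_ge0 (f om - a).
    by case: (leP 0 (f om - a)) => h2; rewrite ?normr0; lra.
apply: (@le_trans _ _ (\int[P]_om Num.max 0 (f om - a))).
  by apply: Rint_leP => //; [apply: bmB => //; exact: bm_cst|move=> om; rewrite le_max lexx orbT].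
apply: Rint_le_EFin; first by move=> om; rewrite le_max lexx.
apply: (@le_trans _ _ (\int[P]_om (b%:E * (\sum_(k < N) (noise h k om)%:E)))%E).
  apply: ge0_le_integral => //.
  - by move=> om _; rewrite lee_fin le_max lexx.
  - by apply/measurable_EFinP; case: bu.
  - apply: emeasurable_funM => //; apply: emeasurable_sum => k.
    by apply/measurable_EFinP; exact: noise_measurable.
  - move=> om _; rewrite sumEFin -EFinM lee_fin ge_max lerBlDl fle andbT.
    by rewrite mulr_ge0// sumr_ge0// => k _; exact: noise_ge0.
rewrite ge0_integralZl//; last 2 first.
- apply: emeasurable_sum => k; by apply/measurable_EFinP; exact: noise_measurable.
- by move=> om _; rewrite sume_ge0// => k _; rewrite lee_fin noise_ge0.
rewrite EFinM; apply: lee_wpmul2l; first by rewrite lee_fin.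
rewrite ge0_integral_sum//; last 2 first.
- move=> k; by apply/measurable_EFinP; exact: noise_measurable.
- by move=> k om _; rewrite lee_fin noise_ge0.
apply: (@le_trans _ _ (\sum_(k < N) (n%:R * 6)%:E)%E).
  by apply: lee_sum => k _; exact: noise_expect.
by rewrite sumEFin lee_fin sumr_const card_ord -[leLHS]mulr_natl.
Qed.

End noise.
End bounded_control.

(** * Smooth periodic functions *)

Section directional.
Context (R : realType) (n : nat).
Implicit Types (f : 'rV[R]_n -> R) (x v : 'rV[R]_n).

Lemma line_is_derive f x v (t : R) : derivable f (x + t *: v) v ->
  is_derive t 1 (fun s : R => f (x + s *: v)) ('D_v f (x + t *: v)).
Proof.
move=> df.
have e : (fun h : R => h^-1 *: (f (x + (h *: 1 + t) *: v) - f (x + t *: v))) =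
  (fun h : R => h^-1 *: (f (h *: v + (x + t *: v)) - f (x + t *: v))).
  apply/funext => h; congr (_ *: (f _ - _)).
  by rewrite scalerDl [h *: 1]mulr1 addrCA.
apply: DeriveDef; first by rewrite /derivable e.
by rewrite /derive e.
Qed.

Lemma derive_line f x v (c : R) :
  is_derive (0 : R) 1 (fun s : R => f (x + s *: v)) c -> is_derive x v f c.
Proof.
move=> df.
have e : (fun h : R => h^-1 *: (f (x + (h *: 1 + 0) *: v) - f (x + 0 *: v))) =
  (fun h : R => h^-1 *: (f (h *: v + x) - f x)).
  apply/funext => h; rewrite scale0r addr0 addr0 [h *: 1]mulr1.
  by rewrite [x + _]addrC.
have [d1 d2] := df.
apply: DeriveDef; first by move: d1; rewrite /derivable e.
by move: d2; rewrite /derive e.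
Qed.

Lemma line_mvt f x v (a C : R) :
  (forall t, `|t| <= `|a| -> derivable f (x + t *: v) v /\ `|'D_v f (x + t *: v)| <= C) ->
  `|f (x + a *: v) - f x| <= C * `|a|.
Proof.
move=> H.
pose g (s : R) := f (x + s *: v).
have g0 : g 0 = f x by rewrite /g scale0r addr0.
rewrite -g0 -/(g a).
have key b c : b <= c -> (forall t, b <= t <= c -> `|t| <= `|a|) -> `|g c - g b| <= C * (c - b).
  move=> bc hb.
  have dg t : t \in `]b, c[ -> is_derive t 1 g ('D_v f (x + t *: v)).
    rewrite in_itv/= => /andP[h1 h2]; apply: line_is_derive.
    by have [|] := H t; first by apply: hb; rewrite !ltW.
  have cg : {within `[b, c], continuous g}.
    apply: derivable_within_continuous => t; rewrite in_itv/= => tbc.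
    by have [|d1 _] := H t; [exact: hb|have [] := line_is_derive d1].
  have [t tbc ->] := MVT_segment bc dg cg.
  rewrite normrM [X in _ * X]ger0_norm ?subr_ge0// ler_wpM2r ?subr_ge0//.
  by have [|] := H t; first by apply: hb; move: tbc; rewrite in_itv.
case: (leP 0 a) => a0.
  rewrite [X in C * X]ger0_norm// -[X in C * X]subr0; apply: key => // t /andP[h1 h2].
  by rewrite !ger0_norm.
rewrite distrC [X in C * X]ltr0_norm// -[X in C * X]add0r; apply: key => [|t /andP[h1 h2]]; first exact: ltW.
by rewrite !ler0_norm ?lerN2// ltW.
Qed.

(** The point moves along one coordinate at a time, so that only partial derivatives occur; the
    intermediate points remain within [|z|] of [x] in the sup norm. *)
Lemma coord_mvt f x z (C : R) :
  (forall y i, `|y - x| <= `|z| -> derivable f y (delta_mx ord0 i) /\ `|'D_(delta_mx ord0 i) f y| <= C) ->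
  `|f (x + z) - f x| <= C * \sum_i `|z ord0 i|.
Proof.
move=> H.
pose pt (k : nat) : 'rV[R]_n := x + \row_i (if (i < k)%N then z ord0 i else 0).
have p0 : pt 0%N = x by apply/rowP => i; rewrite !mxE ltn0 addr0.
have pn : pt n = x + z by apply/rowP => i; rewrite !mxE ltn_ord.
rewrite -pn -p0 -(telescope_sumr (f \o pt))// mulr_sumr big_mkord.
apply: le_trans (ler_norm_sum _ _ _) _; apply: ler_sum => k _ /=.
have -> : pt k.+1 = pt k + z ord0 k *: delta_mx ord0 k.
  apply/rowP => i; rewrite !mxE eqxx/= -addrA; congr (_ + _).
  rewrite ltnS leq_eqVlt; case: (eqVneq i k) => [->|ik] /=.
    by rewrite eqxx ltnn mulr1 add0r.
  by rewrite (inj_eq val_inj) (negbTE ik)/= mulr0 addr0.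
apply: line_mvt => t tz; apply: H.
apply: norm_rV_le => // i; rewrite !mxE eqxx/=.
case: (eqVneq i k) => [->|ik].
  rewrite ltnn mulr1 addr0 addrAC subrr add0r; exact: le_trans tz (coord_le_norm _ _).
rewrite mulr0 addr0 addrAC subrr add0r.
by case: ifP => _; [exact: coord_le_norm|rewrite normr0].
Qed.

Lemma linear_is_derive (a : 'rV[R]_n) x v :
  is_derive x v (fun y => \sum_i y ord0 i * a ord0 i) (\sum_i v ord0 i * a ord0 i).
Proof.
apply: derive_line.
have -> : (fun s : R => \sum_i (x + s *: v) ord0 i * a ord0 i) =
  (fun s => \sum_i x ord0 i * a ord0 i + s * \sum_i v ord0 i * a ord0 i).
  apply/funext => s; rewrite mulr_sumr -big_split/=; apply: eq_bigr => i _.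
  by rewrite !mxE; ring.
by apply: is_derive_eq; rewrite /GRing.scale/=; ring.
Qed.

End directional.

Section periodic.
Context (R : realType) (n : nat).
Implicit Types (f : 'rV[R]_n -> R) (x v : 'rV[R]_n).

Definition per f := forall x z, f (x + intv R z) = f x.

Lemma per_torus (h : torus R n -> R) : per (h \o @to_torus R n).
Proof. by move=> x z /=; rewrite to_torusD. Qed.

Lemma per_repr f x : per f -> f (repr (to_torus x)) = f x.
Proof.
move=> pf; have /to_torusP/lattice_eqP[z ->] : to_torus (repr (to_torus x)) = to_torus x by rewrite to_torusK.
exact: pf.
Qed.

Lemma per_continuous f : per f -> continuous f -> continuous (fun p : phase R n => f (repr p.1)).
Proof.
move=> pf cf; apply/phase_continuousP.
rewrite (_ : _ \o _ = f \o fst); last by apply/funext => p /=; rewrite per_repr.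
by move=> p; apply: continuous_comp; [exact: cvg_fst|exact: cf].
Qed.

Lemma per_bounded f : per f -> continuous f -> exists2 B, 0 <= B & forall x, `|f x| <= B.
Proof.
move=> pf cf; have [B HB] := phase_bounded 0 (per_continuous pf cf).
have h x : `|f x| <= B by have := HB x 0; rewrite normr0 lexx /= per_repr// => /(_ isT).
by exists B => //; exact: le_trans (normr_ge0 _) (h 0).
Qed.

Lemma per_derive f v : per f -> per (fun x => 'D_v f x).
Proof.
move=> pf x z; rewrite /derive pf.
by under eq_fun do rewrite /= addrA pf.
Qed.

Local Notation "'E i" := (delta_mx ord0 i : 'rV[R]_n) (at level 10).

Lemma norm_sum_le (z : 'rV[R]_n) : \sum_i `|z ord0 i| <= n%:R * `|z|.
Proof.
rewrite -[n in n%:R]card_ord mulr_natl -sumr_const.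
by apply: ler_sum => i _; exact: coord_le_norm.
Qed.

(** Periodicity makes the continuous first and second partial derivatives bounded; the Lipschitz and
    Taylor bounds then follow from [coord_mvt], all with one constant. *)
Lemma smooth_estimates f : per f -> smooth f -> exists2 C, 0 <= C &
  [/\ forall x, `|f x| <= C, forall x i, `|'D_('E i) f x| <= C,
      forall x y, `|f x - f y| <= C * `|x - y|,
      forall x y i, `|'D_('E i) f x - 'D_('E i) f y| <= C * `|x - y| &
      forall x z, `|f (x + z) - f x - \sum_i z ord0 i * 'D_('E i) f x| <= C * `|z| ^+ 2].
Proof.
move=> pf sf.
have fin (G : 'I_n -> 'rV[R]_n -> R) : (forall i, per (G i)) -> (forall i, continuous (G i)) ->
    exists2 B, 0 <= B & forall i x, `|G i x| <= B.
  move=> pG cG; have /choice[b Hb] i : exists b, 0 <= b /\ forall x, `|G i x| <= b.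
    by have [b b0 Hb] := per_bounded (pG i) (cG i); exists b.
  exists (\sum_i b i); first by apply: sumr_ge0 => i _; have [] := Hb i.
  move=> i x; have [_ /(_ x) h] := Hb i; apply: le_trans h _.
  by rewrite (bigD1 i)//= lerDl sumr_ge0// => j _; have [] := Hb j.
have [B0 B00 H0] := per_bounded pf (sf [::]).1.
have [B1 B10 H1] := fin (fun i x => 'D_('E i) f x) (fun i => @per_derive f ('E i) pf) (fun i => (sf [:: 'E i]).1).
have [B2 B20 H2] : exists2 B, 0 <= B & forall i j x, `|'D_('E j) (fun x => 'D_('E i) f x) x| <= B.
  have /choice[b Hb] j : exists b, 0 <= b /\ forall i x, `|'D_('E j) (fun x => 'D_('E i) f x) x| <= b.
    have [] := fin (fun i x => 'D_('E j) (fun x => 'D_('E i) f x) x).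
    - by move=> i; do 2 apply: per_derive.
    - by move=> i; exact: (sf [:: 'E j; 'E i]).1.
    - by move=> b; exists b.
  exists (\sum_i b i); first by apply: sumr_ge0 => i _; have [] := Hb i.
  move=> i j x; have [_ /(_ i x) h] := Hb j; apply: le_trans h _.
  by rewrite (bigD1 j)//= lerDl sumr_ge0// => k _; have [] := Hb k.
have N0 : 0 <= n%:R :> R by [].
have lip1 x y i : `|'D_('E i) f x - 'D_('E i) f y| <= B2 * (n%:R * `|x - y|).
  have := @coord_mvt _ _ (fun x => 'D_('E i) f x) y (x - y) B2.
  rewrite [y + _]addrC subrK => h; apply: le_trans (h _) _.
    by move=> z j _; split; [exact: (sf [:: 'E i]).2|exact: H2].
  by rewrite ler_wpM2l// norm_sum_le.
exists (B0 + B1 + B1 * n%:R + B2 * n%:R + B2 * n%:R * n%:R); first by rewrite !addr_ge0// !mulr_ge0//.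
have e1 : 0 <= B1 * n%:R by rewrite mulr_ge0.
have e2 : 0 <= B2 * n%:R by rewrite mulr_ge0.
have e3 : 0 <= B2 * n%:R * n%:R by rewrite !mulr_ge0.
split.
- by move=> x; apply: le_trans (H0 x) _; lra.
- by move=> x i; apply: le_trans (H1 i x) _; lra.
- move=> x y; have := @coord_mvt _ _ f y (x - y) B1.
  rewrite [y + _]addrC subrK => h; apply: le_trans (h _) _.
    by move=> z j _; split; [exact: (sf [::]).2|exact: H1].
  apply: (@le_trans _ _ (B1 * (n%:R * `|x - y|))); first by rewrite ler_wpM2l// norm_sum_le.
  by rewrite mulrA ler_wpM2r//; lra.
- move=> x y i; apply: le_trans (lip1 x y i) _.
  by rewrite mulrA ler_wpM2r//; lra.
- move=> x z.
  pose a : 'rV[R]_n := \row_i 'D_('E i) f x.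
  (* Without its linear part at [x], the function has partial derivatives of size [|z|] on the ball
     of radius [|z|], and the mean value estimate becomes quadratic. *)
  pose q y := f y - \sum_i y ord0 i * a ord0 i.
  have dq y i : is_derive y ('E i) q ('D_('E i) f y - 'D_('E i) f x).
    have -> : 'D_('E i) f x = \sum_j ('E i) ord0 j * a ord0 j.
      rewrite (bigD1 i)//= big1 ?addr0; first by rewrite !mxE !eqxx mul1r.
      by move=> j /negbTE ji; rewrite !mxE eqxx ji mul0r.
    apply: is_deriveB; last exact: linear_is_derive.
    by apply: DeriveDef => //; exact: (sf [::]).2.
  have := @coord_mvt _ _ q x z (B2 * (n%:R * `|z|)).
  have -> : q (x + z) - q x = f (x + z) - f x - \sum_i z ord0 i * 'D_('E i) f x.
    rewrite /q; have -> : \sum_i (x + z) ord0 i * a ord0 i = \sum_i x ord0 i * a ord0 i + \sum_i z ord0 i * 'D_('E i) f x.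
      by rewrite -big_split/=; apply: eq_bigr => i _; rewrite !mxE; ring.
    by ring.
  move=> h; apply: le_trans (h _) _.
    move=> y i yz; have [d1 d2] := dq y i; split=> //.
    by rewrite d2; apply: le_trans (lip1 _ _ _) _; rewrite !ler_wpM2l.
  apply: (@le_trans _ _ (B2 * (n%:R * `|z|) * (n%:R * `|z|))).
    by rewrite ler_wpM2l ?norm_sum_le// !mulr_ge0.
  rewrite (_ : _ * _ * _ = B2 * n%:R * n%:R * `|z| ^+ 2); last by ring.
  by rewrite ler_wpM2r ?exprn_ge0//; lra.
Qed.

End periodic.

(** * Trigonometric functions stable under differentiation *)

Section trig.
Context (R : realType) (n : nat).
Implicit Types (f : 'rV[R]_n -> R) (x v : 'rV[R]_n).

(* A class of smooth functions closed under differentiation. *)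
Inductive trig : ('rV[R]_n -> R) -> Prop :=
| trig_cst c : trig (fun=> c)
| trig_cos (a : 'rV[R]_n) (d : R) : trig (fun x => cos (\sum_i x ord0 i * a ord0 i + d))
| trigD f g : trig f -> trig g -> trig (fun x => f x + g x)
| trigM f g : trig f -> trig g -> trig (fun x => f x * g x).

Lemma trig_continuous f : trig f -> continuous f.
Proof.
elim=> {f} [c|a d|f g _ cf _ cg|f g _ cf _ cg].
- exact: cst_continuous.
- move=> x; apply: (@continuous_comp _ _ _ (fun x => \sum_i x ord0 i * a ord0 i + d) (@cos R)); last exact: continuous_cos.
  apply: continuousD_fun; last exact: cst_continuous.
  apply: sum_continuous => i; apply: continuousM_fun; [exact: rV_coord_continuous|exact: cst_continuous].
- exact: continuousD_fun.
- exact: continuousM_fun.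
Qed.

(** Writing the derivative as a cosine with shifted phase keeps the class [trig] closed without a
    separate constructor for the sine. *)
Lemma cos_line (c b : R) : is_derive (0 : R) 1 (fun s : R => cos (c + s * b)) (b * cos (c + pi / 2)).
Proof.
pose l (s : R) := c + s * b.
have dl : is_derive (0 : R) 1 l b by apply: is_derive_eq; rewrite /GRing.scale/=; ring.
have dc : is_derive (l 0) 1 (@cos R) (- sin (l 0)) := is_derive_cos (l 0).
have := @is_derive1_comp _ (@cos R) l 0 _ _ dc dl.
by rewrite cosDpihalf {2}/l mul0r addr0 mulrC.
Qed.

Lemma trig_derive f v : trig f -> exists2 g, trig g & forall x, is_derive x v f (g x).
Proof.
elim=> {f} [c|a d|f g tf [f' tf' df] tg [g' tg' dg]|f g tf [f' tf' df] tg [g' tg' dg]].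
- by exists (fun=> 0); [exact: trig_cst|move=> x; exact: is_derive_cst].
- exists (fun x => (\sum_i v ord0 i * a ord0 i) * cos (\sum_i x ord0 i * a ord0 i + (d + pi / 2))).
    by apply: trigM; [exact: trig_cst|exact: trig_cos].
  move=> x; apply: derive_line.
  have -> : (fun s : R => cos (\sum_i (x + s *: v) ord0 i * a ord0 i + d)) =
    (fun s => cos ((\sum_i x ord0 i * a ord0 i + d) + s * \sum_i v ord0 i * a ord0 i)).
    apply/funext => s /=; congr cos; rewrite mulr_sumr addrAC -big_split/=; congr (_ + _); apply: eq_bigr => i _.
    by rewrite !mxE; ring.
  by rewrite addrA; exact: cos_line.
- by exists (fun x => f' x + g' x); [exact: trigD|move=> x; apply: is_deriveD].
- exists (fun x => f x * g' x + g x * f' x); first by apply: trigD; exact: trigM.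
  by move=> x; exact: is_deriveM.
Qed.

Lemma trig_iter f s : trig f -> trig (iter_derive f s).
Proof.
move=> tf; elim: s => //= v s IH; have [g tg dg] := trig_derive v IH.
rewrite (_ : (fun x => _) = g)//; apply/funext => x.
by have [_ ->] := dg x.
Qed.

Lemma trig_smooth f : trig f -> smooth f.
Proof.
move=> tf s; have ts := trig_iter s tf; split; first exact: trig_continuous.
by move=> x v; have [g _ /(_ x)[]] := trig_derive v ts.
Qed.

Lemma trig_shift f y : trig f -> trig (fun x => f (x - y)).
Proof.
elim=> {f} [c|a d|f g _ tf _ tg|f g _ tf _ tg].
- exact: trig_cst.
- rewrite (_ : (fun x => _) = (fun x => cos (\sum_i x ord0 i * a ord0 i + (d - \sum_i y ord0 i * a ord0 i)))).
    exact: trig_cos.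
  apply/funext => x; congr cos; rewrite [d - _]addrC addrA -sumrB; congr (_ + _).
  by apply: eq_bigr => i _; rewrite !mxE; ring.
- exact: trigD.
- exact: trigM.
Qed.

Lemma trig_sum (I : Type) (r : seq I) (F : I -> 'rV[R]_n -> R) : (forall i, trig (F i)) ->
  trig (fun x => \sum_(i <- r) F i x).
Proof.
move=> tF; elim: r => [|i r IH].
  by rewrite (_ : (fun x => _) = fun=> 0); [exact: trig_cst|apply/funext => x; rewrite big_nil].
by rewrite (_ : (fun x => _) = fun x => F i x + \sum_(j <- r) F j x); [exact: trigD|apply/funext => x; rewrite big_cons].
Qed.

Lemma trig_prod (I : Type) (r : seq I) (F : I -> 'rV[R]_n -> R) : (forall i, trig (F i)) ->
  trig (fun x => \prod_(i <- r) F i x).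
Proof.
move=> tF; elim: r => [|i r IH].
  by rewrite (_ : (fun x => _) = fun=> 1); [exact: trig_cst|apply/funext => x; rewrite big_nil].
by rewrite (_ : (fun x => _) = fun x => F i x * \prod_(j <- r) F j x); [exact: trigM|apply/funext => x; rewrite big_cons].
Qed.

End trig.

(** * Limits are almost holonomic *)

(** Cutting into [N] pieces gives a total variation of order [1/N]. This replaces differentiation in
    time: the control is only measurable, so the path need not be differentiable at every time. *)
Lemma quadratic_increments_cst (R : realType) (G : R -> R) (C a b : R) : a <= b ->
  (forall s t, a <= s -> s <= t -> t <= b -> `|G t - G s| <= C * (t - s) ^+ 2) -> G b = G a.
Proof.
move=> ab H; apply/eqP; rewrite -subr_eq0 -normr_le0; apply/ler_addgt0Pr => e e0; rewrite add0r.
have C0 : 0 <= C * (b - a) ^+ 2 by apply: le_trans (normr_ge0 _) (H a b _ _ _).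
have [N HN] := natr_large (C * (b - a) ^+ 2 / e).
rewrite ltr_pdivrMr// in HN.
pose d := (b - a) / N.+1%:R.
have d0 : 0 <= d by rewrite divr_ge0// subr_ge0.
have Nd : N.+1%:R * d = b - a by rewrite /d mulrC divfK.
have -> : G b - G a = \sum_(0 <= k < N.+1) (G (a + k.+1%:R * d) - G (a + k%:R * d)).
  rewrite (telescope_sumr (fun k => G (a + k%:R * d)))// mul0r addr0 Nd.
  by congr (G _ - _); ring.
rewrite big_mkord; apply: le_trans (ler_norm_sum _ _ _) _.
apply: (@le_trans _ _ (\sum_(k < N.+1) C * d ^+ 2)).
  apply: ler_sum => k _.
  have e1 : (a + k.+1%:R * d) - (a + k%:R * d) = d by rewrite -natr1; ring.
  rewrite -[X in C * X ^+ 2]e1; apply: H.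
  - by rewrite lerDl mulr_ge0.
  - by rewrite lerD2l ler_wpM2r// ler_nat.
  - rewrite -lerBrDl -Nd ler_wpM2r// ler_nat; exact: ltn_ord.
rewrite sumr_const card_ord -[leLHS]mulr_natl.
have -> : N.+1%:R * (C * d ^+ 2) = C * (b - a) ^+ 2 / N.+1%:R.
  by rewrite /d; field.
by rewrite ler_pdivrMr// [e * _]mulrC ltW.
Qed.

Lemma continuous_norm_fun (R : realType) (T : topologicalType) (f : T -> R) : continuous f ->
  continuous (fun x => `|f x|).
Proof. by move=> cf x; apply: cvg_norm; exact: cf. Qed.

Lemma seq_lim_le_near (R : realType) (u : nat -> R) (l a : R) : u k @[k --> \oo] --> l ->
  (\forall k \near \oo, u k <= a) -> l <= a.
Proof.
by move=> ul ua; rewrite -(cvg_lim (@Rhausdorff R) ul); apply: limr_le => //; apply: cvgP ul.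
Qed.

(** [2 * C] is the boundary term, which the length of the time interval reduces to at most [e]; the
    noise term counts at most [2 * T] steps, each of expected size [6 * N]. *)
Lemma time_average_bound (R : realType) (T a b I1 I2 C A D N e : R) : 0 < T -> 0 < e ->
  2 * C / e <= T -> a = T^-1 * I1 -> b = T^-1 * I2 ->
  `|I1| <= 2 * C + A * (2 * T * (N * 6)) + D * I2 -> `|a| - D * b <= A * (12 * N) + e.
Proof.
move=> T0 e0 Te -> ->; rewrite normrM gtr0_norm ?invr_gt0//.
have -> : T^-1 * `|I1| - D * (T^-1 * I2) = (`|I1| - D * I2) / T by ring.
rewrite ler_pdivrMr//.
by rewrite ler_pdivrMr// in Te => h; lra.
Qed.

Lemma rVB (R : realType) n (x y : 'rV[R]_n) i : (x - y) ord0 i = x ord0 i - y ord0 i.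
Proof. by rewrite !mxE. Qed.

Lemma Rint_itv_dist (R : realType) (f g h : R -> R) (s t : R) : s <= t ->
  bm `[s, t] f -> bm `[s, t] g -> bm `[s, t] h -> (forall r, s <= r <= t -> `|f r - g r| <= h r) ->
  `|\int[lebesgue_measure]_(r in `[s, t]) f r - \int[lebesgue_measure]_(r in `[s, t]) g r| <=
    \int[lebesgue_measure]_(r in `[s, t]) h r.
Proof.
move=> st bf bg bh fg.
have mI : measurable (`[s, t]%classic : set R) by exact: measurable_itv.
rewrite -RintegralB//; [|by apply: bm_integrable => //; exact: itv_fin|by apply: bm_integrable => //; exact: itv_fin].
apply: le_trans (le_normr_Rintegral _ _) _ => //.
  by apply: bm_integrable => //; [exact: itv_fin|exact: bmB].
by apply: Rint_le => //; [exact: itv_fin|by apply: bm_norm; exact: bmB].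
Qed.

Section jm_finite_sums.
Context (R : realType) d (W : measurableType d).

Lemma jm_sum (T : R) (I : Type) (r : seq I) (f : I -> R -> W -> R) : (forall i, jm T (f i)) ->
  jm T (fun t om => \sum_(i <- r) f i t om).
Proof.
move=> jf; elim: r => [|i r IH].
  rewrite (_ : (fun t om => _) = (fun _ _ => 0)); first exact: jm_cst.
  by apply/funext => t; apply/funext => om; rewrite big_nil.
rewrite (_ : (fun t om => _) = (fun t om => f i t om + \sum_(j <- r) f j t om)); first exact: jmD.
by apply/funext => t; apply/funext => om; rewrite big_cons.
Qed.

End jm_finite_sums.

Section holonomy.
Context (R : realType) (n : nat) (d : measure_display) (W : measurableType d)
  (P : probability W R) (F : R -> set (set W)) (w : R -> W -> 'rV[R]_n).
Hypotheses (fF : filtration F) (bw : brownian P F w).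
Local Notation lam := (@lebesgue_measure R).
Local Notation "'E i" := (delta_mx ord0 i : 'rV[R]_n) (at level 10).
Context (psi : 'rV[R]_n -> R) (C2 : R).
Local Notation grad i x := ('D_('E i) psi x).
Hypotheses (C20 : 0 <= C2) (psi_bound : forall x, `|psi x| <= C2)
  (grad_bound : forall x i, `|grad i x| <= C2)
  (psi_lip : forall x y, `|psi x - psi y| <= C2 * `|x - y|)
  (grad_lip : forall x y i, `|grad i x - grad i y| <= C2 * `|x - y|)
  (grad_cont : forall i, continuous (fun x => grad i x))
  (psi_taylor : forall x z, `|psi (x + z) - psi x - \sum_i z ord0 i * grad i x| <= C2 * `|z| ^+ 2).

Section path.
Context (v : R -> W -> 'rV[R]_n) (sigma : R) (x0 : 'rV[R]_n) (C : R).
Hypotheses (pv : progressive F v) (vC : forall t om, 0 <= t -> enorm (v t om) <= C) (sigma0 : 0 < sigma).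
Local Notation X := (diffusion w sigma x0 v).
Local Notation drift a b om i := (\int[lam]_(s in `[a, b]) v s om ord0 i).

Let vC' t om : 0 <= t -> `|v t om| <= C.
Proof. by move=> t0; apply: le_trans (norm_le_enorm _) (vC _ t0). Qed.

Let C0 (om : W) : 0 <= C.
Proof. by apply: le_trans (enorm_ge0 _) (vC om (lexx 0)). Qed.

Lemma jm_rV T (Y : R -> W -> 'rV[R]_n) (f : 'rV[R]_n -> R) : (forall i, jm T (fun t om => Y t om ord0 i)) ->
  continuous f -> jm T (fun t om => f (Y t om)).
Proof.
move=> jY cf; apply: (@measurable_rV R n _ _ _ (fun p => Y p.1 p.2)) => //.
by apply: measurableX => //; exact: measurable_itv.
Qed.

(* The noise frozen at time a: on [a, +oo[ the path Y a is Lipschitz. *)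
Let Y a t om : 'rV[R]_n := X t om - sigma *: (w t om - w a om).

Lemma frozen_jm a T i : 0 <= a -> jm T (fun t om => Y a t om ord0 i).
Proof.
move=> a0.
have jX := diffusion_jm fF bw sigma x0 pv vC' (T:=T) i.
have jw := brownian_jm fF bw (T:=T) i.
have ja : jm T (fun _ om => sigma * w a om ord0 i).
  by apply: jm_om; apply: measurable_funM => //; exact: brownian_measurable fF bw _ _ a0.
have jsw := jmM (@jm_cst _ _ _ T (- sigma)) jw.
have := jmD (jmD jX jsw) ja.
by apply: eq_measurable_fun => p _ /=; rewrite /Y !mxE; ring.
Qed.

Lemma frozenB a s t om i : 0 <= a -> a <= s -> s <= t -> Y a t om ord0 i - Y a s om ord0 i = drift s t om i.
Proof.
move=> a0 as_ st; have s0 := le_trans a0 as_.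
have := diffusionB w fF sigma x0 pv vC' om i s0 st.
rewrite /Y; set x := X t om; set y := X s om; rewrite !mxE; lra.
Qed.

Lemma frozen_lip a s t om : 0 <= a -> a <= s -> s <= t -> `|Y a t om - Y a s om| <= C * (t - s).
Proof.
move=> a0 as_ st; have s0 := le_trans a0 as_; apply: norm_rV_le => [|i].
  by rewrite mulr_ge0 ?subr_ge0// (C0 om).
rewrite rVB frozenB//; exact: (drift_bound fF pv vC' om i s0 st).
Qed.

Let fY a t om := \sum_i v t om ord0 i * grad i (Y a t om).
Let fX t om := \sum_i v t om ord0 i * grad i (X t om).

Lemma control_sum_bound t om (c : 'I_n -> R) (B : R) : 0 <= t -> (forall i, `|c i| <= B) ->
  `|\sum_i v t om ord0 i * c i| <= n%:R * (C * B).
Proof.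
move=> t0 cB; apply: le_trans (ler_norm_sum _ _ _) _.
rewrite -[n in n%:R]card_ord mulr_natl -sumr_const; apply: ler_sum => i _; rewrite normrM.
by apply: ler_pM => //; exact: le_trans (coord_le_norm _ _) (vC' om t0).
Qed.

Lemma fY_jm a T : 0 <= a -> 0 <= T -> jm T (fY a).
Proof.
move=> a0 T0; apply: jm_sum => i; apply: jmM; first exact: (progressive_jm fF i T0 pv).
by apply: (jm_rV (f := fun x => grad i x)) => // j; exact: frozen_jm.
Qed.

Lemma fX_jm T : 0 <= T -> jm T fX.
Proof.
move=> T0; apply: jm_sum => i; apply: jmM; first exact: (progressive_jm fF i T0 pv).
by apply: (jm_rV (f := fun x => grad i x)) => // j; exact: (diffusion_jm fF bw _ _ pv vC').
Qed.

Lemma fY_jb a T : jb T (n%:R * (C * C2)) (fY a).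
Proof. by move=> t om /andP[t0 _]; exact: control_sum_bound. Qed.

Lemma fX_jb T : jb T (n%:R * (C * C2)) fX.
Proof. by move=> t om /andP[t0 _]; exact: control_sum_bound. Qed.

Lemma fY_integrable a s t om : 0 <= a -> 0 <= s -> 0 <= t -> lam.-integrable `[s, t] (EFin \o fY a ^~ om).
Proof. by move=> a0 s0 t0; exact: (jb_integrable om s0 (lexx t) (fY_jm a0 t0) (@fY_jb a t)). Qed.

Lemma fX_integrable s t om : 0 <= s -> 0 <= t -> lam.-integrable `[s, t] (EFin \o fX ^~ om).
Proof. by move=> s0 t0; exact: (jb_integrable om s0 (lexx t) (fX_jm t0) (@fX_jb t)). Qed.

(** The difference of the two sides has quadratic increments: the Taylor bound controls that of
    [psi], and in the integral the gradient varies by at most a multiple of the elapsed time. *)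
Lemma frozen_chain_rule a b om : 0 <= a -> a <= b ->
  \int[lam]_(t in `[a, b]) fY a t om = psi (Y a b om) - psi (Y a a om).
Proof.
move=> a0 ab.
pose G t := psi (Y a t om) - \int[lam]_(s in `[a, t]) fY a s om.
have := @quadratic_increments_cst R G (C2 * C ^+ 2 + n%:R * (C * (C2 * C))) a b ab.
rewrite /G set_itv1 Rintegral_set1 subr0 => h; rewrite -h; first by ring.
move=> {h} s t as_ st tb.
have s0 := le_trans a0 as_; have t0 := le_trans s0 st.
rewrite (@Rint_split _ _ a s t)//; last exact: fY_integrable.
pose c i := grad i (Y a s om).
have Ic : \int[lam]_(r in `[s, t]) (\sum_i v r om ord0 i * c i) = \sum_i (Y a t om - Y a s om) ord0 i * c i.
  rewrite Rint_sum; [|exact: measurable_itv|exact: itv_fin|].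
    apply: eq_bigr => i _; rewrite RintegralZr//; last exact: (control_integrable fF pv vC' om i s0 t0).
    by congr (_ * _); rewrite rVB frozenB.
  move=> i; apply: bmM; last exact: bm_cst.
  exact: (jbm om s0 (lexx t) (control_jm fF pv i t0) (control_jb vC' (T:=t) i)).
have bc : bm `[s, t] (fun r => \sum_i v r om ord0 i * c i).
  apply: bm_sum => i; apply: bmM; last exact: bm_cst.
  exact: (jbm om s0 (lexx t) (control_jm fF pv i t0) (control_jb vC' (T:=t) i)).
have bY : bm `[s, t] (fY a ^~ om) by exact: (jbm om s0 (lexx t) (fY_jm a0 t0) (@fY_jb a t)).
have hI : `|\int[lam]_(r in `[s, t]) fY a r om - \sum_i (Y a t om - Y a s om) ord0 i * c i| <= n%:R * (C * (C2 * C)) * (t - s) ^+ 2.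
  rewrite -Ic expr2 mulrA -Rint_itv_cst//; apply: (Rint_itv_dist st bY bc (bm_cst _ _)) => r /andP[sr rt].
  rewrite /fY -sumrB; under eq_bigr do rewrite -mulrBr.
  have r0 := le_trans s0 sr.
  have -> : n%:R * (C * (C2 * C)) * (t - s) = n%:R * (C * (C2 * (C * (t - s)))) by ring.
  apply: control_sum_bound => // i; apply: le_trans (grad_lip _ _ _) _.
  rewrite ler_wpM2l//; apply: le_trans (frozen_lip om a0 as_ sr) _.
  by rewrite ler_wpM2l ?(C0 om)//; lra.
have hT := psi_taylor (Y a s om) (Y a t om - Y a s om).
rewrite [Y a s om + _]addrC subrK in hT.
have hL : C2 * `|Y a t om - Y a s om| ^+ 2 <= C2 * C ^+ 2 * (t - s) ^+ 2.
  rewrite -mulrA -exprMn ler_wpM2l// lerXn2r ?nnegrE//; last exact: frozen_lip.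
  by rewrite mulr_ge0 ?subr_ge0// (C0 om).
rewrite mulrDl.
have -> : psi (Y a t om) - (\int[lam]_(s in `[a, s]) fY a s om + \int[lam]_(s in `[s, t]) fY a s om) -
   (psi (Y a s om) - \int[lam]_(s in `[a, s]) fY a s om) =
   (psi (Y a t om) - psi (Y a s om) - \sum_i (Y a t om - Y a s om) ord0 i * c i) -
   (\int[lam]_(s in `[s, t]) fY a s om - \sum_i (Y a t om - Y a s om) ord0 i * c i) by ring.
apply: le_trans (ler_normB _ _) _; apply: lerD => //.
exact: le_trans hT hL.
Qed.


Let rk (K t : R) om := Num.max 0 (enorm (v t om) - K).

Lemma rk_jm K T : 0 <= T -> jm T (rk K).
Proof.
move=> T0; apply: (jm_rV (f := fun x => Num.max 0 (enorm x - K))).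
  by move=> i; exact: (progressive_jm fF i T0 pv).
apply: continuous_max_fun; first exact: cst_continuous.
by apply: continuousB_fun; [exact: enorm_continuous|exact: cst_continuous].
Qed.

Lemma rk_jb K T : 0 <= K -> jb T C (rk K).
Proof.
move=> K0 t om /andP[t0 _]; rewrite /rk ger0_norm ?le_max ?lexx//.
by rewrite ge_max (C0 om); have := vC om t0; lra.
Qed.

Lemma rk_bm K (a b : R) om : 0 <= K -> 0 <= a -> 0 <= b -> bm `[a, b] (rk K ^~ om).
Proof. by move=> K0 a0 b0; exact: (jbm om a0 (lexx b) (rk_jm K b0) (@rk_jb K b K0)). Qed.

Lemma fX_bm (a b : R) om : 0 <= a -> 0 <= b -> bm `[a, b] (fX ^~ om).
Proof. by move=> a0 b0; exact: (jbm om a0 (lexx b) (fX_jm b0) (@fX_jb b)). Qed.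

(** The bound [C] of the control must not appear. A velocity part of size [K] is multiplied by the
    Lipschitz variation of the gradient, proportional to the noise, while the excess over [K] meets
    only the bound [2 * C2] on that variation. *)
Lemma frozen_error K a r om : 0 <= K -> 0 <= a -> a <= r ->
  `|fX r om - fY a r om| <= n%:R * (K * C2 * sigma) * `|w r om - w a om| + 2 * n%:R * C2 * rk K r om.
Proof.
move=> K0 a0 ar; have r0 := le_trans a0 ar.
have XY : `|X r om - Y a r om| = sigma * `|w r om - w a om|.
  by rewrite /Y opprB addrC subrK normrZ gtr0_norm.
rewrite /fX /fY -sumrB; under eq_bigr do rewrite -mulrBr.
apply: le_trans (ler_norm_sum _ _ _) _.
have -> : n%:R * (K * C2 * sigma) * `|w r om - w a om| + 2 * n%:R * C2 * rk K r om =
  \sum_(i < n) (K * C2 * sigma * `|w r om - w a om| + 2 * C2 * rk K r om).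
  by rewrite sumr_const card_ord -[RHS]mulr_natl; ring.
apply: ler_sum => i _; rewrite normrM.
have h1 := grad_lip (X r om) (Y a r om) i; rewrite XY in h1.
have h2 := ler_normB (grad i (X r om)) (grad i (Y a r om)).
have h3 := grad_bound (X r om) i; have h4 := grad_bound (Y a r om) i.
have h5 := le_trans (coord_le_norm (v r om) i) (norm_le_enorm _).
have h6 : enorm (v r om) <= K + rk K r om by rewrite -lerBlDl /rk le_max lexx orbT.
have h7 : 0 <= rk K r om by rewrite /rk le_max lexx.
set m := `|_ - _| in h1 h2 *; have m0 : 0 <= m by exact: normr_ge0.
apply: (@le_trans _ _ ((K + rk K r om) * m)); first by rewrite ler_wpM2r//; exact: le_trans h5 h6.
rewrite mulrDl; apply: lerD.
  by have := ler_wpM2l K0 h1; lra.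
by rewrite mulrC ler_wpM2r//; lra.
Qed.

Lemma interval_error K a b om : 0 <= K -> 0 <= a -> a <= b ->
  `|\int[lam]_(r in `[a, b]) fX r om - (psi (X b om) - psi (X a om))| <=
  sigma * (C2 * (n%:R * K + 1)) * (`|w b om - w a om| + \int[lam]_(r in `[a, b]) `|w r om - w a om|) +
  2 * n%:R * C2 * \int[lam]_(r in `[a, b]) rk K r om.
Proof.
move=> K0 a0 ab; have b0 := le_trans a0 ab.
have mI : measurable (`[a, b]%classic : set R) by exact: measurable_itv.
have bX := fX_bm om a0 b0.
have bY : bm `[a, b] (fY a ^~ om) by exact: (jbm om a0 (lexx b) (fY_jm a0 b0) (@fY_jb a b)).
have bw' := increment_bm fF bw om a0 ab.
have br := rk_bm om K0 a0 b0.
have h := Rint_itv_dist ab bX bY (bmD (bmZ (n%:R * (K * C2 * sigma)) bw') (bmZ (2 * n%:R * C2) br)).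
have {h} h : `|\int[lam]_(r in `[a, b]) fX r om - \int[lam]_(r in `[a, b]) fY a r om| <=
    n%:R * (K * C2 * sigma) * \int[lam]_(r in `[a, b]) `|w r om - w a om| +
    2 * n%:R * C2 * \int[lam]_(r in `[a, b]) rk K r om.
  rewrite -!RintegralZl//; [|by apply: bm_integrable => //; exact: itv_fin|by apply: bm_integrable => //; exact: itv_fin].
  rewrite -RintegralD//; [|by apply: bm_integrable => //; [exact: itv_fin|exact: bmZ]|by apply: bm_integrable => //; [exact: itv_fin|exact: bmZ]].
  by apply: h => r /andP[ar rb]; exact: frozen_error.
rewrite frozen_chain_rule// in h.
have Ya : Y a a om = X a om by rewrite /Y subrr scaler0 subr0.
have Yb : `|psi (Y a b om) - psi (X b om)| <= C2 * (sigma * `|w b om - w a om|).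
  apply: le_trans (psi_lip _ _) _; rewrite ler_wpM2l//.
  by rewrite /Y addrAC subrr add0r normrN normrZ gtr0_norm.
rewrite Ya in h.
have I0 : 0 <= \int[lam]_(r in `[a, b]) `|w r om - w a om| by apply: Rintegral_ge0.
set I1 := \int[lam]_(r in `[a, b]) `|w r om - w a om| in h I0 *.
set I2 := \int[lam]_(r in `[a, b]) rk K r om in h *.
set D := `|w b om - w a om| in Yb *; have D0 : 0 <= D by exact: normr_ge0.
have -> : \int[lam]_(r in `[a, b]) fX r om - (psi (X b om) - psi (X a om)) =
  (\int[lam]_(r in `[a, b]) fX r om - (psi (Y a b om) - psi (X a om))) + (psi (Y a b om) - psi (X b om)) by ring.
apply: le_trans (ler_normD _ _) _; apply: le_trans (lerD h Yb) _.
have p1 : 0 <= sigma * C2 * I1 by rewrite !mulr_ge0// ltW.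
have p2 : 0 <= sigma * C2 * n%:R * K * D by rewrite !mulr_ge0// ltW.
lra.
Qed.

(** The values of [psi] telescope, so that only two end values survive, however long the path. *)
Lemma path_error K h N om : 0 <= K -> 0 < h ->
  `|\int[lam]_(r in `[0, N%:R * h]) fX r om - (psi (X (N%:R * h) om) - psi (X 0 om))| <=
  sigma * (C2 * (n%:R * K + 1)) * (\sum_(k < N) noise w h k om) +
  2 * n%:R * C2 * \int[lam]_(r in `[0, N%:R * h]) rk K r om.
Proof.
move=> K0 h0; elim: N => [|N IH].
  by rewrite mul0r set_itv1 !Rintegral_set1 big_ord0 !mulr0 subrr subr0 normr0 addr0.
have a0 : 0 <= N%:R * h by rewrite mulr_ge0// ltW.
have ab : N%:R * h <= N.+1%:R * h by rewrite ler_pM2r// ler_nat.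
have b0 := le_trans a0 ab.
have h2 := interval_error om K0 a0 ab.
rewrite (@Rint_split _ (fX ^~ om) 0 (N%:R * h))//; last exact: fX_integrable.
rewrite (@Rint_split _ (rk K ^~ om) 0 (N%:R * h))//; last first.
  by apply: bm_integrable; [exact: measurable_itv|exact: itv_fin|exact: rk_bm].
rewrite big_ord_recr/= {2}/noise.
set I1 := Rintegral _ _ _ in IH *; set I2 := \int[lam]_(r in `[N%:R * h, N.+1%:R * h]) fX r om in h2 *.
have -> : I1 + I2 - (psi (X (N.+1%:R * h) om) - psi (X 0 om)) =
  (I1 - (psi (X (N%:R * h) om) - psi (X 0 om))) + (I2 - (psi (X (N.+1%:R * h) om) - psi (X (N%:R * h) om))) by ring.
apply: le_trans (ler_normD _ _) _; apply: le_trans (lerD IH h2) _.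
lra.
Qed.

Lemma occupation_bound K T : 0 <= K -> 1 <= T ->
  `|\int[P]_om \int[lam]_(r in `[0, T]) fX r om| <=
   2 * C2 + sigma * (C2 * (n%:R * K + 1)) * (2 * T * (n%:R * 6)) +
   2 * n%:R * C2 * \int[P]_om \int[lam]_(r in `[0, T]) rk K r om.
Proof.
move=> K0 T1; have T0 : 0 <= T by lra.
(* Steps of length at most one that divide [T] exactly; since [T >= 1], there are at most [2 * T] of
   them. *)
pose N := (Num.truncn T).+1; pose h := T / N%:R.
have Th : N%:R * h = T by rewrite /h mulrC divfK// pnatr_eq0.
have /andP[t1 t2] := truncn_itv T0.
have h0 : 0 < h by rewrite /h divr_gt0//; lra.
have h1 : h <= 1 by rewrite /h ler_pdivrMr// mul1r ltW.
have NT : N%:R <= 2 * T by rewrite /N -natr1; lra.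
have bI : bm setT (fun om => \int[lam]_(r in `[0, T]) fX r om).
  exact: (jb_Rint_bm P (lexx 0) T0 (lexx T) (fX_jm T0) (@fX_jb T)).
have bR : bm setT (fun om => \int[lam]_(r in `[0, T]) rk K r om).
  exact: (jb_Rint_bm P (lexx 0) T0 (lexx T) (rk_jm K T0) (@rk_jb K T K0)).
(* The sign [e] reduces the absolute value of the expectation to two one-sided bounds, the form
   required by [expect_le_noise]. *)
have key (e : R) : `|e| = 1 -> e * \int[P]_om \int[lam]_(r in `[0, T]) fX r om <=
   2 * C2 + sigma * (C2 * (n%:R * K + 1)) * (2 * T * (n%:R * 6)) +
   2 * n%:R * C2 * \int[P]_om \int[lam]_(r in `[0, T]) rk K r om.
  move=> e1; have A0 : 0 <= sigma * (C2 * (n%:R * K + 1)) by rewrite !mulr_ge0 ?addr_ge0 ?mulr_ge0// ltW.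
  rewrite -lerBlDr -!RintegralZl//; [|exact: bm_integrableT|exact: bm_integrableT].
  rewrite -RintegralB//; [|exact/bm_integrableT/bmZ|exact/bm_integrableT/bmZ].
  apply: le_trans (expect_le_noise fF bw (bmB (bmZ e bI) (bmZ (2 * n%:R * C2) bR)) A0 h0 h1 (a := 2 * C2) (N := N) _) _.
    move=> om; have := path_error N om K0 h0; rewrite Th => p1.
    rewrite lerBlDr -addrA; have p2 := psi_bound (X T om); have p3 := psi_bound (X 0 om).
    set I1 := Rintegral _ _ _ in p1 *.
    have p4 : e * I1 <= `|I1| by rewrite (le_trans (ler_norm _))// normrM e1 mul1r.
    have p5 : `|I1| <= `|I1 - (psi (X T om) - psi (X 0 om))| + `|psi (X T om) - psi (X 0 om)|.
      by rewrite -[X in `|X| <= _](subrK (psi (X T om) - psi (X 0 om))) ler_normD.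
    have p6 := ler_normB (psi (X T om)) (psi (X 0 om)).
    lra.
  rewrite lerD2l ler_wpM2l// ler_wpM2r//.
rewrite ler_norml lerNl -mulN1r !(key _)//; rewrite ?normrN ?normr1//.
by rewrite -[X in X <= _]mul1r key// normr1.
Qed.

End path.
End holonomy.

Section closed_measures.
Context (R : realType) (n : nat) (d : measure_display) (W : measurableType d)
  (P : probability W R) (F : R -> set (set W)) (w : R -> W -> 'rV[R]_n)
  (L : phase R n -> R) (g : R -> R).
Hypotheses (fF : filtration F) (bw : brownian P F w) (wL : weight_for L g).
Local Notation lam := (@lebesgue_measure R).
Local Notation "'E i" := (delta_mx ord0 i : 'rV[R]_n) (at level 10).
Local Notation pair f mu := (fine (charge_integral (smeasure_of mu) f)).

Definition hol (phi : torus R n -> R) (p : phase R n) : R :=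
  \sum_(i < n) p.2 ord0 i * 'D_('E i) (phi \o @to_torus R n) (repr p.1).

Definition excess (K : R) (p : phase R n) : R := Num.max 0 (enorm p.2 - K).

Lemma excess_C0w K : 0 <= K -> C0w g (excess K).
Proof.
move=> K0; apply: (C0w_linear wL (B := 1)).
  apply: continuous_max_fun; first exact: cst_continuous_phase.
  by apply: continuousB_fun; [exact: enorm_phase_continuous|exact: cst_continuous_phase].
move=> p; have e0 := enorm_ge0 p.2; rewrite mul1r /excess ger0_norm ?le_max ?lexx//.
by rewrite ge_max; apply/andP; split; lra.
Qed.

Lemma hol_continuous phi : smooth (phi \o @to_torus R n) -> continuous (hol phi).
Proof.
move=> sphi; apply: sum_continuous => i; apply: continuousM_fun.
  exact: (snd_phase_continuous (h := fun x => x ord0 i) (@rV_coord_continuous R n i)).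
apply: (per_continuous (f := fun x => 'D_('E i) (phi \o @to_torus R n) x)).
  by apply: per_derive; exact: per_torus.
exact: (sphi [:: 'E i]).1.
Qed.

Lemma hol_C0w phi : smooth (phi \o @to_torus R n) -> C0w g (hol phi).
Proof.
move=> sphi; have [C C0 [_ gC _ _ _]] := smooth_estimates (@per_torus R n phi) sphi.
apply: (C0w_linear wL (B := n%:R * C)); first exact: hol_continuous.
move=> p; apply: le_trans (ler_norm_sum _ _ _) _.
have -> : n%:R * C * (1 + enorm p.2) = \sum_(i < n) C * (1 + enorm p.2).
  by rewrite sumr_const card_ord -[RHS]mulr_natl mulrA.
apply: ler_sum => i _; rewrite normrM mulrC; apply: ler_pM => //.
have := le_trans (coord_le_norm p.2 i) (norm_le_enorm _); lra.
Qed.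

Lemma occupation_pairing (sigma : R) x0 v T (m : wmeasure n g) f C : 0 < T -> progressive F v ->
  (forall t om, 0 <= t -> `|v t om| <= C) -> occupation P w sigma x0 v T m -> C0w g f ->
  pair f m = T^-1 * \int[P]_om \int[lam]_(t in `[0, T]) f (lift (diffusion w sigma x0 v t om, v t om)).
Proof.
move=> T0 pv vC occ Cf; have cf : continuous f by case: Cf.
rewrite (occ _ Cf) unlock EFin_Rint//; apply: bm_integrableT.
have vC' t om : 0 <= t <= T -> `|v t om| <= C by move=> /andP[t0 _]; exact: vC.
apply: (Rint_lift_bm P T0 _ _ vC') => // i; first exact: (diffusion_jm fF bw _ _ pv vC).
exact: (progressive_jm fF i (ltW T0) pv).
Qed.

Lemma hol_lift phi x v : hol phi (lift (x, v)) = \sum_i v ord0 i * 'D_('E i) (phi \o @to_torus R n) x.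
Proof.
apply: eq_bigr => i _; congr (_ * _).
by apply: (per_repr (f := fun x => 'D_('E i) (phi \o @to_torus R n) x)); apply: per_derive; exact: per_torus.
Qed.

(** [C] and [D] depend on [phi] alone, so that [K] can be chosen first, by superlinearity, and
    [sigma] sent to zero afterwards. *)
Theorem M0_holonomy phi : smooth (phi \o @to_torus R n) -> exists C D : R, [/\ 0 <= C, 0 <= D &
  forall K sigma (mu : wmeasure n g), 0 <= K -> 0 < sigma -> M0 P F w sigma mu ->
    `|pair (hol phi) mu| <= C * (sigma * (K + 1)) + D * pair (excess K) mu].
Proof.
move=> sphi; have [C2 C20 [pb gb pl gl pt]] := smooth_estimates (@per_torus R n phi) sphi.
have gc i : continuous (fun x => 'D_('E i) (phi \o @to_torus R n) x) by exact: (sphi [:: 'E i]).1.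
have N0 : 0 <= n%:R :> R by [].
exists (C2 * (n%:R + 1) * (12 * n%:R)), (2 * n%:R * C2).
split; [by rewrite !(addr_ge0, mulr_ge0)|by rewrite !mulr_ge0|].
move=> K sigma mu K0 s0 Mmu.
pose A := sigma * (C2 * (n%:R * K + 1)) * (12 * n%:R).
have cI := pairing_continuous (hol_C0w sphi).
have cK := pairing_continuous (excess_C0w K0).
(* [H] is weak-* continuous, so [H <= A] is a closed condition: once checked on [limit_measures], it
   holds on the closure. *)
pose H (nu : wmeasure n g) := `|pair (hol phi) nu| - 2 * n%:R * C2 * pair (excess K) nu.
have cH : continuous H.
  apply: continuousB_fun; first exact: continuous_norm_fun.
  by apply: continuousM_fun => //; exact: cst_continuous.
have HA : limit_measures P F w sigma `<=` [set nu : wmeasure n g | H nu <= A].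
  move=> nu [x0 [v [T [m [[pv [C vC]] [T0 Too] occ mnu]]]]] /=.
  have vC' t om : 0 <= t -> `|v t om| <= C by move=> t0; exact: le_trans (norm_le_enorm _) (vC t om t0).
  have Hm : H (m k) @[k --> \oo] --> H nu by exact: (@cvg_comp _ _ _ m H _ _ _ mnu (cH nu)).
  apply/ler_addgt0Pr => e e0.
  apply: (seq_lim_le_near Hm).
  have hoo M : \forall k \near \oo, M <= T k by have /cvgryPge := Too; apply.
  near=> k; have T1 : 1 <= T k by near: k; exact: hoo.
  have Te : 2 * C2 / e <= T k by near: k; exact: hoo.
  have := @occupation_bound _ _ _ _ _ _ _ fF bw _ _ C20 pb gb pl gl gc pt v sigma x0 C pv vC s0 K (T k) K0 T1.
  have e1 : \int[P]_om \int[lam]_(t in `[0, T k]) hol phi (lift (diffusion w sigma x0 v t om, v t om)) =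
    \int[P]_om \int[lam]_(t in `[0, T k]) (\sum_i v t om ord0 i * 'D_('E i) (phi \o @to_torus R n) (diffusion w sigma x0 v t om)).
    by apply: eq_Rintegral => om _; apply: eq_Rintegral => t _; rewrite hol_lift.
  rewrite -e1; have p1 := occupation_pairing (T0 k) pv vC' (occ k) (hol_C0w sphi).
  have p2 := occupation_pairing (T0 k) pv vC' (occ k) (excess_C0w K0).
  by rewrite /H; exact: time_average_bound (T0 k) e0 Te p1 p2.
have := @preimage_closed _ _ H [set y : R | y <= A] (fun nu _ => cH nu) (@closed_le _ A) mu (closure_subset HA Mmu).
rewrite /= /H lerBlDr => h; apply: le_trans h _.
rewrite lerD2r /A.
have -> : C2 * (n%:R + 1) * (12 * n%:R) * (sigma * (K + 1)) = sigma * (C2 * ((n%:R + 1) * (K + 1))) * (12 * n%:R) by ring.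
rewrite ler_wpM2r ?mulr_ge0// ler_pM2l// ler_wpM2l//; lra.
Unshelve. all: by end_near.
Qed.

End closed_measures.

(** * The discrete Hamilton-Jacobi equation *)

Lemma introw_ext n (x y : 'rV[int]_n) : (forall i, x ord0 i = y ord0 i) -> x = y.
Proof. by move=> xy; apply/rowP => i; exact: xy. Qed.

Lemma introwD n (x y : 'rV[int]_n) i : (x + y) ord0 i = (x ord0 i + y ord0 i)%R :> int.
Proof. by rewrite mxE. Qed.

Lemma introwB n (x y : 'rV[int]_n) i : (x - y) ord0 i = (x ord0 i - y ord0 i)%R :> int.
Proof. by rewrite !mxE. Qed.

Lemma introwMn n (x : 'rV[int]_n) k i : (x *+ k) ord0 i = (x ord0 i * k%:Z)%R :> int.
Proof. by rewrite mulmxnE -mulr_natr natz. Qed.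

Section bellman.
Context (R : realType) (n : nat) (L : phase R n -> R).
Variables (p q M : nat) (al : R).
Hypotheses (p0 : (0 < p)%N) (q0 : (0 < q)%N) (M0 : (0 < M)%N).
Hypotheses (al0 : 0 < al) (al1 : al <= p%:R).
Local Notation m := (p * q)%N.
Local Notation Z := 'rV[int]_n.
Implicit Types (x y z : Z) (f : Z -> R).

Let h : R := p%:R^-1.
Let b : R := 1 - al * h.

Definition mesh x : 'rV[R]_n := m%:R^-1 *: intv R x.
Definition vel z : 'rV[R]_n := q%:R^-1 *: intv R z.

(** The admissible steps are indexed by a finite type, so that a minimising step exists; the shift
    centres the indices at zero. *)
Definition step_of (j : {ffun 'I_n -> 'I_(2 * (M * q)).+1}) : Z := \row_i ((j i)%:Z - (M * q)%:Z).

Lemma step_ofP z : (forall i, (`|z ord0 i| <= M * q)%N) -> exists j, step_of j = z.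
Proof.
move=> zM; exists [ffun i => inord `|(z ord0 i + (M * q)%:Z)%R|%N].
apply: introw_ext => i; rewrite !mxE ffunE inordK; last by have := zM i; lia.
by have := zM i; lia.
Qed.

Lemma step_of_le j i : (`|step_of j ord0 i| <= M * q)%N.
Proof. by rewrite mxE; have := ltn_ord (j i); lia. Qed.

(* Value iteration with time step 1 / p and discount rate [al]; velocities are multiples of 1 / q, so
   that a step moves by a vector of the lattice of mesh 1 / (p * q). *)
Definition bell_cost f x z : R := h * L (lift (mesh x, vel z)) + b * f (x + z).

Definition bell_arg f x := [arg min_(j < [ffun=> ord0]) bell_cost f x (step_of j)]%O.

Definition bell f x : R := bell_cost f x (step_of (bell_arg f x)).

Lemma bell_le f x z : (forall i, (`|z ord0 i| <= M * q)%N) -> bell f x <= bell_cost f x z.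
Proof.
move=> /step_ofP[j <-]; rewrite /bell /bell_arg.
by case: arg_minP => // j' _; apply.
Qed.

Let h0 : 0 < h. Proof. by rewrite invr_gt0 ltr0n. Qed.
Let ph : p%:R * h = 1. Proof. by rewrite mulfV// pnatr_eq0 -lt0n. Qed.
Let b0 : 0 <= b.
Proof. by rewrite subr_ge0 /h ler_pdivrMr ?mul1r// ltr0n. Qed.
Let b1 : b <= 1. Proof. by rewrite gerBl mulr_ge0// ltW. Qed.

Lemma bell_homo f g : (forall x, f x <= g x) -> forall x, bell f x <= bell g x.
Proof.
move=> fg x; apply: le_trans (bell_le _ _ (step_of_le (bell_arg g x))) _.
by rewrite /bell /bell_cost lerD2l ler_wpM2l.
Qed.

Lemma bellD f c x : bell (fun y => f y + c) x <= bell f x + b * c.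
Proof.
apply: le_trans (bell_le _ _ (step_of_le (bell_arg f x))) _.
by rewrite /bell /bell_cost; lra.
Qed.

Lemma meshD x y : mesh (x + y) = mesh x + mesh y.
Proof. by rewrite /mesh -scalerDr; congr (_ *: _); apply/rowP => i; rewrite !mxE rmorphD. Qed.

Lemma mesh_per x z v : lift (mesh (x + z *+ m), v) = lift (mesh x, v).
Proof.
rewrite meshD [mesh (z *+ m)](_ : _ = intv R z) ?liftD//.
apply/rowP => i; rewrite /mesh !mxE mulmxnE rmorphMn/= -[X in _ * X]mulr_natl mulKf//.
by rewrite pnatr_eq0 muln_eq0 negb_or -!lt0n p0.
Qed.

Definition mper f := forall x z, f (x + z *+ m) = f x.

Lemma bell_per f : mper f -> mper (bell f).
Proof.
move=> pf x z.
have e y : bell_cost f (x + z *+ m) y = bell_cost f x y.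
  by rewrite /bell_cost mesh_per addrAC pf.
apply/le_anti/andP; split.
  by apply: le_trans (bell_le _ _ (step_of_le (bell_arg f x))) _; rewrite e.
by apply: le_trans (bell_le _ _ (step_of_le (bell_arg f (x + z *+ m)))) _; rewrite -e.
Qed.

Variable (A : R).
Hypotheses (L0 : forall P, 0 <= L P)
  (LA : forall x v : 'rV[R]_n, `|v| <= 1 -> L (lift (x, v)) <= A).

Let A0 : 0 <= A.
Proof. by apply: le_trans (L0 (lift (0, 0))) (LA _ _); rewrite normr0. Qed.

Definition bell_iter N : Z -> R := iter N bell (fun=> 0).
Local Notation u := bell_iter.

Lemma bell_iter_ge0 N x : 0 <= u N x.
Proof. by elim: N x => //= N IH x; rewrite /bell /bell_cost addr_ge0// mulr_ge0// ltW. Qed.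

Lemma bell_iter_homo N x : u N x <= u N.+1 x.
Proof.
elim: N x => [|N IH] x; first exact: bell_iter_ge0.
by rewrite /u ![in leRHS]/= ; apply: bell_homo.
Qed.

Lemma bell_iter_per N : mper (u N).
Proof. by elim: N => [|N IH] //=; exact: bell_per. Qed.

Lemma unit_step f x z : (forall i, (`|z ord0 i| <= q)%N) -> bell f x <= h * A + b * f (x + z).
Proof.
move=> zq; apply: le_trans (bell_le _ _ (z := z) _) _.
  by move=> i; apply: leq_trans (zq i) _; rewrite leq_pmull.
rewrite lerD2r ler_pM2l//; apply: LA; apply: norm_rV_le => // i.
rewrite /vel /intv !mxE normrM normfV normr_nat -intr_norm mulrC ler_pdivrMr ?ltr0n// mul1r.
by rewrite -[q%:R]/(q%:~R) ler_int -abszE lez_nat.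
Qed.

Lemma bell_iter_bound N x : u N x <= A / al.
Proof.
elim: N x => [|N IH] x; first by rewrite divr_ge0// ltW.
apply: le_trans (unit_step _ _ (z := 0) _) _; first by move=> i; rewrite mxE.
rewrite addr0; apply: le_trans (lerD (lexx _) (ler_wpM2l b0 (IH x))) _.
rewrite le_eqVlt; apply/orP; left; apply/eqP; rewrite /b; field; exact: lt0r_neq0.
Qed.

Lemma bell_iter_step N x : u N.+1 x <= u N x + b ^+ N * (h * A).
Proof.
elim: N x => [|N IH] x.
  apply: le_trans (unit_step _ _ (z := 0) _) _; first by move=> i; rewrite mxE.
  by rewrite mulr0 addr0 expr0 mul1r add0r.
apply: le_trans (bell_homo IH x) _.
by apply: le_trans (bellD _ _ _) _; rewrite exprS mulrA.
Qed.

(** A displacement of [s * q] lattice units is covered in [s] steps of speed at most one, each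
    costing at most [h * A]. As the iterates increase with [N] and are nonnegative, neither the
    extra iterations nor the discount spoil the bound, which does not involve [al]. *)
Lemma bell_iter_lip N s x z : (forall i, (`|z ord0 i| <= s * q)%N) ->
  u N x <= s%:R * (h * A) + u N (x + z).
Proof.
elim: s x z => [|s IH] x z zs.
  have -> : z = 0 by apply/rowP => i; have := zs i; rewrite mxE mul0n leqn0 absz_eq0 => /eqP.
  by rewrite addr0 mul0r add0r.
(* The first step is [z] clipped coordinatewise to [[-q, q]]; what remains is covered in one step
   less. *)
pose z1 : Z := \row_i (if (z ord0 i <= - q%:Z)%R then - q%:Z else if (q%:Z <= z ord0 i)%R then q%:Z else z ord0 i).
have z1q i : (`|z1 ord0 i| <= q)%N.
  by rewrite mxE; case: ifP => ?; [lia|case: ifP => ?; lia].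
have := unit_step (u N) x z1q; rewrite -[bell (u N) x]/(u N.+1 x) => h1.
have h2 := bell_iter_homo N x.
have h3 : u N (x + z1) <= s%:R * (h * A) + u N (x + z1 + (z - z1)).
  apply: IH => i; rewrite introwB mxE; have := zs i; rewrite mulSn; move: (s * q)%N => sq.
    by case: ifP => ?; [lia|case: ifP => ?; lia].
rewrite -addrA [z1 + _]addrC subrK in h3.
have h4 : b * u N (x + z1) <= u N (x + z1) by rewrite ler_piMl// bell_iter_ge0.
by rewrite -natr1; lra.
Qed.

(** The same steps are used from both points. The costs then differ by [h * eta] per step, and the
    discounted sum of these differences is at most [eta / al]. *)
Lemma bell_iter_modulus N (eta : R) (e : Z) : 0 <= eta ->
  (forall x z, (forall i, (`|z ord0 i| <= M * q)%N) ->
    L (lift (mesh (x + e), vel z)) <= L (lift (mesh x, vel z)) + eta) ->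
  forall x, u N (x + e) <= u N x + eta / al.
Proof.
move=> eta0 He; elim: N => [|N IH] x; first by rewrite /= add0r divr_ge0// ltW.
have zM := step_of_le (bell_arg (u N) x).
change (bell (u N) (x + e) <= bell (u N) x + eta / al).
apply: le_trans (bell_le _ _ zM) _; rewrite /bell /bell_cost.
set z := step_of _ in zM *.
rewrite addrAC.
have h1 := ler_wpM2l (ltW h0) (He x z zM); have h2 := ler_wpM2l b0 (IH (x + z)).
have h3 : h * eta + b * (eta / al) = eta / al by rewrite /b; field; exact: lt0r_neq0.
move: h1 h2 h3; lra.
Qed.

(** In [p] steps of unit speed, that is in unit time, any point of the torus can be reached, at cost
    [p * h * A = A]. *)
Lemma bell_iter_osc N x y : u N x <= A + u N y.
Proof.
pose k : Z := \row_i ((x ord0 i - y ord0 i) %/ m%:Z)%Z.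
pose z : Z := \row_i (- ((x ord0 i - y ord0 i) %% m%:Z)%Z).
have m0 : (0 < m)%N by rewrite muln_gt0 p0.
have e : x + z = y + k *+ m.
  apply: introw_ext => i; rewrite !introwD introwMn !mxE.
  have := divz_eq (x ord0 i - y ord0 i) m%:Z; lia.
have := @bell_iter_lip N p x z; rewrite e bell_iter_per mulrA ph mul1r; apply.
move=> i; rewrite mxE; have := ltz_pmod (x ord0 i - y ord0 i) (d := m%:Z); have := modz_ge0 (x ord0 i - y ord0 i) (d := m%:Z).
lia.
Qed.

(* A discrete corrector: lam approximates the minimal average cost. *)
Theorem discrete_corrector (eps : R) : 0 < eps -> al * A <= eps ->
  exists (u : Z -> R) (lam : R) (V : Z -> Z),
  [/\ [/\ mper u, (forall x, 0 <= u x <= A / al) & al * u 0 = lam],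
    (forall s x z, (forall i, (`|z ord0 i| <= s * q)%N) -> u x <= s%:R * (h * A) + u (x + z)),
    (forall x y, u x <= A + u y),
    (forall eta e, 0 <= eta -> (forall x z, (forall i, (`|z ord0 i| <= M * q)%N) ->
        L (lift (mesh (x + e), vel z)) <= L (lift (mesh x, vel z)) + eta) ->
      forall x, u (x + e) <= u x + eta / al) &
    [/\ (forall x z, (forall i, (`|z ord0 i| <= M * q)%N) ->
      h * (lam - eps) <= h * L (lift (mesh x, vel z)) + u (x + z) - u x),
     (forall x i, (`|V x ord0 i| <= M * q)%N) &
     (forall x, h * L (lift (mesh x, vel (V x))) + u (x + V x) - u x <= h * (lam + 2 * eps))]].
Proof.
move=> eps0 alA.
have b_lt1 : b < 1 by rewrite gtrBl mulr_gt0.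
(* The iteration is stopped when one more round changes the value by at most [h * eps]; no fixed
   point is needed. *)
have [N HN] : exists N, b ^+ N * A <= eps.
  have e1 : 0 < eps / (A + 1) by rewrite divr_gt0// ltr_wpDl.
  have bc : b ^+ k @[k --> \oo] --> (0 : R) by apply: cvg_expr; rewrite ger0_norm.
  have [N HN] := (seq_cvgP _ _).1 bc _ e1.
  exists N; have := HN N (leqnn _); rewrite subr0 ger0_norm ?exprn_ge0//.
  rewrite ler_pdivlMr ?ltr_wpDl//.
  have : 0 <= b ^+ N by rewrite exprn_ge0.
  lra.
exists (u N), (al * u N 0), (fun x => step_of (bell_arg (u N) x)); split.
- by split=> [|x|//]; [exact: bell_iter_per|rewrite bell_iter_ge0 bell_iter_bound].
- exact: bell_iter_lip.
- exact: bell_iter_osc.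
- exact: bell_iter_modulus.
(* The discount term of the Bellman equation is [h * al * u]; small oscillation replaces it by
   [h * lam] up to [h * eps]. Together with the stopping error this gives the [2 * eps] of the upper
   inequality. *)
have osc x : al * u N 0 - eps <= al * u N x /\ al * u N x <= al * u N 0 + eps.
  have h1 := ler_wpM2l (ltW al0) (bell_iter_osc N 0 x); have h2 := ler_wpM2l (ltW al0) (bell_iter_osc N x 0).
  by rewrite !mulrDr in h1 h2; split; lra.
split=> [x z zM|x i|x]; last 2 first.
- exact: step_of_le.
- have h1 := bell_iter_step N x.
  rewrite -[u N.+1 x]/(bell (u N) x) /bell /bell_cost in h1.
  set z := step_of _ in h1 *.
  have [_ h2] := osc (x + z).
  have h3 := ler_wpM2l (ltW h0) h2; have h4 := ler_wpM2l (ltW h0) HN.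
  by rewrite /b in h1; lra.
- have h1 := bell_le (u N) x zM; have h2 := bell_iter_homo N x.
  rewrite -[bell (u N) x]/(u N.+1 x) /bell_cost /b in h1.
  have [h3 _] := osc (x + z); have h4 := ler_wpM2l (ltW h0) h3.
  by lra.
Qed.

End bellman.

(** * Smoothing the discrete corrector *)

Section fejer.
Context (R : realType).
Implicit Types (s : R) (r t : nat).

(** The product equals [(sin (2^r pi s) / (2^r sin (pi s)))^2]: the Fejer kernel of order [2^r],
    divided by [2^r]. The product form reduces each property to a duplication formula. *)
Fixpoint fejer r s : R := if r is r'.+1 then cos (pi * s) ^+ 2 * fejer r' (2 * s) else 1.

Lemma fejer_ge0 r s : 0 <= fejer r s.
Proof. by elim: r s => //= r IH s; rewrite mulr_ge0// sqr_ge0. Qed.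

Lemma cospiD1 s : cos (pi * (s + 1)) ^+ 2 = cos (pi * s) ^+ 2.
Proof. by rewrite mulrDr mulr1 cosDpi sqrrN. Qed.

Lemma fejer_per1 r s : fejer r (s + 1) = fejer r s.
Proof.
elim: r s => //= r IH s; rewrite cospiD1; congr (_ * _).
have -> : 2 * (s + 1) = 2 * s + 1 + 1 by ring.
by rewrite !IH.
Qed.

Lemma fejer_per r s (z : int) : fejer r (s + z%:~R) = fejer r s.
Proof.
have pn (k : nat) s' : fejer r (s' + k%:R) = fejer r s'.
  by elim: k s' => [|k IH] s'; rewrite ?addr0// -natr1 addrA fejer_per1 IH.
case: z => k; first by rewrite pn.
by rewrite NegzE -[in RHS](subrK k.+1%:R s) pn mulrNz.
Qed.

(* The values at s and s - 1/2 of the first factor add up to 1. *)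
Lemma fejer_sum r t s : (0 < t)%N ->
  \sum_(j < 2 ^ r * t) fejer r (s - j%:R / (2 ^ r * t)%:R) = t%:R.
Proof.
move=> t0; elim: r s => [|r IH] s.
  by rewrite expn0 mul1n sumr_const card_ord.
have e : (2 ^ r.+1 * t = 2 ^ r * t + 2 ^ r * t)%N by rewrite expnS; lia.
rewrite e; set m := (2 ^ r * t)%N in IH *.
have m0 : m%:R != 0 :> R by rewrite pnatr_eq0 -lt0n muln_gt0 expn_gt0.
rewrite big_split_ord/= -big_split/= -(IH (2 * s)).
apply: eq_bigr => j _; rewrite addnC.
have emm : (m + m)%:R = 2 * m%:R :> R by rewrite natrD; ring.
rewrite emm; have e1 : 2 * (s - j%:R / (2 * m%:R)) = 2 * s - j%:R / m%:R by field.
have e2 : 2 * (s - (j + m)%:R / (2 * m%:R)) + 1 = 2 * s - j%:R / m%:R by rewrite natrD; field.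
rewrite -(fejer_per1 r (2 * (s - (j + m)%:R / _))) e1 e2 -mulrDl.
have -> : pi * (s - (j + m)%:R / (2 * m%:R)) = pi * (s - j%:R / (2 * m%:R)) - pi / 2.
  by rewrite natrD; field.
by rewrite cosBpihalf cos2Dsin2 mul1r.
Qed.

(** The left side is in fact [4^-1 ^+ r * sin (2^r pi s)^2], by repeated use of the formula for the
    sine of a double angle. *)
Lemma fejer_sin r s : fejer r s * sin (pi * s) ^+ 2 <= 4^-1 ^+ r.
Proof.
elim: r s => [|r IH] s /=.
  by rewrite mul1r expr0 -subr_ge0 -cos2sin2 sqr_ge0.
have -> : cos (pi * s) ^+ 2 * fejer r (2 * s) * sin (pi * s) ^+ 2 =
    4^-1 * (fejer r (2 * s) * sin (pi * (2 * s)) ^+ 2).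
  have -> : pi * (2 * s) = (pi * s) *+ 2 by ring.
  by rewrite sin_mulr2n; field.
by rewrite [X in _ <= X]exprS; apply: ler_wpM2l; [rewrite invr_ge0|exact: IH].
Qed.

Lemma fejer_trig n r (c : R) (i : 'I_n) : trig (fun x : 'rV[R]_n => fejer r (c * x ord0 i)).
Proof.
elim: r c => [|r IH] c /=; first exact: trig_cst.
have tc : trig (fun x : 'rV[R]_n => cos (pi * (c * x ord0 i))).
  have := trig_cos ((pi * c) *: delta_mx ord0 i : 'rV[R]_n) 0.
  rewrite (_ : (fun x => _) = (fun x : 'rV[R]_n => cos (pi * (c * x ord0 i))))//.
  apply/funext => x; congr cos; rewrite (bigD1 i)//= big1 ?addr0.
    by rewrite !mxE !eqxx/=; ring.
  by move=> j /negbTE ji; rewrite !mxE eqxx ji/= !mulr0.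
rewrite (_ : (fun x => _) = (fun x : 'rV[R]_n => cos (pi * (c * x ord0 i)) * cos (pi * (c * x ord0 i)) * fejer r (2 * c * x ord0 i))).
  by apply: trigM => //; exact: trigM.
by apply/funext => x; rewrite expr2 -[2 * c * _]mulrA.
Qed.

Lemma sinpi_small (del : R) : 0 < del -> exists2 kap : R, 0 < kap &
  forall s, sin (pi * s) ^+ 2 < kap -> exists z : int, `|s - z%:~R| < del.
Proof.
move=> del0; pose e := Num.min del 2^-1.
have e0 : 0 < e by rewrite lt_min del0/= invr_gt0.
have e2 : e <= 2^-1 by rewrite ge_min lexx orbT.
have pi0 := @pi_gt0 R.
have se : 0 < sin (pi * e).
  by apply: sin_gt0_pi; rewrite mulr_gt0//=; nra.
exists (sin (pi * e) ^+ 2); first by rewrite exprn_gt0.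
move=> s ss; pose z := Num.floor (s + 2^-1); exists z.
have /andP[z1 z2] := floor_itv (s + 2^-1).
rewrite -/z intrD in z1 z2 *.
set y := s - z%:~R; have y1 : `|y| <= 2^-1 by rewrite ler_norml /y; move: z2; rewrite mulr1z; lra.
rewrite ltNge; apply/negP => dy.
have ey : e <= `|y| by rewrite ge_min dy.
have sy : sin (pi * s) ^+ 2 = sin (pi * `|y|) ^+ 2.
  have h (k : nat) a : sin (pi * (a + k%:R)) ^+ 2 = sin (pi * a) ^+ 2.
    by elim: k a => [|k IH] a; rewrite ?addr0// -natr1 addrA mulrDr mulr1 sinDpi sqrrN IH.
  have h2 (k : int) a : sin (pi * (a + k%:~R)) ^+ 2 = sin (pi * a) ^+ 2.
    case: k => k; first by rewrite h.
    by rewrite NegzE -[in RHS](subrK k.+1%:R a) h mulrNz.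
  rewrite -[s](subrK z%:~R) h2 -/y; case: (leP 0 y) => y0; first by rewrite ger0_norm.
  by rewrite ltr0_norm// mulrN sinN sqrrN.
move: ss; rewrite sy ltNge => /negP; apply.
have c1 : pi * `|y| <= pi / 2 by rewrite ler_pM2l.
have c2 : 0 <= pi * `|y| by rewrite mulr_ge0// ltW.
have c3 : 0 <= pi * e by rewrite mulr_ge0// ltW.
have c4 : pi * e <= pi * `|y| by rewrite ler_pM2l.
rewrite !sin2cos2 lerD2l lerN2 lerXn2r ?nnegrE//; last first.
- move: c4; rewrite !le_eqVlt => /orP[/eqP ->|c4]; first by rewrite eqxx.
  by rewrite ltr_cos ?c4 ?orbT// in_itv/=; apply/andP; split => //; move: c4; lra.
- by apply: cos_ge0_pihalf; apply/andP; split; lra.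
- by apply: cos_ge0_pihalf; apply/andP; split; lra.
Qed.

End fejer.

Section torus_modulus.
Context (R : realType) (n : nat).

(** Proximity on the torus is measured by squared sines because these are what the kernel averages
    to a small number. Away from the diagonal one of them is at least [kap], and the second term
    absorbs the crude bound on [L]. *)
Lemma torus_modulus (L : phase R n -> R) (M eps : R) : continuous L -> 0 < eps ->
  exists2 C, 0 <= C & forall x y v : 'rV[R]_n, `|v| <= M ->
    `|L (lift (x, v)) - L (lift (y, v))| <= eps + C * \sum_i sin (pi * (x ord0 i - y ord0 i)) ^+ 2.
Proof.
move=> cL eps0; have [del del0 Hd] := phase_uniform M cL eps0.
have [B HB] := phase_bounded M cL; have [kap kap0 Hk] := sinpi_small del0.
exists (2 * `|B| / kap); first by rewrite divr_ge0// ?ltW// mulr_ge0.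
move=> x y v vM.
have C0 : 0 <= 2 * `|B| / kap by rewrite divr_ge0// ?ltW// mulr_ge0.
case: (boolP [forall i, sin (pi * (x ord0 i - y ord0 i)) ^+ 2 < kap]) => [/forallP h|].
  have /choice[z Hz] i := Hk _ (h i).
  rewrite -(liftD y v (\row_i z i)).
  apply: (@le_trans _ _ eps); last by rewrite lerDl mulr_ge0// sumr_ge0// => i _; rewrite sqr_ge0.
  apply: ltW; apply: Hd => //; last by rewrite subrr normr0.
  apply: norm_rV_lt => // i; have := Hz i; rewrite /intv !mxE.
  by rewrite (_ : x ord0 i - y ord0 i - (z i)%:~R = x ord0 i - (y ord0 i + (z i)%:~R)) ?(ord1 ord0)//; ring.
rewrite negb_forall => /existsP[i]; rewrite -leNgt => hi.
apply: le_trans (ler_normB _ _) _.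
have h1 := le_trans (HB x v vM) (ler_norm B); have h2 := le_trans (HB y v vM) (ler_norm B).
have h3 : kap <= \sum_i sin (pi * (x ord0 i - y ord0 i)) ^+ 2.
  by apply: le_trans hi _; rewrite (bigD1 i)//= lerDl sumr_ge0// => k _; rewrite sqr_ge0.
have h4 := ler_wpM2l C0 h3; rewrite divfK ?gt_eqF// in h4.
lra.
Qed.

End torus_modulus.

Section kernel.
Context (R : realType) (n r t : nat).
Hypothesis t0 : (0 < t)%N.
Local Notation m := (2 ^ r * t)%N.
Local Notation Z := 'rV[int]_n.
Local Notation J := {ffun 'I_n -> 'I_m}.

Definition grid (k : nat) (z : Z) : 'rV[R]_n := k%:R^-1 *: intv R z.

Lemma gridD k x y : grid k (x + y) = grid k x + grid k y.
Proof. by rewrite /grid -scalerDr; congr (_ *: _); apply/rowP => i; rewrite !mxE rmorphD. Qed.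

Lemma grid_per k x z : (0 < k)%N -> grid k (x + z *+ k) = grid k x + intv R z.
Proof.
move=> k0; rewrite gridD; congr (_ + _).
apply/rowP => i; rewrite /grid !mxE mulmxnE rmorphMn/= -[X in _ * X]mulr_natl mulKf//.
by rewrite pnatr_eq0 -lt0n.
Qed.

Definition node (j : J) : Z := \row_i (j i)%:Z.

Definition kern (x : 'rV[R]_n) : R := \prod_i fejer r (x ord0 i).

Lemma kern_ge0 x : 0 <= kern x.
Proof. by apply: prodr_ge0 => i _; exact: fejer_ge0. Qed.

Lemma kern_per : per kern.
Proof.
move=> x z; apply: eq_bigr => i _.
by rewrite (_ : (x + intv R z) ord0 i = x ord0 i + (z ord0 i)%:~R) ?fejer_per// /intv !mxE.
Qed.

Lemma kern_trig : trig kern.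
Proof.
apply: trig_prod => i; rewrite (_ : (fun x => _) = (fun x : 'rV[R]_n => fejer r (1 * x ord0 i))).
  exact: fejer_trig.
by apply/funext => x; rewrite mul1r.
Qed.

Let m0 : (0 < m)%N. Proof. by rewrite muln_gt0 expn_gt0. Qed.

Lemma node_coord (x : 'rV[R]_n) (j : J) i : (x - grid m (node j)) ord0 i = x ord0 i - (j i)%:R / m%:R.
Proof. by rewrite /grid /node /intv !mxE mulrC. Qed.

Lemma kern_sum x : \sum_(j : J) kern (x - grid m (node j)) = t%:R ^+ n.
Proof.
rewrite /kern; under eq_bigr do under eq_bigr do rewrite node_coord.
rewrite -(bigA_distr_bigA (fun i (k : 'I_m) => fejer r (x ord0 i - k%:R / m%:R))).
under eq_bigr do rewrite fejer_sum//.
by rewrite prodr_const card_ord.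
Qed.

(** The sum factorises over coordinates. The factor of [i0] is at most [m * 4^-r = t * 2^-r],
    against [t] for the others: the kernel concentrates at rate [2^-r], uniformly in [t]. *)
Lemma kern_sum_sin x i0 :
  \sum_(j : J) kern (x - grid m (node j)) * sin (pi * (x - grid m (node j)) ord0 i0) ^+ 2 <=
  t%:R ^+ n * 2^-1 ^+ r.
Proof.
pose G i (k : 'I_m) := fejer r (x ord0 i - k%:R / m%:R) *
  (if i == i0 then sin (pi * (x ord0 i0 - k%:R / m%:R)) ^+ 2 else 1).
have -> : \sum_(j : J) kern (x - grid m (node j)) * sin (pi * (x - grid m (node j)) ord0 i0) ^+ 2 =
  \sum_(j : J) \prod_i G i (j i).
  apply: eq_bigr => j _; rewrite big_split/=; congr (_ * _).
    by apply: eq_bigr => i _; rewrite node_coord.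
  by rewrite -big_mkcond/= big_pred1_eq node_coord.
rewrite -bigA_distr_bigA.
have -> : t%:R ^+ n * 2^-1 ^+ r = \prod_(i < n) (t%:R * (if i == i0 then 2^-1 ^+ r else 1 : R)).
  by rewrite big_split/= prodr_const card_ord -big_mkcond/= big_pred1_eq.
apply: ler_prod => i _; apply/andP; split.
  apply: sumr_ge0 => k _; rewrite mulr_ge0 ?fejer_ge0//.
  by case: ifP => _ //; rewrite sqr_ge0.
rewrite /G; case: eqVneq => [->|_]; last first.
  by under eq_bigr do rewrite mulr1; rewrite mulr1 fejer_sum.
apply: (@le_trans _ _ (\sum_(k < m) 4^-1 ^+ r)).
  by apply: ler_sum => k _; exact: fejer_sin.
rewrite sumr_const card_ord -[X in X <= _]mulr_natl natrM natrX mulrAC [X in _ <= X]mulrC ler_wpM2r//.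
by rewrite -exprMn (_ : 2 * 4^-1 = 2^-1 :> R)//; field.
Qed.

Lemma per_sum_shift (G : Z -> R) z : (forall x y, G (x + y *+ m) = G x) ->
  \sum_(j : J) G (node j + z) = \sum_(j : J) G (node j).
Proof.
move=> pG.
have lt (a : int) : (`|(a %% m%:Z)%Z| < m)%N.
  by have := ltz_pmod a (d := m%:Z); have := modz_ge0 a (d := m%:Z); move: m0; lia.
pose s (j : J) : J := [ffun i => Ordinal (lt ((j i)%:Z + z ord0 i)%R)].
have Gs j : G (node j + z) = G (node (s j)).
  rewrite -(pG (node (s j)) (\row_i (((j i)%:Z + z ord0 i) %/ m%:Z)%Z)); congr G.
  apply: introw_ext => i; rewrite !introwD introwMn !mxE ffunE/=.
  have := divz_eq ((j i)%:Z + z ord0 i) m%:Z; have := modz_ge0 ((j i)%:Z + z ord0 i) (d := m%:Z).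
  move: m0; lia.
have sI : injective s.
  move=> j j' /ffunP e; apply/ffunP => i; apply/val_inj => /=.
  have := congr1 val (e i); rewrite !ffunE/= => e1.
  have e2 : ((j i)%:Z + z ord0 i = (j' i)%:Z + z ord0 i %[mod m%:Z])%Z.
    have := modz_ge0 ((j i)%:Z + z ord0 i) (d := m%:Z); have := modz_ge0 ((j' i)%:Z + z ord0 i) (d := m%:Z).
    move: m0 e1; lia.
  move/eqP: e2; rewrite eqz_modDr => /eqP; by rewrite !modz_nat !modn_small// => -[].
rewrite (eq_bigr _ (fun j _ => Gs j)).
by rewrite [RHS](reindex_inj sI).
Qed.

End kernel.

Section test_function.
Context (R : realType) (n : nat).
Local Notation Z := 'rV[int]_n.
Local Notation "'E i" := (delta_mx ord0 i : 'rV[R]_n) (at level 10).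

(** Identifies the partial derivatives of [interp] with sums of derivatives of the kernel. The
    general bounds for smooth functions give an expansion with an uncontrolled constant, whereas the
    termwise one has an explicit constant. *)
Lemma taylor_unique (f : 'rV[R]_n -> R) (x : 'rV[R]_n) (G G' : 'I_n -> R) (C C' : R) :
  (forall z, `|f (x + z) - f x - \sum_i z ord0 i * G i| <= C * `|z| ^+ 2) ->
  (forall z, `|f (x + z) - f x - \sum_i z ord0 i * G' i| <= C' * `|z| ^+ 2) ->
  forall i, G i = G' i.
Proof.
move=> H H' i; apply/eqP; rewrite -subr_eq0 -normr_le0.
have nE : `|'E i| <= 1.
  apply: norm_rV_le => // k; rewrite mxE; case: (_ && _); rewrite ?normr1 ?normr0//.
have key s : 0 < s -> `|G i - G' i| <= (`|C| + `|C'|) * s.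
  move=> s0.
  have sE (g : 'I_n -> R) : \sum_k (s *: 'E i) ord0 k * g k = s * g i.
    rewrite (bigD1 i)//= big1 ?addr0; first by rewrite !mxE !eqxx/= mulr1.
    by move=> k /negbTE ki; rewrite !mxE ki andbF mulr0 mul0r.
  have h1 := H (s *: 'E i); have h2 := H' (s *: 'E i); rewrite !sE in h1 h2.
  have ns : `|s *: 'E i| ^+ 2 <= s ^+ 2.
    apply: lerXn2r; rewrite ?nnegrE//; first exact: ltW.
    by rewrite normrZ gtr0_norm// ler_piMr// ltW.
  have c1 : C * `|s *: 'E i| ^+ 2 <= `|C| * s ^+ 2.
    apply: le_trans (ler_wpM2l (normr_ge0 C) ns); rewrite ler_wpM2r ?exprn_ge0//; exact: ler_norm.
  have c2 : C' * `|s *: 'E i| ^+ 2 <= `|C'| * s ^+ 2.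
    apply: le_trans (ler_wpM2l (normr_ge0 C') ns); rewrite ler_wpM2r ?exprn_ge0//; exact: ler_norm.
  have h3 : `|s * (G i - G' i)| <= (`|C| + `|C'|) * s ^+ 2.
    have -> : s * (G i - G' i) = (f (x + s *: 'E i) - f x - s * G' i) - (f (x + s *: 'E i) - f x - s * G i) by ring.
    by apply: le_trans (ler_normB _ _) _; lra.
  move: h3; rewrite normrM gtr0_norm// expr2 [s * s]mulrC mulrA mulrC ler_pM2r//.
apply/ler_addgt0Pr => e e0; rewrite add0r.
have p1 : 0 < `|C| + `|C'| + 1 by rewrite ltr_wpDl// addr_ge0.
apply: le_trans (key (e / (`|C| + `|C'| + 1)) _) _; first by rewrite divr_gt0.
by rewrite mulrA ler_pdivrMr// mulrC ler_pM2l// lerDl.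
Qed.

Context (r : nat).

Lemma kern_taylor : exists2 C, 0 <= C & forall x z : 'rV[R]_n,
  `|kern r (x + z) - kern r x - \sum_i z ord0 i * 'D_('E i) (kern r) x| <= C * `|z| ^+ 2.
Proof.
have [C C0 [_ _ _ _ h]] := smooth_estimates (@kern_per R n r) (trig_smooth (@kern_trig R n r)).
by exists C.
Qed.

Context (t : nat) (u : Z -> R) (A C : R).
Hypotheses (t0 : (0 < t)%N) (uA : forall x, `|u x - u 0| <= A).
Hypotheses (C0 : 0 <= C) (taylorC : forall x z : 'rV[R]_n,
  `|kern r (x + z) - kern r x - \sum_i z ord0 i * 'D_('E i) (kern r) x| <= C * `|z| ^+ 2).
Local Notation m := (2 ^ r * t)%N.
Local Notation J := {ffun 'I_n -> 'I_m}.
Hypothesis pu : forall x z, u (x + z *+ m) = u x.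

(* Smoothing [u] by a Fejer-type kernel: derivatives of [interp] are controlled independently of [t]. *)
Definition interp (x : 'rV[R]_n) : R :=
  (t%:R ^+ n)^-1 * \sum_(j : J) (u (node j) - u 0) * kern r (x - grid R m (node j)).

Let tn0 : 0 < (t%:R ^+ n)^-1 :> R.
Proof. by rewrite invr_gt0 exprn_gt0// ltr0n. Qed.

Let m0 : (0 < m)%N. Proof. by rewrite muln_gt0 expn_gt0. Qed.

Lemma interp_trig : trig interp.
Proof.
apply: trigM; first exact: trig_cst.
apply: trig_sum => j; apply: trigM; first exact: trig_cst.
by apply: trig_shift; exact: kern_trig.
Qed.

Lemma interp_per : per interp.
Proof. by move=> x z; congr (_ * _); apply: eq_bigr => j _; rewrite addrAC kern_per. Qed.

(** There are [m ^ n] nodes and the normalisation divides by [t ^ n], so [(2 ^ r) ^ n] is left: the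
    constant does not see the refinement of the lattice. *)
Lemma interp_taylor x z :
  `|interp (x + z) - interp x - \sum_i z ord0 i * 'D_('E i) interp x| <= (2 ^ r)%:R ^+ n * A * C * `|z| ^+ 2.
Proof.
pose G x i := (t%:R ^+ n)^-1 * \sum_(j : J) (u (node j) - u 0) * 'D_('E i) (kern r) (x - grid R m (node j)).
have TG y : `|interp (x + y) - interp x - \sum_i y ord0 i * G x i| <= (2 ^ r)%:R ^+ n * A * C * `|y| ^+ 2.
  have -> : interp (x + y) - interp x - \sum_i y ord0 i * G x i =
    (t%:R ^+ n)^-1 * \sum_(j : J) (u (node j) - u 0) *
     (kern r (x - grid R m (node j) + y) - kern r (x - grid R m (node j)) - \sum_i y ord0 i * 'D_('E i) (kern r) (x - grid R m (node j))).
    have -> : \sum_i y ord0 i * G x i = (t%:R ^+ n)^-1 * \sum_(j : J) (u (node j) - u 0) * \sum_i y ord0 i * 'D_('E i) (kern r) (x - grid R m (node j)).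
      under eq_bigr do rewrite /G mulrCA mulr_sumr.
      rewrite -mulr_sumr; congr (_ * _); rewrite exchange_big/=; apply: eq_bigr => j _.
      by rewrite mulr_sumr; apply: eq_bigr => i _; ring.
    rewrite /interp -!mulrBr -!sumrB; congr (_ * _); apply: eq_bigr => j _.
    by rewrite [x + y - _]addrAC; ring.
  rewrite normrM gtr0_norm// mulrC ler_pdivrMr ?exprn_gt0 ?ltr0n//.
  apply: le_trans (ler_norm_sum _ _ _) _.
  apply: (@le_trans _ _ (\sum_(j : J) A * (C * `|y| ^+ 2))).
    by apply: ler_sum => j _; rewrite normrM; apply: ler_pM.
  rewrite sumr_const card_ffun !card_ord -[X in X <= _]mulr_natl natrX natrM exprMn.
  by rewrite le_eqVlt; apply/orP; left; apply/eqP; ring.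
have [C' _ [_ _ _ _ h]] := smooth_estimates interp_per (trig_smooth interp_trig).
have e := taylor_unique TG (h x).
by under eq_bigr do rewrite -e; exact: TG.
Qed.

(** Summation by parts: reindexing the periodic sum over nodes moves a lattice translation from the
    kernel to [u]. *)
Lemma interp_shift x z : interp (x + grid R m z) - interp x =
  (t%:R ^+ n)^-1 * \sum_(j : J) (u (node j + z) - u (node j)) * kern r (x - grid R m (node j)).
Proof.
rewrite /interp -mulrBr; congr (_ * _).
have e := @per_sum_shift R n r t t0 (fun y => (u y - u 0) * kern r (x + grid R m z - grid R m y)) z.
rewrite -e; last first.
  by move=> y y'; rewrite pu grid_per// opprD addrA -(kern_per _ (x + grid R m z - grid R m y - intv R y') y') subrK.
rewrite -sumrB; apply: eq_bigr => j _.
by rewrite gridD [grid R m (node j) + _]addrC opprD addrA addrK; ring.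
Qed.

End test_function.

(** * The smoothed corrector is an approximate subsolution *)

Section lower_bound.
Context (R : realType) (n : nat) (L : phase R n -> R).
Local Notation Z := 'rV[int]_n.
Local Notation "'E i" := (delta_mx ord0 i : 'rV[R]_n) (at level 10).
Context (p q M r t : nat) (u : Z -> R) (A C C1 lam eps : R).
Hypotheses (t0 : (0 < t)%N) (p0 : (0 < p)%N) (q0 : (0 < q)%N) (em : (2 ^ r * t = p * q)%N).
Hypotheses (A0 : 0 <= A) (C0 : 0 <= C) (taylorC : forall x z : 'rV[R]_n,
  `|kern r (x + z) - kern r x - \sum_i z ord0 i * 'D_('E i) (kern r) x| <= C * `|z| ^+ 2).
Local Notation m := (2 ^ r * t)%N.
Local Notation J := {ffun 'I_n -> 'I_m}.
Local Notation h := (p%:R^-1 : R).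
Hypotheses (pu : forall x z, u (x + z *+ m) = u x) (osc : forall x y, u x <= A + u y)
  (lip : forall x z : Z, (forall i, (`|z ord0 i| <= q)%N) -> u x <= h * A + u (x + z))
  (low : forall x z : Z, (forall i, (`|z ord0 i| <= M * q)%N) ->
    h * (lam - eps) <= h * L (lift (grid R m x, grid R q z)) + u (x + z) - u x)
  (C10 : 0 <= C1) (Lmod : forall x y v : 'rV[R]_n, `|v| <= M%:R ->
    `|L (lift (x, v)) - L (lift (y, v))| <= eps + C1 * \sum_i sin (pi * (x ord0 i - y ord0 i)) ^+ 2)
  (rC1 : n%:R * C1 * 2^-1 ^+ r <= eps).
Let D : R := (2 ^ r)%:R ^+ n * A * C.
Hypotheses (D1 : D * h <= 1) (D2 : D * M%:R ^+ 2 * h <= eps).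

Let h0 : 0 < h. Proof. by rewrite invr_gt0 ltr0n. Qed.
Let T0 : 0 < t%:R ^+ n :> R. Proof. by rewrite exprn_gt0// ltr0n. Qed.
Let uA x : `|u x - u 0| <= A.
Proof. by rewrite ler_norml; have := osc x 0; have := osc 0 x; move=> ? ?; apply/andP; split; lra. Qed.
Let D0 : 0 <= D. Proof. by rewrite !mulr_ge0 ?exprn_ge0. Qed.
Local Notation Phi := (@interp R n r t u).

Lemma norm_grid_le (k s : nat) (z : Z) : (0 < k)%N -> (forall i, (`|z ord0 i| <= s * k)%N) -> `|grid R k z| <= s%:R :> R.
Proof.
move=> k0 zs; apply: norm_rV_le => // i.
rewrite /grid /intv !mxE normrM normfV normr_nat -intr_norm mulrC ler_pdivrMr ?ltr0n//.
by rewrite -natrM -[(s * k)%:R]/((s * k)%:~R) ler_int -abszE lez_nat.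
Qed.

Let scale (z : Z) : grid R m z = h *: grid R q z.
Proof. by rewrite /grid em natrM invfM scalerA mulrC. Qed.

(** The inequalities [low] at the nodes are averaged with the kernel as weight. One [eps] comes from
    [low]; moving [L] from a node to [x] costs another, plus the averaged squared sines, which
    account for the third. *)
Lemma interp_increment (x : 'rV[R]_n) (z : Z) : (forall i, (`|z ord0 i| <= M * q)%N) ->
  h * (lam - 3 * eps - L (lift (x, grid R q z))) <= Phi (x + grid R m z) - Phi x.
Proof.
move=> zM; have vM := norm_grid_le q0 zM.
rewrite (interp_shift t0 pu) [leRHS]mulrC ler_pdivlMr//.
pose c := lam - 2 * eps - L (lift (x, grid R q z)).
apply: (@le_trans _ _ (\sum_(j : J) (h * (c - C1 * \sum_i sin (pi * (x - grid R m (node j)) ord0 i) ^+ 2)) * kern r (x - grid R m (node j)))); last first.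
  apply: ler_sum => j _; rewrite ler_wpM2r ?kern_ge0//.
  have h1 := low (node j) zM; have h2 := Lmod x (grid R m (node j)) vM.
  have e : \sum_i sin (pi * (x - grid R m (node j)) ord0 i) ^+ 2 = \sum_i sin (pi * (x ord0 i - grid R m (node j) ord0 i)) ^+ 2.
    by apply: eq_bigr => i _; rewrite rVB.
  rewrite -e ler_norml in h2; case/andP: h2 => h2 _.
  set S := \sum_i _ in h2 *.
  have h3 : h * L (lift (grid R m (node j), grid R q z)) <= h * (L (lift (x, grid R q z)) + eps + C1 * S).
    by rewrite ler_pM2l//; lra.
  rewrite /c; lra.
under eq_bigr do rewrite mulrBr mulrBl -!mulrA.
rewrite sumrB -mulr_sumr -mulr_sumr kern_sum//.
have h4 : \sum_(j : J) h * (C1 * ((\sum_i sin (pi * (x - grid R m (node j)) ord0 i) ^+ 2) * kern r (x - grid R m (node j)))) <=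
    h * (C1 * (n%:R * (t%:R ^+ n * 2^-1 ^+ r))).
  rewrite -mulr_sumr ler_pM2l// -mulr_sumr ler_wpM2l//.
  under eq_bigr do rewrite mulr_suml.
  rewrite exchange_big/= -[n in n%:R]card_ord mulr_natl -sumr_const; apply: ler_sum => i _.
  by under eq_bigr do rewrite mulrC; exact: kern_sum_sin.
have h5 : h * (C1 * (n%:R * (t%:R ^+ n * 2^-1 ^+ r))) <= h * (t%:R ^+ n * eps).
  rewrite ler_pM2l// (_ : C1 * _ = t%:R ^+ n * (n%:R * C1 * 2^-1 ^+ r)); last by ring.
  by rewrite ler_pM2l.
rewrite /c; lra.
Qed.

(** A unit-speed step changes [u] by at most [h * A], hence also its average. Dividing by [h] leaves
    [A], and the Taylor error contributes at most one. The bound is independent of the lattice, as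
    is needed to choose [M] before it. *)
Lemma interp_grad x i : `|'D_('E i) Phi x| <= A + 1.
Proof.
pose z : Z := \row_k (if k == i then q%:Z else 0).
have zq k : (`|z ord0 k| <= q)%N by rewrite mxE; case: ifP => _; rewrite ?absz0// absz_nat.
have zE : grid R m z = h *: 'E i.
  rewrite scale; congr (_ *: _); apply/rowP => k; rewrite /grid /intv /z !mxE.
  by case: eqVneq => _ /=; rewrite ?mulr0// -pmulrn mulVf// pnatr_eq0 -lt0n.
have bnd y : `|u (y + z) - u y| <= h * A.
  have h1 := lip y zq; have h2 : u (y + z) <= h * A + u (y + z + - z).
    by apply: lip => k; rewrite mxE abszN.
  by rewrite addrK in h2; rewrite ler_norml; apply/andP; split; lra.
have h1 : `|Phi (x + h *: 'E i) - Phi x| <= h * A.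
  rewrite -zE (interp_shift t0 pu) normrM gtr0_norm ?invr_gt0// mulrC ler_pdivrMr//.
  apply: le_trans (ler_norm_sum _ _ _) _.
  rewrite -(kern_sum r t0 x) mulr_sumr; apply: ler_sum => j _.
  by rewrite normrM [X in _ * X]ger0_norm ?kern_ge0// ler_wpM2r ?kern_ge0.
have h2 := interp_taylor t0 uA taylorC x (h *: 'E i).
have e : \sum_k (h *: 'E i) ord0 k * 'D_('E k) Phi x = h * 'D_('E i) Phi x.
  rewrite (bigD1 i)//= big1 ?addr0; first by rewrite !mxE !eqxx/= mulr1.
  by move=> k /negbTE ki; rewrite !mxE ki andbF mulr0 mul0r.
have nE : `|h *: 'E i| ^+ 2 <= h ^+ 2.
  apply: lerXn2r; rewrite ?nnegrE ?(ltW h0)//.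
  rewrite normrZ gtr0_norm// ler_piMr ?(ltW h0)//; apply: norm_rV_le => // k.
  by rewrite mxE; case: (_ && _); rewrite ?normr1 ?normr0.
rewrite e -/D in h2.
have h3 : D * `|h *: 'E i| ^+ 2 <= h * 1.
  apply: le_trans (ler_wpM2l D0 nE) _; rewrite expr2 mulrA mulrC ler_pM2l//.
have h4 : h * `|'D_('E i) Phi x| <= h * (A + 1).
  rewrite -[X in X * _](gtr0_norm h0) -normrM.
  have -> : h * 'D_('E i) Phi x = (Phi (x + h *: 'E i) - Phi x) - (Phi (x + h *: 'E i) - Phi x - h * 'D_('E i) Phi x) by ring.
  by apply: le_trans (ler_normB _ _) _; lra.
by rewrite ler_pM2l in h4.
Qed.

(** Dividing the increment over one step by [h] turns it into the gradient term; the Taylor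
    remainder costs the fourth [eps]. *)
Lemma lower_grid (x : 'rV[R]_n) (z : Z) : (forall i, (`|z ord0 i| <= M * q)%N) ->
  lam - 4 * eps <= L (lift (x, grid R q z)) + \sum_i (grid R q z) ord0 i * 'D_('E i) Phi x.
Proof.
move=> zM; have vM := norm_grid_le q0 zM.
have h1 := interp_increment x zM; have h2 := interp_taylor t0 uA taylorC x (grid R m z).
rewrite scale in h1 h2.
have e : \sum_i (h *: grid R q z) ord0 i * 'D_('E i) Phi x = h * \sum_i (grid R q z) ord0 i * 'D_('E i) Phi x.
  by rewrite mulr_sumr; apply: eq_bigr => i _; rewrite mulrA; congr (_ * _); rewrite mxE.
rewrite e -/D in h2.
have h3 : D * `|h *: grid R q z| ^+ 2 <= h * eps.
  rewrite normrZ gtr0_norm// exprMn.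
  have : `|grid R q z| ^+ 2 <= M%:R ^+ 2 by apply: lerXn2r; rewrite ?nnegrE.
  move=> /(ler_wpM2l D0) h3; have := ler_wpM2l (ltW h0) (ler_wpM2l (ltW h0) h3).
  have := ler_wpM2l (ltW h0) D2.
  rewrite expr2; lra.
set S := \sum_i _ in h2 *.
rewrite ler_norml in h2; case/andP: h2 => _ h2.
rewrite -(ler_pM2l h0); lra.
Qed.

End lower_bound.

(** * Choice of the constants *)

Section corrector.
Context (R : realType) (n : nat) (L : phase R n -> R).
Local Notation Z := 'rV[int]_n.
Hypotheses (cL : continuous L) (L0 : forall P, 0 <= L P)
  (Linf : (L P / enorm P.2) @[P --> @vinfty R n] --> +oo).

Lemma lin_modulus (M eta : R) : 0 < eta -> exists2 C, 0 <= C & forall x y v : 'rV[R]_n, `|v| <= M ->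
  `|L (lift (x, v)) - L (lift (y, v))| <= eta + C * `|x - y|.
Proof.
move=> eta0; have [del del0 Hd] := phase_uniform M cL eta0.
have [B HB] := phase_bounded M cL.
have C0 : 0 <= 2 * `|B| / del by rewrite divr_ge0// ?ltW// mulr_ge0.
exists (2 * `|B| / del) => // x y v vM; case: (ltP `|x - y| del) => h.
  apply: (@le_trans _ _ eta); last by rewrite lerDl mulr_ge0.
  by apply: ltW; apply: Hd => //; rewrite subrr normr0.
apply: le_trans (ler_normB _ _) _.
have h1 := le_trans (HB x v vM) (ler_norm B); have h2 := le_trans (HB y v vM) (ler_norm B).
have h4 := ler_wpM2l C0 h; rewrite divfK ?gt_eqF// in h4.
lra.
Qed.

Lemma superlinear (a : R) : 0 <= a -> exists M : nat, forall x v : 'rV[R]_n,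
  M%:R < `|v| -> a * (1 + enorm v) <= L (lift (x, v)).
Proof.
move=> a0; have [K HK] := vinfty_pinfty Linf (2 * a).
have [N HN] := natr_large (Num.max 1 K).
exists N.+1 => x v vN.
have ve := norm_le_enorm v.
have e1 : Num.max 1 K < enorm v by exact: lt_trans HN (lt_le_trans vN ve).
move: e1; rewrite gt_max => /andP[e1 eK].
have := HK (lift (x, v)) eK; rewrite /= ler_pdivlMr; last lra.
by move=> h; have h' : a * 1 <= a * enorm v; [rewrite ler_wpM2l// ltW|lra].
Qed.

Lemma round_velocity (q M : nat) (v : 'rV[R]_n) : (0 < q)%N -> `|v| <= M%:R ->
  exists z : Z, (forall i, (`|z ord0 i| <= M * q)%N) /\ `|v - grid R q z| <= q%:R^-1.
Proof.
move=> q0 vM.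
have qR : 0 < q%:R :> R by rewrite ltr0n.
(* Rounding towards zero does not increase the modulus, so the bound [M * q] is preserved. *)
pose z : Z := \row_i (if 0 <= v ord0 i then (Num.truncn (q%:R * v ord0 i))%:Z else - (Num.truncn (- (q%:R * v ord0 i)))%:Z).
have cv i := le_trans (coord_le_norm v i) vM.
exists z; split=> [i|].
  have h (y : R) : 0 <= y -> y <= q%:R * M%:R -> (Num.truncn y <= M * q)%N.
    move=> y0 yM; have /andP[h1 _] := truncn_itv y0.
    by rewrite -(ler_nat R) natrM mulrC; exact: le_trans h1 yM.
  have := cv i; rewrite /z mxE; case: (leP 0 (v ord0 i)) => v0 c.
    rewrite absz_nat; apply: h; first by rewrite mulr_ge0.
    by rewrite ler_pM2l//; move: c; rewrite ger0_norm.
  rewrite abszN absz_nat; apply: h; first by rewrite -mulrN mulr_ge0// oppr_ge0 ltW.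
  by rewrite -mulrN ler_pM2l//; move: c; rewrite ltr0_norm.
apply: norm_rV_le => [|i]; first by rewrite invr_ge0.
have -> : (v - grid R q z) ord0 i = q%:R^-1 * (q%:R * v ord0 i - (z ord0 i)%:~R).
  by rewrite rVB mulrBr mulKf ?gt_eqF// /grid /intv !mxE.
rewrite normrM normfV normr_nat -[leRHS]mulr1 ler_pM2l ?invr_gt0//.
rewrite /z mxE; case: (leP 0 (v ord0 i)) => v0.
  have /andP[h1 h2] := truncn_itv (mulr_ge0 (ltW qR) v0); rewrite -natr1 in h2.
  rewrite -pmulrn ler_norml; apply/andP; split; lra.
have v0' : 0 <= - (q%:R * v ord0 i) by rewrite -mulrN mulr_ge0// oppr_ge0 ltW.
have /andP[h1 h2] := truncn_itv v0'; rewrite -natr1 in h2.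
rewrite mulrNz -pmulrn ler_norml; apply/andP; split; lra.
Qed.

(** The constants are fixed in an order without circularity: [A], then [M], the discount [al], the
    kernel order [r], the number of time steps [p], and finally [q]. Beyond the [4 * eps] of
    [lower_grid], rounding the velocity costs one [eps] in [L] and one in the gradient term. *)
Theorem corrector (eps : R) : 0 < eps ->
  exists (p q M : nat) (u : Z -> R) (V : Z -> Z) (lam U C : R),
  [/\ [/\ (0 < p)%N, (0 < q)%N & 0 <= C],
    exists2 phi : torus R n -> R, smooth (phi \o @to_torus R n) &
      forall P, lam - 6 * eps <= L P + hol phi P,
    (forall x, 0 <= u x <= U),
    (forall x i, (`|V x ord0 i| <= M * q)%N) &
    [/\ (forall x, p%:R^-1 * L (lift (grid R (p * q) x, grid R q (V x))) + u (x + V x) - u x <=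
           p%:R^-1 * (lam + 2 * eps)),
      (forall x e s, 0 <= s -> `|grid R (p * q) e| <= (p * q)%:R^-1 + s ->
         u (x + e) <= u x + eps * p%:R^-1 + C * s) &
      (forall (x y v : 'rV[R]_n) s, 0 <= s -> `|v| <= M%:R -> `|x - y| <= (1 + M%:R) * p%:R^-1 + s ->
         L (lift (y, v)) <= L (lift (x, v)) + 2 * eps + C * s)]].
Proof.
move=> eps0.
have [A A0 LA] : exists2 A, 0 <= A & forall x v : 'rV[R]_n, `|v| <= 1 -> L (lift (x, v)) <= A.
  have [B HB] := phase_bounded 1 cL; exists `|B| => // x v v1.
  by apply: le_trans (ler_norm _) _; apply: le_trans (HB x v v1) (ler_norm _).
(* The slope anticipates the gradient bound [A + 1] of the smoothed corrector: beyond [M], [L] pays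
   for the gradient term and still exceeds [A], which bounds [lam]. *)
have [M0 HM] := superlinear (a := n%:R * (A + 1) + A) (addr_ge0 (mulr_ge0 (ler0n _ _) (addr_ge0 A0 ler01)) A0).
pose M := M0.+1.
have HM' (x v : 'rV[R]_n) : M%:R < `|v| -> (n%:R * (A + 1) + A) * (1 + enorm v) <= L (lift (x, v)).
  by move=> h; apply: HM; apply: le_lt_trans h; rewrite ler_nat.
pose al := Num.min 1 (eps / (A + 1)).
have A1 : 0 < A + 1 by rewrite ltr_wpDl.
have al0 : 0 < al by rewrite lt_min ltr01 divr_gt0.
have al1 : al <= 1 by rewrite ge_min lexx.
have alA : al * A <= eps.
  have : al <= eps / (A + 1) by rewrite ge_min lexx orbT.
  rewrite ler_pdivlMr// => h; apply: le_trans h; rewrite ler_pM2l//; lra.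
have [C1 C10 HC1] := torus_modulus M%:R cL eps0.
have [r Hr] : exists r, n%:R * C1 * 2^-1 ^+ r <= eps.
  have nC : 0 <= n%:R * C1 by rewrite mulr_ge0.
  have [r Hr] := @expr_half_lt R (eps / (n%:R * C1 + 1)) (divr_gt0 eps0 (ltr_wpDl nC ltr01)).
  exists r; rewrite -exprVn ltr_pdivlMr ?ltr_wpDl// mulrC in Hr.
  have : 0 <= 2^-1 ^+ r :> R by rewrite exprn_ge0// invr_ge0.
  lra.
have [CK CK0 HCK] := kern_taylor R n r.
pose D : R := (2 ^ r)%:R ^+ n * A * CK.
have D0 : 0 <= D by rewrite !mulr_ge0 ?exprn_ge0.
have [C3 C30 HC3] := lin_modulus M%:R eps0.
have [p' [Hp0 Hp1 Hp2 Hp3]] : exists p' : nat, [/\ (0 < p')%N, D <= p'%:R, D * M%:R ^+ 2 <= eps * p'%:R &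
    C3 * (1 + M%:R) <= eps * p'%:R].
  have [N HN] := natr_large (D + (D * M%:R ^+ 2 + C3 * (1 + M%:R)) / eps).
  have a1 : 0 <= D * M%:R ^+ 2 by rewrite mulr_ge0 ?exprn_ge0.
  have a2 : 0 <= C3 * (1 + M%:R) by rewrite mulr_ge0 ?addr_ge0.
  have a3 : 0 <= (D * M%:R ^+ 2 + C3 * (1 + M%:R)) / eps by rewrite divr_ge0 ?addr_ge0// ltW.
  exists N.+1; split=> //; first lra.
  - have : (D * M%:R ^+ 2 + C3 * (1 + M%:R)) / eps <= N.+1%:R by lra.
    rewrite ler_pdivrMr//; lra.
  - have : (D * M%:R ^+ 2 + C3 * (1 + M%:R)) / eps <= N.+1%:R by lra.
    rewrite ler_pdivrMr//; lra.
(* The factor [2 ^ r] gives [p * q] the form [2 ^ r * t] required by the kernel. *)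
pose p := (2 ^ r * p')%N.
have p0 : (0 < p)%N by rewrite muln_gt0 expn_gt0.
have pR : 0 < p%:R :> R by rewrite ltr0n.
have pp : p'%:R <= p%:R :> R by rewrite ler_nat leq_pmull// expn_gt0.
have p1 : 1 <= p%:R :> R by rewrite ler1n.
(* The modulus of [u] amplifies an error on [L] by [1 / al], and only [eps / p] may be lost per
   step. The factor [1/2] leaves room for a second error [eta] due to the mesh. *)
pose eta := eps * al * p%:R^-1 / 2.
have eta0 : 0 < eta by rewrite divr_gt0// divr_gt0// mulr_gt0.
have [C4 C40 HC4] := lin_modulus M%:R eta0.
have [del del0 Hdel] := phase_uniform M%:R cL eps0.
(* The three conditions control the displacement by one mesh in the modulus of [u], the rounding of
   [v] in the gradient term, and its rounding in [L]. *)
have [q [q0 Hq1 Hq2 Hq3]] : exists q : nat, [/\ (0 < q)%N, C4 <= eta * q%:R, n%:R * (A + 1) <= eps * q%:R & 1 < del * q%:R].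
  have [N HN] := natr_large (C4 / eta + n%:R * (A + 1) / eps + 1 / del).
  have a1 : 0 <= C4 / eta by rewrite divr_ge0// ltW.
  have a2 : 0 <= n%:R * (A + 1) / eps by rewrite divr_ge0 ?mulr_ge0// ltW.
  have a3 : 0 <= 1 / del by rewrite divr_ge0// ltW.
  exists N.+1; split=> //.
  - have : C4 / eta <= N.+1%:R by lra.
    by rewrite ler_pdivrMr// mulrC.
  - have : n%:R * (A + 1) / eps <= N.+1%:R by lra.
    by rewrite ler_pdivrMr// [eps * _]mulrC.
  - have : 1 / del < N.+1%:R by lra.
    by rewrite ltr_pdivrMr// mulrC.
have qR : 0 < q%:R :> R by rewrite ltr0n.
have alp : al <= p%:R by exact: le_trans al1 p1.
have [u [lam [V [[pu ub lamE] lip osc modu [low Vb up]]]]] := discrete_corrector p0 q0 (ltn0Sn M0) al0 alp L0 LA eps0 alA.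
pose t := (p' * q)%N.
have t0 : (0 < t)%N by rewrite muln_gt0 Hp0.
have em : (2 ^ r * t = p * q)%N by rewrite /t /p mulnA.
have lamA : lam <= A.
  rewrite -lamE; have /andP[_ h] := ub 0; rewrite -ler_pdivlMl//; by rewrite mulrC.
have hD1 : D * p%:R^-1 <= 1 by rewrite ler_pdivrMr// mul1r; lra.
have hD2 : D * M%:R ^+ 2 * p%:R^-1 <= eps.
  by rewrite ler_pdivrMr//; apply: le_trans Hp2 _; rewrite ler_pM2l.
have pu' x z : u (x + z *+ (2 ^ r * t)) = u x by rewrite em; exact: pu.
have lip' (x z : Z) : (forall i, (`|z ord0 i| <= q)%N) -> u x <= p%:R^-1 * A + u (x + z).
  by move=> zq; have := lip 1%N x z; rewrite mul1r; apply=> i; rewrite mul1n.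
have low' (x z : Z) : (forall i, (`|z ord0 i| <= M * q)%N) ->
    p%:R^-1 * (lam - eps) <= p%:R^-1 * L (lift (grid R (2 ^ r * t) x, grid R q z)) + u (x + z) - u x.
  by rewrite em; exact: low.
have Hlow := lower_grid t0 p0 q0 em A0 CK0 HCK pu' osc low' C10 HC1 Hr hD2.
have Hgrad := interp_grad t0 p0 q0 em A0 CK0 HCK pu' osc lip' hD1.
exists p, q, M, u, V, lam, (A / al), (Num.max C3 (C4 / al)); split=> //.
- by split=> //; rewrite le_max C30.
- pose Phi := interp r t u.
  have Pper : per Phi := interp_per r t u.
  have PhiE : (fun P : torus R n => Phi (repr P)) \o @to_torus R n = Phi.
    by apply/funext => x /=; rewrite per_repr.
  exists (fun P => Phi (repr P)); first by rewrite PhiE; apply: trig_smooth; exact: interp_trig.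
  move=> P; have -> : P = lift (repr P.1, P.2) by rewrite /lift to_torusK -surjective_pairing.
  move: (repr P.1) P.2 => x v {P}; rewrite hol_lift PhiE.
  have dv (y : 'rV[R]_n) : `|\sum_i y ord0 i * 'D_(delta_mx ord0 i) Phi x| <= n%:R * (`|y| * (A + 1)).
    apply: le_trans (ler_norm_sum _ _ _) _; rewrite -[n in n%:R]card_ord mulr_natl -sumr_const.
    by apply: ler_sum => i _; rewrite normrM; apply: ler_pM => //; exact: coord_le_norm.
  case: (leP `|v| M%:R) => vM.
    have [z [zM vz]] := round_velocity q0 vM.
    have h1 := Hlow x z zM.
    have qd : q%:R^-1 < del by rewrite -[X in X < _]mul1r ltr_pdivrMr.
    have h2 := Hdel x x v (grid R q z) vM; rewrite subrr normr0 in h2.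
    have {}h2 := h2 del0 (le_lt_trans vz qd).
    have h3 := dv (v - grid R q z).
    have e3 : \sum_i (v - grid R q z) ord0 i * 'D_(delta_mx ord0 i) Phi x =
      \sum_i v ord0 i * 'D_(delta_mx ord0 i) Phi x - \sum_i (grid R q z) ord0 i * 'D_(delta_mx ord0 i) Phi x.
      by rewrite -sumrB; apply: eq_bigr => i _; rewrite rVB mulrBl.
    rewrite e3 in h3.
    have h4 : n%:R * (`|v - grid R q z| * (A + 1)) <= eps.
      apply: (@le_trans _ _ (n%:R * (q%:R^-1 * (A + 1)))).
        by rewrite ler_wpM2l// ler_wpM2r// ltW.
      by rewrite mulrCA mulrC ler_pdivrMr.
    rewrite ltr_norml in h2; case/andP: h2 => h2 _.
    rewrite ler_norml in h3; case/andP: h3 => h3 _.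
    rewrite -/Phi in h1; clear - h1 h2 h3 h4; lra.
  have h1 := HM' x v vM; have h2 := dv v.
  rewrite ler_norml in h2; case/andP: h2 => h2 _.
  have h3 : n%:R * (`|v| * (A + 1)) <= n%:R * (A + 1) * enorm v.
    by rewrite [`|v| * _]mulrC mulrA ler_wpM2l ?mulr_ge0 ?(ltW A1)//; exact: norm_le_enorm.
  have h4 : 0 <= A * enorm v by rewrite mulr_ge0// enorm_ge0.
  have h5 : 0 <= n%:R * (A + 1) by rewrite mulr_ge0// ltW.
  clear - h1 h2 h3 h4 h5 lamA eps0; lra.
- split=> [//|x e s s0 He|x y v s s0 vM xy].
  + have m0 : 0 < (p * q)%:R :> R by rewrite ltr0n muln_gt0 p0.
    pose c : R := eta + C4 * ((p * q)%:R^-1 + s).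
    have c0 : 0 <= c by rewrite addr_ge0 ?(ltW eta0)// mulr_ge0// addr_ge0// invr_ge0 ltW.
    have h1 := modu c e c0.
    have h2 : u (x + e) <= u x + c / al.
      apply: h1 => y z zM.
      have vM : `|vel R q z| <= M%:R by exact: (norm_grid_le R q0 zM).
      have h3 := HC4 (mesh R p q (y + e)) (mesh R p q y) _ vM.
      rewrite meshD [_ + mesh _ _ _ _]addrC addrK -/(grid R (p * q) e) in h3.
      have h4 := ler_wpM2l C40 He.
      rewrite meshD [mesh R p q y + _]addrC.
      rewrite ler_norml in h3; case/andP: h3 => _ h3.
      rewrite /c; have -> : mesh R p q e = grid R (p * q) e by [].
      clear - h3 h4; lra.
    apply: le_trans h2 _.
    have h5 : C4 * (p * q)%:R^-1 <= eta.
      rewrite ler_pdivrMr// natrM; apply: le_trans Hq1 _; rewrite ler_pM2l// ler_peMl// ltW.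
    have h6 : c / al <= (2 * eta + C4 * s) / al by rewrite ler_pM2r ?invr_gt0// /c; clear - h5; lra.
    have h7 : 2 * eta / al = eps * p%:R^-1 by rewrite /eta; field; rewrite !gt_eqF.
    have h8 : C4 / al * s <= Num.max C3 (C4 / al) * s by rewrite ler_wpM2r// le_max lexx orbT.
    have h9 : (2 * eta + C4 * s) / al = 2 * eta / al + C4 / al * s by ring.
    rewrite h9 h7 in h6; clear - h6 h8; lra.
  + have h1 := HC3 x y v vM; have h2 := ler_wpM2l C30 xy.
    have h3 : C3 * ((1 + M%:R) * p%:R^-1) <= eps.
      by rewrite mulrA ler_pdivrMr//; apply: le_trans Hp3 _; rewrite ler_pM2l.
    have h4 : C3 * s <= Num.max C3 (C4 / al) * s by rewrite ler_wpM2r// le_max lexx.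
    rewrite ler_norml in h1; case/andP: h1 => h1 _; clear - h1 h2 h3 h4; lra.
Qed.

End corrector.

(** * The feedback control *)

Section discrete_valued.
Context d (T : measurableType d) (I : countType) d' (T' : measurableType d').

Lemma discrete_measurable (D : set T) (f : T -> I) (H : I -> T') :
  (forall z, measurable (D `&` [set t | f t = z])) -> measurable_fun D (fun t => H (f t)).
Proof.
move=> mf mD B mB.
rewrite (_ : _ `&` _ = \bigcup_(k : nat) (if unpickle k is Some z then (D `&` [set t | f t = z]) `&` [set _ | B (H z)] else set0)).
  apply: bigcupT_measurable => k; case: unpickle => [z|//].
  case: (pselect (B (H z))) => Bz.
    by rewrite (_ : [set _ : T | B (H z)] = setT) ?setIT//; apply/seteqP; split.
  by rewrite (_ : [set _ : T | B (H z)] = set0) ?setI0//; apply/seteqP; split.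
apply/seteqP; split=> [t [Dt Bt]|t [k _]].
  by exists (pickle (f t)) => //; rewrite pickleK.
by case: unpickle => // z [[Dt /= ->]].
Qed.

End discrete_valued.

Section feedback.
Context (R : realType) (n : nat) (d : measure_display) (W : measurableType d)
  (P : probability W R) (F : R -> set (set W)) (w : R -> W -> 'rV[R]_n).
Hypotheses (fF : filtration F) (bw : brownian P F w).
Local Notation Z := 'rV[int]_n.
Context (p q M : nat) (V : Z -> Z) (sigma : R).
Hypotheses (p0 : (0 < p)%N) (q0 : (0 < q)%N) (s0 : 0 < sigma)
  (VM : forall x i, (`|V x ord0 i| <= M * q)%N).
Local Notation lam := (@lebesgue_measure R).
Local Notation h := (p%:R^-1 : R).
Local Notation m' := (p * q).-1.

(** The predecessor in the index compensates the successor in [gridfl]: the cells have mesh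
    [1/(pq)]. *)
Definition cell (x : 'rV[R]_n) : Z := gridfl m' x.
Lemma trunc_itv_eq (k : nat) (s : R) : 0 <= s -> Num.truncn (p%:R * s) = k <-> k%:R * h <= s < k.+1%:R * h.
Proof.
move=> s_ge0; have pR : 0 < p%:R :> R by rewrite ltr0n.
have e (j : nat) : (j%:R * h <= s) = (j%:R <= p%:R * s) by rewrite ler_pdivrMr// mulrC.
have e' (j : nat) : (s < j%:R * h) = (p%:R * s < j%:R) by rewrite ltr_pdivlMr// mulrC.
rewrite e e'; split=> [<-|]; first by apply: truncn_itv; rewrite mulr_ge0// ltW.
exact: truncn_def.
Qed.

Definition gvel (z : Z) : 'rV[R]_n := grid R q (V z).

(* The feedback control is constant on [k / p, (k + 1) / p[ and depends on the past only through the
   lattice cell of the position at time k / p. *)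
Fixpoint feedback_drift (k : nat) (om : W) : 'rV[R]_n :=
  if k is k'.+1 then
    feedback_drift k' om + h *: gvel (cell (feedback_drift k' om + sigma *: w (k'%:R * h) om))
  else 0.

Definition feedback_pos k om := feedback_drift k om + sigma *: w (k%:R * h) om.
Definition feedback_cell k om : Z := cell (feedback_pos k om).
Definition feedback (t : R) (om : W) : 'rV[R]_n := gvel (feedback_cell (Num.truncn (p%:R * t)) om).

Let h0 : 0 < h. Proof. by rewrite invr_gt0 ltr0n. Qed.
Let ph : p%:R * h = 1. Proof. by rewrite mulfV// pnatr_eq0 -lt0n. Qed.
Let pR : 0 < p%:R :> R. Proof. by rewrite ltr0n. Qed.

Lemma gvel_norm z : `|gvel z| <= M%:R.
Proof. exact: (norm_grid_le R q0). Qed.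

Lemma feedback_norm t om : `|feedback t om| <= M%:R.
Proof. exact: gvel_norm. Qed.

(** The time [s] is kept fixed while [k] grows, so that the induction takes place in one
    sigma-algebra. Cells take countably many values, hence any function of the cell is
    measurable. *)
Lemma adapted_measurable (k : nat) (s : R) : k%:R * h <= s ->
  (forall i, measurable_fun setT (fun om : g_sigma_algebraType (F s) => feedback_drift k om ord0 i)) /\
  (forall z, measurable [set om : g_sigma_algebraType (F s) | feedback_cell k om = z]).
Proof.
have kh0 (j : nat) : 0 <= j%:R * h by rewrite mulr_ge0// ltW.
have mw (j : nat) i : j%:R * h <= s -> measurable_fun setT (fun om : g_sigma_algebraType (F s) => w (j%:R * h) om ord0 i).
  move=> js _ B mB; rewrite setTI; apply: sub_sigma_algebra.
  have [_ _ incr] := fF; have [_ _ aw _] := bw.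
  by apply: (incr (j%:R * h) s); [rewrite kh0|apply: aw].
have cellm (j : nat) : j%:R * h <= s ->
  (forall i, measurable_fun setT (fun om : g_sigma_algebraType (F s) => feedback_drift j om ord0 i)) ->
  forall z, measurable [set om : g_sigma_algebraType (F s) | feedback_cell j om = z].
  move=> js md z; rewrite -[X in measurable X]setTI.
  apply: (@measurable_gridfl R n _ (g_sigma_algebraType (F s)) setT measurableT (feedback_pos j)) => i.
  apply: (eq_measurable_fun (fun om : g_sigma_algebraType (F s) => feedback_drift j om ord0 i + sigma * w (j%:R * h) om ord0 i)).
    by move=> om _; rewrite /feedback_pos !mxE.
  by apply: measurable_funD => //; apply: measurable_funM => //; exact: mw.
elim: k => [|k IH] ks.
  have md0 i : measurable_fun setT (fun om : g_sigma_algebraType (F s) => feedback_drift 0 om ord0 i).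
    exact: measurable_cst.
  by split=> // z; exact: cellm.
have ks' : k%:R * h <= s by apply: le_trans ks; rewrite ler_pM2r// ler_nat.
have [md mc] := IH ks'.
have md' i : measurable_fun setT (fun om : g_sigma_algebraType (F s) => feedback_drift k.+1 om ord0 i).
  apply: (eq_measurable_fun (fun om : g_sigma_algebraType (F s) => feedback_drift k om ord0 i + h * (gvel (feedback_cell k om)) ord0 i)).
    by move=> om _; rewrite /= !mxE.
  apply: measurable_funD => //; apply: measurable_funM => //.
  apply: (@discrete_measurable _ (g_sigma_algebraType (F s)) _ _ _ setT (feedback_cell k) (fun z => gvel z ord0 i)).
  by move=> z; rewrite setTI.
by split=> // z; exact: cellm.
Qed.

Lemma feedback_progressive : progressive F feedback.
Proof.
move=> t i t0.
pose D : set (measurableTypeR R * g_sigma_algebraType (F t)) := `[0, t]%classic `*` setT.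
apply: (@discrete_measurable _ _ _ _ _ D (fun p0 => feedback_cell (Num.truncn (p%:R * p0.1)) p0.2) (fun z => gvel z ord0 i)) => z.
(* A time slab starting after [t] does not meet [[0, t]], and its cell need not be measurable at
   time [t]; it is therefore replaced by the empty set. *)
rewrite (_ : _ `&` _ = \bigcup_(k : nat) ((`[0, t]%classic `&` `[k%:R * h, k.+1%:R * h[%classic) `*`
   (if k%:R * h <= t then [set om | feedback_cell k om = z] else set0))).
  apply: bigcupT_measurable => k; apply: measurableX.
    by apply: measurableI; exact: measurable_itv.
  by case: ifP => // kt; have [_] := adapted_measurable kt; apply.
apply/seteqP; split=> [[s om] [[/= st _] e]|[s om] [k _ [/= [st sk]]]].
  have s_ge0 : 0 <= s by move: st; rewrite in_itv/= => /andP[].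
  have k1 := (trunc_itv_eq (Num.truncn (p%:R * s)) s_ge0).1 erefl.
  exists (Num.truncn (p%:R * s)) => //=; split; first by split=> //; rewrite in_itv.
  case: ifP => //; move: st; rewrite in_itv/= => /andP[_ st]; case/andP: k1 => k1 _.
  by rewrite (le_trans k1 st).
case: ifP => // kt /= e; have s_ge0 : 0 <= s by move: st; rewrite in_itv/= => /andP[].
split=> //=; rewrite -e; congr feedback_cell; by apply/trunc_itv_eq.
Qed.

Lemma feedback_bounded : bounded_control F feedback.
Proof.
split; first exact: feedback_progressive.
exists (n%:R * M%:R) => t om _; apply: le_trans (enorm_le_norm _) _.
by rewrite ler_wpM2l// feedback_norm.
Qed.

Local Notation X := (diffusion w sigma 0 feedback).

Let fnorm t om : 0 <= t -> `|feedback t om| <= M%:R. Proof. by move=> _; exact: feedback_norm. Qed.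

Lemma feedback_step t om k : k%:R * h <= t < k.+1%:R * h -> feedback t om = gvel (feedback_cell k om).
Proof.
move=> tk; have t0 : 0 <= t.
  by case/andP: tk => h1 _; apply: le_trans h1; rewrite mulr_ge0// ltW.
by rewrite /feedback ((trunc_itv_eq k t0).2 tk).
Qed.

(** The feedback is constant only on half-open intervals; the missing end point has measure zero. *)
Lemma Rint_itvco (f g : R -> R) (a b : R) : a <= b -> bm `[a, b] f -> bm `[a, b] g ->
  (forall t, a <= t < b -> f t <= g t) -> \int[lam]_(t in `[a, b]) f t <= \int[lam]_(t in `[a, b]) g t.
Proof.
move=> ab [mf [Cf fC]] [mg [Cg gC]] fg.
have mI : measurable (`[a, b[%classic : set R) by exact: measurable_itv.
have sub : (`[a, b[%classic : set R) `<=` `[a, b]%classic by apply: subset_itv; rewrite ?bnd_simp.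
have bf : bm `[a, b[ f.
  split; first by apply: measurable_funS mf => //; exact: measurable_itv.
  by exists Cf => t /sub; exact: fC.
have bg : bm `[a, b[ g.
  split; first by apply: measurable_funS mg => //; exact: measurable_itv.
  by exists Cg => t /sub; exact: gC.
have fin : (lam `[a, b[%classic < +oo)%E.
  by apply: le_lt_trans (itv_fin a b); apply: le_measure => //; rewrite inE//; exact: measurable_itv.
rewrite -!Rintegral_itv_bndo_bndc; [|exact: bm_integrable|exact: bm_integrable].
by apply: Rint_le => // t /=; rewrite in_itv/=; exact: fg.
Qed.

Lemma Rint_itvco_cst (f : R -> R) (a b c : R) : a <= b -> bm `[a, b] f ->
  (forall t, a <= t < b -> f t = c) -> \int[lam]_(t in `[a, b]) f t = c * (b - a).
Proof.
move=> ab bf fc; rewrite -Rint_itv_cst//; apply/le_anti/andP.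
by split; apply: Rint_itvco => //; rewrite ?bm_cst//; try exact: bm_cst; move=> t tab; rewrite fc.
Qed.

Lemma feedback_diffusion k om : X (k%:R * h) om = feedback_pos k om.
Proof.
elim: k => [|k IH].
  by apply/rowP => i; rewrite /feedback_pos !mxE mul0r set_itv1 Rintegral_set1 !add0r.
have k0 : 0 <= k%:R * h by rewrite mulr_ge0// ltW.
have kk : k%:R * h <= k.+1%:R * h by rewrite ler_pM2r// ler_nat.
have hh : k.+1%:R * h - k%:R * h = h by rewrite -mulrBl -natr1 addrAC subrr add0r mul1r.
apply/rowP => i.
have e1 := diffusionB w fF sigma 0 feedback_progressive fnorm om i k0 kk.
have e2 : \int[lam]_(s in `[k%:R * h, k.+1%:R * h]) feedback s om ord0 i = (gvel (feedback_cell k om)) ord0 i * h.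
  rewrite -[in RHS]hh; apply: Rint_itvco_cst => //.
    exact: (jbm om k0 (lexx _) (control_jm fF feedback_progressive i (le_trans k0 kk)) (control_jb fnorm (T:=_) i)).
  by move=> t tk; rewrite (feedback_step om tk).
rewrite e2 IH in e1.
have -> : X (k.+1%:R * h) om 0 i = X (k.+1%:R * h) om ord0 i by [].
have -> : X (k.+1%:R * h) om ord0 i = feedback_pos k om ord0 i + (gvel (feedback_cell k om) ord0 i * h + sigma * (w (k.+1%:R * h) om ord0 i - w (k%:R * h) om ord0 i)).
  by rewrite -e1; ring.
rewrite /feedback_pos /= -/(feedback_pos k om) -/(feedback_cell k om); set y := gvel _; rewrite !mxE; ring.
Qed.

Section cost.
Context (L : phase R n -> R) (u : Z -> R) (lam0 U C eps : R).
Hypotheses (cL : continuous L) (C0 : 0 <= C) (eps0 : 0 < eps) (uU : forall x, 0 <= u x <= U)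
  (Hc : forall x, h * L (lift (grid R (p * q) x, gvel x)) + u (x + V x) - u x <= h * (lam0 + 2 * eps))
  (Hd : forall x e s, 0 <= s -> `|grid R (p * q) e| <= (p * q)%:R^-1 + s ->
         u (x + e) <= u x + eps * h + C * s)
  (He : forall (x y v : 'rV[R]_n) s, 0 <= s -> `|v| <= M%:R -> `|x - y| <= (1 + M%:R) * h + s ->
         L (lift (y, v)) <= L (lift (x, v)) + 2 * eps + C * s).

Let m0 : (0 < p * q)%N. Proof. by rewrite muln_gt0 p0. Qed.
Let mR : 0 < (p * q)%:R :> R. Proof. by rewrite ltr0n. Qed.
Let mS : (p * q)%:R = m'.+1%:R :> R. Proof. by rewrite prednK. Qed.

Lemma grid_coord (z : Z) i : grid R (p * q) z ord0 i = (z ord0 i)%:~R / (p * q)%:R.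
Proof. by rewrite /grid /intv !mxE mulrC. Qed.

Lemma cell_coord (x : 'rV[R]_n) i : (cell x ord0 i)%:~R <= (p * q)%:R * x ord0 i < (cell x ord0 i)%:~R + 1.
Proof.
rewrite mS /cell /gridfl mxE; have /andP[h1 h2] := floor_itv (m'.+1%:R * x ord0 i).
by rewrite h1; move: h2; rewrite intrD mulr1z.
Qed.

Lemma cell_close (x : 'rV[R]_n) : `|grid R (p * q) (cell x) - x| <= (p * q)%:R^-1.
Proof.
apply: norm_rV_le => [|i]; first by rewrite invr_ge0 ltW.
rewrite rVB grid_coord; have /andP[h1 h2] := cell_coord x i.
have -> : (cell x ord0 i)%:~R / (p * q)%:R - x ord0 i = ((cell x ord0 i)%:~R - (p * q)%:R * x ord0 i) / (p * q)%:R.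
  by move: (lt0r_neq0 mR); move: (p * q)%:R => mm mm0; field.
rewrite normrM [X in _ * X]gtr0_norm ?invr_gt0// ler_piMl ?invr_ge0 ?(ltW mR)//.
rewrite ler_norml; apply/andP; split; lra.
Qed.

(** A lattice displacement moves the cell by exactly itself, so only [b] and the rounding, at most
    one mesh, contribute. Rounding errors therefore do not depend on the speed. *)
Lemma cell_jump (y b : 'rV[R]_n) z :
  `|grid R (p * q) (cell (y + grid R (p * q) z + b) - (cell y + z))| <= (p * q)%:R^-1 + `|b|.
Proof.
apply: norm_rV_le => [|i]; first by rewrite addr_ge0// invr_ge0 ltW.
set y' := y + _ + b.
have /andP[h1 h2] := cell_coord y i; have /andP[h3 h4] := cell_coord y' i.
have e : (p * q)%:R * y' ord0 i = (p * q)%:R * y ord0 i + (z ord0 i)%:~R + (p * q)%:R * b ord0 i.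
  have -> : y' ord0 i = y ord0 i + grid R (p * q) z ord0 i + b ord0 i by rewrite /y' mxE [X in X + _]mxE.
  by rewrite grid_coord; move: (lt0r_neq0 mR); move: (p * q)%:R => mm mm0; field.
rewrite e in h3 h4.
rewrite grid_coord introwB introwD !intrB intrD.
set c := _ - _; have hc : `|c - (p * q)%:R * b ord0 i| <= 1.
  by rewrite ler_norml /c; apply/andP; split; lra.
rewrite normrM [X in _ * X]gtr0_norm ?invr_gt0// ler_pdivrMr// mulrDl mulVf ?gt_eqF//.
have hb : (p * q)%:R * `|b ord0 i| <= `|b| * (p * q)%:R by rewrite mulrC ler_pM2r//; exact: coord_le_norm.
have : `|c| <= `|c - (p * q)%:R * b ord0 i| + `|(p * q)%:R * b ord0 i|.
  by rewrite -{1}[c](subrK ((p * q)%:R * b ord0 i)) ler_normD.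
rewrite normrM gtr0_norm//; lra.
Qed.

Let scale (z : Z) : grid R (p * q) z = h *: grid R q z.
Proof. by rewrite /grid natrM invfM scalerA mulrC. Qed.

Lemma feedback_posS k om : feedback_pos k.+1 om =
  feedback_pos k om + grid R (p * q) (V (feedback_cell k om)) + sigma *: (w (k.+1%:R * h) om - w (k%:R * h) om).
Proof.
rewrite scale.
change (feedback_drift k om + h *: gvel (feedback_cell k om) + sigma *: w (k.+1%:R * h) om =
  feedback_drift k om + sigma *: w (k%:R * h) om + h *: gvel (feedback_cell k om) +
  sigma *: (w (k.+1%:R * h) om - w (k%:R * h) om)).
by rewrite scalerBr; apply/rowP => i; rewrite !mxE; ring.
Qed.

Let costX t om := L (lift (X t om, feedback t om)).

Lemma cost_jm T : 0 <= T -> jm T costX.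
Proof.
move=> T0; apply: lift_jm => // i.
  exact: (diffusion_jm fF bw sigma 0 feedback_progressive fnorm).
exact: (progressive_jm fF i T0 feedback_progressive).
Qed.

Lemma cost_jb : exists B, forall T, jb T B costX.
Proof.
have [B HB] := phase_bounded M%:R cL.
by exists B => T t om _; apply: HB; exact: feedback_norm.
Qed.

(** Of the [5 * eps], two come from the near-optimality of [V], two from replacing the moving point
    by its lattice cell inside [L], and one from the rounding of the next cell inside [u]. The
    values of [u] are left to telescope. *)
Lemma cost_step k om :
  \int[lam]_(t in `[k%:R * h, k.+1%:R * h]) costX t om <=
  u (feedback_cell k om) - u (feedback_cell k.+1 om) + h * (lam0 + 5 * eps) + C * sigma * noise w h k om.
Proof.
have k0 : 0 <= k%:R * h by rewrite mulr_ge0// ltW.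
have kk : k%:R * h <= k.+1%:R * h by rewrite ler_pM2r// ler_nat.
have hh : k.+1%:R * h - k%:R * h = h by rewrite -mulrBl -natr1 addrAC subrr add0r mul1r.
have T0 := le_trans k0 kk.
have [B HB] := cost_jb.
have bC : bm `[k%:R * h, k.+1%:R * h] (costX ^~ om).
  exact: (jbm om k0 (lexx _) (cost_jm T0) (HB _)).
have bw' := increment_bm fF bw om k0 kk.
set x := feedback_cell k om.
pose c := L (lift (grid R (p * q) x, gvel x)) + 2 * eps.
have bg := bmD (bm_cst `[k%:R * h, k.+1%:R * h] c) (bmZ (C * sigma) bw').
have mI : measurable (`[k%:R * h, k.+1%:R * h]%classic : set R) by exact: measurable_itv.
have h1 : \int[lam]_(t in `[k%:R * h, k.+1%:R * h]) costX t om <=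
   \int[lam]_(t in `[k%:R * h, k.+1%:R * h]) (c + C * sigma * `|w t om - w (k%:R * h) om|).
  apply: (Rint_itvco kk bC bg) => t tk.
  rewrite /costX (feedback_step om tk) /c -mulrA.
  apply: He; [by rewrite mulr_ge0// ltW|exact: gvel_norm|].
  case/andP: tk => tk1 tk2.
  have e1 : `|grid R (p * q) x - feedback_pos k om| <= h.
    apply: le_trans (cell_close _) _; rewrite natrM invfM ler_piMr ?(ltW h0)//.
    by rewrite invf_le1 ?ltr0n// ler1n.
  have e2 : `|feedback_pos k om - X t om| <= M%:R * h + sigma * `|w t om - w (k%:R * h) om|.
    rewrite -feedback_diffusion distrC; apply: norm_rV_le => [|i].
      by rewrite addr_ge0 ?mulr_ge0// ltW.
    rewrite rVB (diffusionB w fF sigma 0 feedback_progressive fnorm om i k0 tk1).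
    apply: le_trans (ler_normD _ _) _; apply: lerD.
      apply: le_trans (drift_bound fF feedback_progressive fnorm om i k0 tk1) _.
      by rewrite ler_wpM2l//; lra.
    by rewrite normrM gtr0_norm// ler_pM2l// -rVB; exact: coord_le_norm.
  have -> : grid R (p * q) x - X t om = (grid R (p * q) x - feedback_pos k om) + (feedback_pos k om - X t om) by rewrite addrA subrK.
  by apply: le_trans (ler_normD _ _) _; lra.
rewrite RintegralD// in h1; [|by apply: bm_integrable => //; [exact: itv_fin|exact: bm_cst]|by apply: bm_integrable => //; [exact: itv_fin|exact: bmZ]].
rewrite Rint_itv_cst// hh RintegralZl// in h1; last by apply: bm_integrable => //; exact: itv_fin.
have h2 := Hc x.
have h3 : u (feedback_cell k.+1 om) <= u (x + V x) + eps * h + C * (sigma * `|w (k.+1%:R * h) om - w (k%:R * h) om|).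
  have := @Hd (x + V x) (feedback_cell k.+1 om - (x + V x)) (sigma * `|w (k.+1%:R * h) om - w (k%:R * h) om|).
  rewrite [x + V x + _]addrC subrK; apply; first by rewrite mulr_ge0// ltW.
  have := cell_jump (feedback_pos k om) (sigma *: (w (k.+1%:R * h) om - w (k%:R * h) om)) (V x).
  have e : `|sigma *: (w (k.+1%:R * h) om - w (k%:R * h) om)| = sigma * `|w (k.+1%:R * h) om - w (k%:R * h) om|.
    by rewrite normrZ gtr0_norm.
  by rewrite -feedback_posS e.
rewrite /noise; set I1 := Rintegral _ _ _ in h1 *; set I2 := Rintegral _ _ _ in h1 *.
rewrite /c in h1; lra.
Qed.

Lemma cost_path N om : \int[lam]_(t in `[0, N%:R * h]) costX t om <=
  U + N%:R * h * (lam0 + 5 * eps) + C * sigma * \sum_(k < N) noise w h k om.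
Proof.
suff H : \int[lam]_(t in `[0, N%:R * h]) costX t om <=
    u (feedback_cell 0 om) - u (feedback_cell N om) + N%:R * h * (lam0 + 5 * eps) + C * sigma * \sum_(k < N) noise w h k om.
  by apply: le_trans H _; have /andP[_ h1] := uU (feedback_cell 0 om); have /andP[h2 _] := uU (feedback_cell N om); lra.
elim: N => [|N IH].
  by rewrite mul0r set_itv1 Rintegral_set1 big_ord0 subrr !mul0r mulr0 !addr0.
have a0 : 0 <= N%:R * h by rewrite mulr_ge0// ltW.
have ab : N%:R * h <= N.+1%:R * h by rewrite ler_pM2r// ler_nat.
have b0 := le_trans a0 ab.
have [B HB] := cost_jb.
rewrite (@Rint_split _ (costX ^~ om) 0 (N%:R * h))//; last first.
  exact: (jb_integrable om (lexx 0) (lexx _) (cost_jm b0) (HB _)).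
have h2 := cost_step N om.
rewrite big_ord_recr/=; set I1 := Rintegral _ _ _ in IH *; set I2 := Rintegral _ _ _ in h2 *.
rewrite -natr1; lra.
Qed.

(** The boundary term [U] costs a sixth [eps] after division by the time. There are [p] noise terms
    per unit of time, whence the factor [p]. *)
Lemma cost_average N : (0 < N)%N -> U <= eps * (N%:R * h) ->
  (N%:R * h)^-1 * (\int[P]_om \int[lam]_(t in `[0, N%:R * h]) costX t om) <=
  lam0 + 6 * eps + sigma * (C * p%:R * (n%:R * 6)).
Proof.
move=> N0 UN; have T0 : 0 < N%:R * h by rewrite mulr_gt0// ltr0n.
have [B HB] := cost_jb.
have bI : bm setT (fun om => \int[lam]_(t in `[0, N%:R * h]) costX t om).
  exact: (jb_Rint_bm P (lexx 0) (ltW T0) (lexx _) (cost_jm (ltW T0)) (HB _)).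
have h1 : h <= 1 by rewrite invf_le1 ?ltr0n// ler1n.
have H := expect_le_noise fF bw bI (mulr_ge0 C0 (ltW s0)) h0 h1 (cost_path N).
rewrite [leLHS]mulrC ler_pdivrMr//; apply: le_trans H _.
have -> : (lam0 + 6 * eps + sigma * (C * p%:R * (n%:R * 6))) * (N%:R * h) =
  eps * (N%:R * h) + N%:R * h * (lam0 + 5 * eps) + C * sigma * (N%:R * (n%:R * 6)) * (p%:R * h) by ring.
by rewrite ph mulr1 !lerD2r.
Qed.

Theorem feedback_limit_measure (g : R -> R) : weight_for L g -> (forall p, 0 <= L p) ->
  exists mu : wmeasure n g, [/\ limit_measures P F w sigma mu, is_prob (smeasure_of mu) &
    (charge_integral (smeasure_of mu) L <= (lam0 + 6 * eps + sigma * (C * p%:R * (n%:R * 6)))%:E)%E].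
Proof.
move=> wL L0.
have [N0 HN0] := natr_large (U * p%:R / eps).
(* Times are multiples of the step, so that no incomplete step occurs, and start late enough for
   [cost_average] to apply to all of them. *)
pose T k : R := (k + N0.+1)%:R * h.
have T0 k : 0 < T k by rewrite mulr_gt0// ltr0n addnS.
have TU k : U <= eps * T k.
  rewrite /T mulrCA mulrC; rewrite ltr_pdivrMr// in HN0.
  have h1 : U * p%:R <= (k + N0.+1)%:R * eps.
    apply: le_trans (ltW HN0) _; rewrite ler_pM2r// ler_nat leq_addl//.
  have := ler_wpM2r (ltW h0) h1; rewrite -mulrA ph mulr1 => h2; apply: le_trans h2 _.
  by rewrite le_eqVlt; apply/orP; left; apply/eqP; ring.
have /choice[Q HQ] k : exists Q : probability (bphase R n) R, forall f : phase R n -> R, continuous f ->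
    (\int[Q]_p (f p)%:E =
     ((T k)^-1 * \int[P]_om \int[lam]_(t in `[0, T k]) f (lift (X t om, feedback t om)))%:E)%E.
  apply: (@occupation_prob _ _ _ _ P (T k) M%:R X feedback (T0 k)).
  - by move=> i; exact: (diffusion_jm fF bw sigma 0 feedback_progressive fnorm).
  - by move=> i; exact: (progressive_jm fF i (ltW (T0 k)) feedback_progressive).
  - by move=> t om _; exact: feedback_norm.
set B := lam0 + 6 * eps + sigma * (C * p%:R * (n%:R * 6)).
have QB k : (\int[Q k]_p (L p)%:E <= B%:E)%E.
  by rewrite HQ// lee_fin; apply: cost_average (TU k); rewrite addnS.
have [j [Q' [jm Q'B cvQ]]] := prob_compactness wL L0 cL QB.
have /choice[m Hm] k := wmeasure_of_prob (weight_integral wL L0 cL (QB (j k))).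
have [mu [pmu _ Imu]] := wmeasure_of_prob (weight_integral wL L0 cL Q'B).
exists mu; split=> //; last by rewrite Imu.
exists 0, feedback, (T \o j), m; split.
- exact: feedback_bounded.
- split; first by move=> k; exact: T0.
  apply/cvgryPge => A; have [K HK] := natr_large (A * p%:R).
  exists K.+1 => // k /= Kk; rewrite /T ler_pdivlMr//.
  apply: le_trans (ltW HK) _; rewrite ler_nat.
  by apply: leq_trans (leq_addr _ _); apply: leq_trans (increasing_ge jm k).
- move=> k phi Cphi; have [_ _ ->] := Hm k.
  have cphi : continuous phi by case: Cphi.
  rewrite (HQ (j k) phi cphi) EFinM unlock EFin_Rint//; apply: bm_integrableT.
  apply: (Rint_lift_bm P (T0 (j k)) (C := M%:R)) => //.
  + by move=> i; exact: (diffusion_jm fF bw sigma 0 feedback_progressive fnorm).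
  + by move=> i; exact: (progressive_jm fF i (ltW (T0 _)) feedback_progressive).
  + by move=> t om _; exact: feedback_norm.
- apply: wmeasure_cvg => phi Cphi.
  rewrite Imu (_ : (fun k => _) = (fun k => \int[Q (j k)]_p phi p)); first exact: cvQ.
  by apply/funext => k; have [_ _ ->] := Hm k.
Qed.

End cost.
End feedback.

(** * Passage to the limit *)

Section final.
Context (R : realType) (n : nat) (L : phase R n -> R) (g : R -> R)
  (d : measure_display) (W : measurableType d) (P : probability W R)
  (F : R -> set (set W)) (w : R -> W -> 'rV[R]_n).
Hypotheses (lL : lagrangian L) (wL : weight_for L g) (fF : filtration F) (bw : brownian P F w).
Local Notation pair f mu := (fine (charge_integral (smeasure_of mu) f)).

Lemma lagrangian_continuous : continuous L.
Proof. by have [sL _ _ _] := lL; apply/phase_continuousP; exact: (sL [::]).1. Qed.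

Let cL := lagrangian_continuous.
Let L0 : forall p, 0 <= L p. Proof. by case: lL. Qed.
Let Linf : (L p / enorm p.2) @[p --> @vinfty R n] --> +oo. Proof. by case: lL. Qed.

Lemma limit_measures_M0 sigma (mu : wmeasure n g) : limit_measures P F w sigma mu -> M0 P F w sigma mu.
Proof. exact: subset_closure. Qed.

(** If the cost of [nu] is finite, it dominates the integrand [hol phi], whose integral vanishes by
    holonomy; otherwise there is nothing to prove. *)
Lemma holonomic_lower_bound (nu : smeasure R n) (phi : torus R n -> R) (a : R) :
  is_prob nu -> holonomic nu -> smooth (phi \o @to_torus R n) ->
  (forall p, a <= L p + hol phi p) -> (a%:E <= charge_integral nu L)%E.
Proof.
move=> pnu hnu sphi aL; have [Q [_ IQ]] := prob_charge pnu; rewrite IQ.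
have I0 : (0 <= \int[Q]_p (L p)%:E)%E by apply: integral_ge0 => p _; rewrite lee_fin.
case: (eqVneq (\int[Q]_p (L p)%:E)%E +oo%E) => [->|fin]; first exact: leey.
have fI : (\int[Q]_p (L p)%:E)%E \is a fin_num by rewrite ge0_fin_numE// ltey.
have LC : (\int[Q]_p (L p)%:E <= (fine (\int[Q]_p (L p)%:E))%:E)%E by rewrite fineK.
have iL := L_integrable L0 cL LC.
have iH := C0w_integrable wL L0 cL (hol_C0w wL sphi) LC.
have H0 : \int[Q]_p hol phi p = 0.
  by have := hnu phi sphi; rewrite IQ => e; rewrite /Rintegral -[X in fine X]/(\int[Q]_p (hol phi p)%:E)%E e.
rewrite (EFin_Rint iL) lee_fin -[leRHS]addr0 -H0 -RintegralD//.
rewrite -[leLHS](Rint_prob_cst Q); apply: le_Rintegral => //.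
  exact/bm_integrableT/bm_cst.
by have := integrableD measurableT iL iH; apply: eq_integrable => // p _; rewrite /= EFinD.
Qed.

(** Dividing [eps] by 12 turns both losses [6 * eps] into half of the allowance; in the upper bound
    the other half is left for the noise term, proportional to [sigma]. *)
Lemma near_optimal (eps : R) : 0 < eps -> exists (lam sig0 : R), [/\ 0 < sig0,
  (forall nu : smeasure R n, is_prob nu -> holonomic nu -> ((lam - eps)%:E <= charge_integral nu L)%E) &
  forall sigma, 0 < sigma -> sigma < sig0 -> exists mu : wmeasure n g,
    [/\ M0 P F w sigma mu, is_prob (smeasure_of mu) & (charge_integral (smeasure_of mu) L <= (lam + eps)%:E)%E]].
Proof.
move=> eps0; have e0 : 0 < eps / 12 by rewrite divr_gt0.
have [p [q [M [u [V [lam [U [C [[p0 q0 C0] [phi sphi Hphi] uU VM [Hc Hd He]]]]]]]]]] := corrector cL L0 Linf e0.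
pose D : R := C * p%:R * (n%:R * 6).
have D0 : 0 <= D by rewrite !mulr_ge0.
exists lam, (eps / 2 / (D + 1)); split.
- by rewrite divr_gt0 ?divr_gt0// ltr_wpDl.
- move=> nu pnu hnu; apply: (holonomic_lower_bound pnu hnu sphi) => x.
  by apply: le_trans (Hphi x); lra.
- move=> sigma s0; rewrite ltr_pdivlMr ?ltr_wpDl// => sD.
  have [mu [lmu pmu Lmu]] := feedback_limit_measure fF bw p0 q0 s0 VM cL C0 e0 uU Hc Hd He wL L0.
  exists mu; split=> //; first exact: limit_measures_M0.
  apply: le_trans Lmu _; rewrite lee_fin -/D; lra.
Qed.

Lemma excess_small (a : R) : 0 < a -> exists2 K, 0 <= K & forall p : phase R n, excess K p <= a * L p.
Proof.
move=> a0; have [K HK] := vinfty_pinfty Linf a^-1.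
exists (Num.max 1 K) => [|p]; first by rewrite le_max ler01.
have Lp : 0 <= a * L p by rewrite mulr_ge0// ltW.
rewrite /excess ge_max Lp/=.
case: (leP (enorm p.2) (Num.max 1 K)) => h; first by lra.
move: (h); rewrite gt_max => /andP[h1 h2].
have := HK p h2; rewrite ler_pdivlMr; last lra.
rewrite ler_pdivrMl//; have : 1 <= Num.max 1 K by rewrite le_max lexx.
lra.
Qed.

Theorem stochastic_mather_limit (mu_ : R -> wmeasure n g) :
  (forall sigma : R, 0 < sigma -> stochastic_mather P L F w sigma (mu_ sigma)) ->
  forall sigma_ : nat -> R,
    (forall k, 0 < sigma_ k) -> sigma_ k @[k --> \oo] --> 0 ->
    exists (j : nat -> nat) (mu : wmeasure n g),
      [/\ {homo j : k l / (k < l)%N},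
          mu_ (sigma_ (j k)) @[k --> \oo] --> mu
        & mather L (smeasure_of mu)].
Proof.
move=> Hmu s_ s0 slim.
have opt (eps : R) : 0 < eps -> exists lam : R, exists2 N : nat,
    forall nu : smeasure R n, is_prob nu -> holonomic nu -> ((lam - eps)%:E <= charge_integral nu L)%E &
    forall k, (N <= k)%N -> (charge_integral (smeasure_of (mu_ (s_ k))) L <= (lam + eps)%:E)%E.
  move=> eps0; have [lam [sig0 [sig00 low up]]] := near_optimal eps0.
  have sig2 : 0 < sig0 / 2 by rewrite divr_gt0.
  have [N HN] := (seq_cvgP _ _).1 slim _ sig2.
  exists lam, N => // k Nk; have := HN k Nk; rewrite subr0 gtr0_norm// => sk.
  have [mu [Mmu pmu Lmu]] := up (s_ k) (s0 k) ltac:(lra).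
  have [_ _ mini] := Hmu (s_ k) (s0 k).
  by apply: le_trans Lmu; exact: mini.
have [lam1 [N1 _ HB]] := opt 1 ltr01.
set B := lam1 + 1 in HB.
have pr k : is_prob (smeasure_of (mu_ (s_ k))) by have [] := Hmu (s_ k) (s0 k).
(* The cost bound holds only for small [sigma]; shifting by [N1] makes it valid along the whole
   sequence. *)
have /choice[Q HQ] k := prob_charge (pr (k + N1)%N).
have QB k : (\int[Q k]_p (L p)%:E <= B%:E)%E.
  by have [_ <-] := HQ k; apply: HB; exact: leq_addl.
have [j [Q' [jm Q'B cvQ]]] := prob_compactness wL L0 cL QB.
have [mu [pmu _ Imu]] := wmeasure_of_prob (weight_integral wL L0 cL Q'B).
have jk k : (k <= j k)%N by exact: increasing_ge jm k.
have pairQ k f : pair f (mu_ (s_ (j k + N1)%N)) = \int[Q (j k)]_p f p.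
  by have [_ ->] := HQ (j k).
exists (fun k => (j k + N1)%N), mu; split.
- by move=> k l kl; rewrite ltn_add2r; exact: jm.
- apply: wmeasure_cvg => f Cf; rewrite Imu.
  rewrite (_ : (fun k => _) = (fun k => \int[Q (j k)]_p f p)); first exact: cvQ.
  by apply/funext => k; rewrite pairQ.
split=> //.
- move=> phi sphi; rewrite -[charge_integral _ _]/(charge_integral (smeasure_of mu) (hol phi)) Imu.
  have CH := hol_C0w wL sphi.
  rewrite (EFin_Rint (C0w_integrable wL L0 cL CH Q'B)); congr EFin.
  apply/eqP; rewrite -normr_le0; apply/ler_addgt0Pr => e e0; rewrite add0r.
  have [C [D [C0 D0 HCD]]] := M0_holonomy fF bw wL sphi.
  have B0 : 0 <= B.
    by rewrite -lee_fin; apply: le_trans (QB 0%N); apply: integral_ge0 => p _; rewrite lee_fin.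
  have DB : 0 < D * B + 1 by rewrite ltr_wpDl// mulr_ge0.
  (* [K] makes the contribution of large velocities at most [e / 2] for all the measures, thanks to
     their common cost bound; only then is [sigma] taken small relative to [K]. *)
  have [K K0 HK] := excess_small (a := e / 2 / (D * B + 1)) (divr_gt0 (divr_gt0 e0 (ltr0Sn _ 1)) DB).
  apply: (seq_lim_le_near (cvg_norm (cvQ _ CH))).
  have CK : 0 < C * (K + 1) + 1 by rewrite ltr_wpDl// mulr_ge0// addr_ge0.
  have [N HN] := (seq_cvgP _ _).1 slim _ (divr_gt0 (divr_gt0 e0 (ltr0Sn _ 1)) CK).
  exists N => // k /= Nk; rewrite -pairQ.
  have sk := s0 (j k + N1)%N.
  have Mk : M0 P F w (s_ (j k + N1)%N) (mu_ (s_ (j k + N1)%N)) by have [] := Hmu _ sk.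
  apply: le_trans (HCD K _ _ K0 sk Mk) _; rewrite pairQ.
  have h1 : C * (s_ (j k + N1)%N * (K + 1)) <= e / 2.
    have := HN (j k + N1)%N (leq_trans Nk (leq_trans (jk k) (leq_addr _ _))).
    rewrite subr0 gtr0_norm// ler_pdivlMr//; lra.
  have a0 : 0 <= e / 2 / (D * B + 1) by rewrite divr_ge0 ?divr_ge0// ltW.
  have mE : measurable_fun setT (excess K : bphase R n -> R).
    by apply: phase_continuous_measurable; have [] := excess_C0w wL K0.
  have hE p : `|excess K p| <= e / 2 / (D * B + 1) * (L p + 0).
    by rewrite addr0 ger0_norm// /excess le_max lexx.
  have [_ h2] := Rint_dominated L0 cL (QB (j k)) mE a0 (lexx 0) hE.
  have h3 : D * \int[Q (j k)]_p excess K p <= D * (e / 2 / (D * B + 1) * (B + 0)).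
    by rewrite ler_wpM2l// (le_trans (ler_norm _)).
  have h4 : D * (e / 2 / (D * B + 1) * (B + 0)) <= e / 2.
    have -> : D * (e / 2 / (D * B + 1) * (B + 0)) = e / 2 * (D * B) / (D * B + 1) by ring.
    by rewrite ler_pdivrMr// ler_pM2l ?divr_gt0//; lra.
  lra.
- move=> nu pnu hnu; rewrite Imu.
  have nu0 : (0 <= charge_integral nu L)%E.
    by have [Qn [_ ->]] := prob_charge pnu; apply: integral_ge0 => p _; rewrite lee_fin.
  case: (eqVneq (charge_integral nu L) +oo%E) => [->|fin]; first exact: leey.
  have fI : charge_integral nu L \is a fin_num by rewrite ge0_fin_numE// ltey.
  pose r := fine (charge_integral nu L).
  have Enu : charge_integral nu L = r%:E by rewrite fineK.
  rewrite Enu; apply/lee_addgt0Pr => e e0.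
  have [lam [N low up]] := opt (e / 2) (divr_gt0 e0 (ltr0Sn _ 1)).
  have := low nu pnu hnu; rewrite Enu lee_fin => lr.
  (* Both bounds refer to the same [lam]: [lam - e / 2] is below the cost [r] of [nu], and the costs
     along the sequence are at most [lam + e / 2]. *)
  have key k : (N <= k)%N -> (\int[Q (j k)]_p (L p)%:E <= (r + e)%:E)%E.
    move=> Nk; have [_ <-] := HQ (j k).
    apply: le_trans (up (j k + N1)%N (leq_trans Nk (leq_trans (jk k) (leq_addr _ _)))) _.
    by rewrite lee_fin; lra.
  (* [L] outgrows the weight and is not a test function, whereas its truncations are bounded and
     continuous. *)
  pose hN (N : nat) p := Num.min (L p) N%:R.
  have hC N' : C0w g (hN N').
    apply: (C0w_linear wL (B := N'%:R)).
      by apply: continuous_min_fun => //; exact: cst_continuous_phase.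
    move=> p; rewrite /hN ger0_norm; last by rewrite le_min L0/=.
    apply: (@le_trans _ _ N'%:R); first by rewrite ge_min lexx orbT.
    by rewrite ler_peMr// lerDl enorm_ge0.
  rewrite -EFinD; apply: (@mono_int_le _ _ _ Q' hN).
  + by move=> N'; apply: phase_continuous_measurable; have [] := hC N'.
  + by move=> N' p; rewrite /hN le_min L0/=.
  + by move=> p N' N'' NN; rewrite /hN le_min ge_min lexx/= ge_min ler_nat NN orbT.
  + move=> p; have [N' HN'] := natr_large (L p); exists N'.+1 => N'' NN.
    rewrite /hN min_l// ltW//; apply: lt_le_trans HN' _; by rewrite ler_nat.
  + move=> N'; rewrite (EFin_Rint (C0w_integrable wL L0 cL (hC N') Q'B)) lee_fin.
    apply: (seq_lim_le_near (cvQ _ (hC N'))); exists N => // k /= Nk.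
    rewrite -lee_fin -(EFin_Rint (C0w_integrable wL L0 cL (hC N') (QB _))).
    apply: le_trans (key k Nk); apply: ge0_le_integral => //.
    * by move=> p _; rewrite lee_fin /hN le_min L0/=.
    * by apply/measurable_EFinP; apply: phase_continuous_measurable; have [] := hC N'.
    * by apply/measurable_EFinP; exact: phase_continuous_measurable.
    * by move=> p _; rewrite lee_fin /hN ge_min lexx.
Qed.

End final.

Theorem mainTheorem11 (R : realType) (n : nat)
  (L : phase R n -> R) (g : R -> R)
  (d : measure_display) (W : measurableType d) (P : probability W R)
  (F : R -> set (set W)) (w : R -> W -> 'rV[R]_n)
  (mu_ : R -> wmeasure n g) :
  lagrangian L -> weight_for L g ->
  filtration F -> brownian P F w ->
  (forall sigma : R, 0 < sigma -> stochastic_mather P L F w sigma (mu_ sigma)) ->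
  forall sigma_ : nat -> R,
    (forall k, 0 < sigma_ k) -> sigma_ k @[k --> \oo] --> 0 ->
    exists (j : nat -> nat) (mu : wmeasure n g),
      [/\ {homo j : k l / (k < l)%N},
          mu_ (sigma_ (j k)) @[k --> \oo] --> mu
        & mather L (smeasure_of mu)].
Proof. by move=> lL wL fF bw; exact: stochastic_mather_limit. Qed.
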